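(* Let $p\in\mathbb{N}$ and let $(X_i,\varepsilon_i)_{i=1}^n$ be independent copies of $(X,\varepsilon)$ with $X\in[0,1]^p$, $\varepsilon\in\mathbb{R}$, $\mathbb{E}[\varepsilon\mid X]=0$. Assume $X$ has a density $f_X$ with $0<c_X\le f_X\le C_X$ on $[0,1]^p$ and $\sigma^2(x)=\mathrm{Var}(\varepsilon\mid X=x)$ satisfies $0<c_{\sigma^2}\le\sigma^2\le C_{\sigma^2}$. Let $\delta=\delta_n\to0$ with $\delta^{-1}\in\mathbb{N}$ and $\log\delta^{-1}=\mathcal{O}(\log n)$. Assume $\sup_{x\in[0,1]^p}\mathbb{E}[|\varepsilon|^3\mid X=x]<\infty$ and $\mathbb{E}[|\varepsilon|^\nu]<\infty$ for some $\nu\in[4,\infty)$. Define $p_\delta(x)=\mathbb{P}(X\in A_\delta(x))$, $\tau_\delta(x)=p_\delta(x)^2/\mathbb{E}[\sigma^2(X)\mathbb{I}_{A_\delta(x)}(X)]$ and $$\tilde m^{(\varepsilon)}(x)=\frac1n\sum_{j=1}^n\varepsilon_j\,p_\delta(x)^{-1}\mathbb{I}\{X_j\in A_\delta(x)\}.$$ Then there exists a sequence of random variables $\mathbf{S}_\delta$ with $\mathbf{S}_\delta\overset{d}{=}\max_{j=1,\dots,\delta^{-p}}|Z_j|$ for independent standard normal $(Z_j)_{j\in\mathbb{N}}$ such that $$\Big|\sqrt n\sup_{x\in[0,1]^p}|\tau_\delta(x)^{1/2}\tilde m^{(\varepsilon)}(x)|-\mathbf{S}_\delta\Big|=\mathcal{O}_{\mathbb{P}}\Big(\frac{(\log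 n)^{3/2}}{\delta^{p/2}n^{1/2-1/\nu}}+\frac{(\log n)^{5/4}}{\delta^{p/4}n^{1/4}}+\frac{\log n}{\delta^{p/6}n^{1/6}}\Big).$$
   Context: For $\delta^{-1}\in\mathbb{N}$, $[0,1]^p$ is partitioned by the equidistant grid of edge length $\delta$ into $\delta^{-p}$ hypercubes of volume $\delta^p$; $A_\delta(x)$ denotes the hypercube of this partition containing $x$. The random variables $\mathbf{S}_\delta$ may be constructed on a (possibly enlarged) probability space together with the data. *)

(* Defs.v *)
From HB Require Import structures.
From mathcomp Require Import all_boot all_order all_algebra.
From mathcomp Require Import all_classical all_reals all_analysis.
Set Implicit Arguments. Unset Strict Implicit. Unset Printing Implicit Defensive.
Import Order.TTheory GRing.Theory Num.Theory.
Import numFieldNormedType.Exports.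
Local Open Scope classical_set_scope.
Local Open Scope ring_scope.

Section defs.
Variable R : realType.

(* the unit hypercube [0,1]^p, points of R^p being p.-tuples
   (p.-tuple R carries the product (= Borel) sigma-algebra of the library) *)
Definition cube (p : nat) : set (p.-tuple R) :=
  [set x | forall i : 'I_p, 0 <= tnth x i <= 1].

(* Lebesgue integral over R^p of a nonnegative function, computed as the
   iterated one-dimensional Lebesgue integral (Tonelli). *)
Fixpoint iint (p : nat) : (p.-tuple R -> \bar R) -> \bar R :=
  match p return (p.-tuple R -> \bar R) -> \bar R with
  | 0 => fun g => g [tuple]
  | q.+1 => fun g =>
      (\int[@lebesgue_measure R]_t iint (fun x : q.-tuple R => g [tuple of t :: x]))%E
  end.

Definition delta (k : nat) : R := (k%:R)^-1.

(* index (0..k-1) of the grid interval of edge 1/k containing r in [0,1];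
   intervals [a/k,(a+1)/k), the last one closed *)
Definition cellidx (k : nat) (r : R) : int :=
  if r < 1 then Num.floor (r * k%:R) else (k%:Z - 1)%R.

Definition Acell (p k : nat) (x : p.-tuple R) : set (p.-tuple R) :=
  [set y | cube y /\ forall i : 'I_p, cellidx k (tnth y i) = cellidx k (tnth x i)].

Context {d : measure_display} {T : measurableType d}.
Variable P : probability T R.

Definition cond_exp {d'} {U : measurableType d'} (X : T -> U) (Y : T -> R)
    (g : U -> R) : Prop :=
  [/\ P.-integrable setT (EFin \o Y),
      measurable_fun setT g,
      P.-integrable setT (EFin \o (g \o X)) &
      forall B : set U, measurable B ->
        ('E_P[fun w => (Y w * \1_B (X w))%R] =
         'E_P[fun w => (g (X w) * \1_B (X w))%R])%E].

Definition cond_var {d'} {U : measurableType d'} (X : T -> U) (Y : T -> R)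
    (s : U -> R) : Prop :=
  exists m : U -> R, cond_exp X Y m /\
    cond_exp X (fun w => (Y w - m (X w)) ^+ 2) s.

Definition mutually_independent {d'} {U : measurableType d'}
    (Y : nat -> T -> U) : Prop :=
  forall (s : seq nat) (B : nat -> set U), uniq s ->
    (forall i, measurable (B i)) ->
    P [set w | forall i, i \in s -> B i (Y i w)] =
    (\big[*%E/1%E]_(i <- s) P (Y i @^-1` B i))%E.

Definition is_OP (Y : nat -> T -> R) (r : nat -> R) : Prop :=
  forall eta : R, 0 < eta -> exists M : R, exists N : nat,
    forall n, (N <= n)%N -> (P [set w | (M * r n < `|Y n w|)%R] <= eta%:E)%E.

End defs.

Section stat.
Variable R : realType.
Context {d : measure_display} {T : measurableType d}.
Variable P : probability T R.
Variables (p : nat) (X : T -> p.-tuple R) (sig2 : p.-tuple R -> R).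

Definition pdelta (k : nat) (x : p.-tuple R) : R := fine (P (X @^-1` Acell k x)).

Definition taudelta (k : nat) (x : p.-tuple R) : R :=
  pdelta k x ^+ 2 /
  fine ('E_P[fun w => (sig2 (X w) * \1_(Acell k x) (X w))%R])%E.

Definition mtilde {T' : Type} (Xs : nat -> T' -> p.-tuple R) (es : nat -> T' -> R)
    (k n : nat) (w : T') (x : p.-tuple R) : R :=
  n%:R^-1 * \sum_(j < n) es j w * (pdelta k x)^-1 * \1_(Acell k x) (Xs j w).

Definition stat {T' : Type} (Xs : nat -> T' -> p.-tuple R) (es : nat -> T' -> R)
    (k n : nat) (w : T') : R :=
  Num.sqrt (n%:R) *
  sup [set `|Num.sqrt (taudelta k x) * mtilde Xs es k n w x| | x in @cube R p].

End stat.

Definition rate (R : realType) (p : nat) (nu : R) (k : nat -> nat) (n : nat) : R :=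
  let l := ln (n%:R : R) in
  let dl := delta R (k n) in
  l `^ (3 / 2) / (dl `^ (p%:R / 2) * n%:R `^ (2^-1 - nu^-1))
  + l `^ (5 / 4) / (dl `^ (p%:R / 4) * n%:R `^ (4^-1))
  + l / (dl `^ (p%:R / 6) * n%:R `^ (6^-1)).

(* Main.v *)
(* With N = k^p cells, sqrt n sup_x |tau^{1/2} m~| is max_c |W_c|, where W is a sum of n i.i.d.
   steps, each moving a single coordinate of R^N: the one indexed by the cell of the observation.

   The maximum is smoothed into smax = lam log sum_c cosh(beta w_c) and the line is cut by a
   spline partition of unity into classes of length about 4. With r the sum of the first and third terms of
   the rate, beta = log n / r and lam = 1 / log n, two points in the same class have maxima at distance
   O(r). The class probabilities of W and of a Gaussian vector Z are compared by Lindeberg's method: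
   a step is replaced by a Gaussian jump of the same variance in the same random coordinate, which
   turns W into a Gaussian vector whose variances are the random cell counts divided by their means;
   these concentrate around 1 by Chernoff's bound. Because log sum cosh has derivative weights of
   total mass 1, the third-order errors carry no factor N, and everything sums up to O(1 / log n).

   Summing over signs bounds the total variation distance between the two class distributions, so a
   maximal coupling of the classes gives P(|max|W| - S| > C r) = O(1 / log n). It is realized for
   every n on one product space: S_n is a conditional quantile transform of an extra uniform
   variable. *)

Require Import Defs.
From HB Require Import structures.
From mathcomp Require Import all_boot all_order all_algebra.
From mathcomp Require Import all_classical all_reals all_analysis.
From mathcomp Require Import measurable_realfun ring lra zify.
Set Implicit Arguments. Unset Strict Implicit. Unset Printing Implicit Defensive.
Import Order.TTheory GRing.Theory Num.Theory.
Import numFieldNormedType.Exports.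
Local Open Scope classical_set_scope.
Local Open Scope ring_scope.


(** * Countable products of a probability *)

(** The two terms of r come from two constraints on beta. Put h = sqrt(N / n). The third moments of
    a step, restricted to one cell, are O(h / n), so n replacements cost lam beta^3 h, which is O(1
    / log n) as soon as r^3 >= (log n)^3 h. The expansion asks for |beta x| <= 1: by Markov's
    inequality of order nu a step exceeds a multiple of h sqrt(log n) n^(1/nu) with probability O(1
    / (n (log n)^2)), and beta times this level is bounded when r >= (log n)^(3/2) n^(1/nu) h. Since
    the Gaussian substitute of a step moves the same random coordinate, every comparison is a Taylor
    expansion in one real variable, weighted by the derivative weight of that coordinate; the price
    is a random variance profile. No anti-concentration of the maximum enters: the coupling asks
    only for the total variation distance between classes, which is attained by test functions whose
    derivatives are bounded uniformly in the number of classes, few splines being active near any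
    point. *)

Definition scons (T : Type) (t : T) (w : nat -> T) : nat -> T :=
  fun i => if i is j.+1 then w j else t.

Lemma integral_prob_cst d (T : measurableType d) (R : realType)
    (P : probability T R) (r : \bar R) : (\int[P]_x cst r x = r)%E.
Proof.
rewrite integral_cst// -[RHS]mule1; congr (_ * _)%E; exact: probability_setT.
Qed.

Section sequence_space.
Context d (T : measurableType d).

Definition coordinate_sets : set (set (nat -> T)) :=
  [set A | exists i (B : set T), measurable B /\ A = (fun w => w i) @^-1` B].

Definition seqspace := g_sigma_algebraType coordinate_sets.

Lemma measurable_coord i : measurable_fun setT (fun w : seqspace => w i).
Proof.
move=> _ B mB; rewrite setTI; apply: sub_sigma_algebra.
by exists i, B.
Qed.

Lemma measurable_seqspace d' (U : measurableType d') (f : U -> seqspace) :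
  (forall i, measurable_fun setT (fun u => f u i)) -> measurable_fun setT f.
Proof.
move=> mf; apply: (@measurability _ _ _ seqspace setT f coordinate_sets) => //.
move=> _ [_ [i [B [mB ->]]] <-].
exact: (mf i).
Qed.

Lemma measurable_scons :
  measurable_fun setT (fun x : T * seqspace => scons x.1 x.2 : seqspace).
Proof.
apply: measurable_seqspace => -[|i] /=; first exact: measurable_fst.
apply: (measurableT_comp (measurable_coord i)); exact: measurable_snd.
Qed.

Definition depends_on (n : nat) (A : set (nat -> T)) := forall w w' : nat -> T,
  (forall i, (i < n)%N -> w i = w' i) -> A w -> A w'.

Definition cylinder : set (set seqspace) :=
  [set A : set seqspace | measurable A /\ exists n, depends_on n A].

Lemma depends_onW n m A : (n <= m)%N -> depends_on n A -> depends_on m A.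
Proof. by move=> nm dA w w' ww'; apply: dA => i ni; apply: ww'; exact: leq_trans nm. Qed.

Lemma cylinder0 : cylinder set0.
Proof. by split => //; exists 0%N. Qed.

Lemma cylinderC A : cylinder A -> cylinder (~` A).
Proof.
move=> [mA [n dA]]; split; first exact: measurableC.
by exists n => w w' ww' nA Aw'; apply: nA; apply: dA Aw' => i /ww'.
Qed.

Lemma cylinderU A B : cylinder A -> cylinder B -> cylinder (A `|` B).
Proof.
move=> [mA [n dA]] [mB [m dB]]; split; first exact: measurableU.
exists (maxn n m) => w w' ww' [Aw|Bw]; [left|right].
  by apply: dA Aw => i im; apply: ww'; rewrite leq_max im.
by apply: dB Bw => i im; apply: ww'; rewrite leq_max im orbT.
Qed.

(* Alias of [seqspace] carrying the algebra of cylinders, on which the premeasure lives. *)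
Definition cylspace := seqspace.
Definition cylinder_display : measure_display. Proof. by constructor. Qed.
HB.instance Definition _ := Pointed.on cylspace.
HB.instance Definition _ := @isAlgebraOfSets.Build cylinder_display cylspace
  cylinder cylinder0 cylinderU cylinderC.

Context (R : realType) (P : probability T R).

Definition sect (A : set (nat -> T)) (t : T) : set (nat -> T) :=
  [set w | A (scons t w)].

Local Open Scope ereal_scope.

Fixpoint iterint (n : nat) (A : set (nat -> T)) : \bar R :=
  if n is m.+1 then \int[P]_t iterint m (sect A t)
  else (\1_A (fun=> point))%:E.

Lemma iterint_ge0 n A : 0 <= iterint n A.
Proof.
elim: n A => [|n IH] A /=; first by rewrite lee_fin indicE ler0n.
by apply: integral_ge0.
Qed.

(** The parameter space [U] varies in the induction: for one more integral the drawn coordinate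
    joins the parameter, and Fubini-Tonelli over [U * T] gives measurability. *)
Lemma measurable_iterint n d' (U : measurableType d') (A : set (U * seqspace)) :
  measurable A -> measurable_fun setT (fun u => iterint n (xsection A u)).
Proof.
elim: n d' U A => [|n IH] d' U A mA /=.
  apply/measurable_EFinP.
  have -> : (fun u => \1_(xsection A u) (fun=> point) : R) =
            \1_(ysection A (fun=> point)).
    by apply/funext => u; rewrite !indicE mem_ysection mem_xsection.
  by apply: measurable_indic; apply: measurable_ysection.
pose A' : set ((U * T) * seqspace) := [set x | A (x.1.1, scons x.1.2 x.2)].
have mA' : measurable A'.
  rewrite -[A']setTI.
  apply: (_ : measurable_fun setT
     (fun x : (U * T) * seqspace => (x.1.1, scons x.1.2 x.2 : seqspace))) => //.
  apply/measurable_fun_pair => /=.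
    by apply: measurableT_comp => //; exact: measurable_fst.
  apply: (measurableT_comp measurable_scons (g := fun x : (U * T) * seqspace => (x.1.2, x.2))).
  apply/measurable_fun_pair => //=.
  exact: (measurableT_comp measurable_snd measurable_fst).
have := IH _ _ _ mA'.
move=> /(@measurable_fun_fubini_tonelli_F _ _ U T R P _) H.
rewrite (_ : (fun _ => _) = fubini_F P (fun x => iterint n (xsection A' x))).
  by apply: H => x; exact: iterint_ge0.
apply/funext => u; apply: eq_integral => t _; congr iterint.
Qed.

Lemma measurable_iterint_sect n (A : set seqspace) : measurable A ->
  measurable_fun setT (fun t => iterint n (sect A t)).
Proof.
move=> mA; pose B : set (T * seqspace) := [set x | A (scons x.1 x.2)].
have mB : measurable B.
  by rewrite -[B]setTI; apply: (measurable_scons measurableT).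
rewrite (_ : (fun _ => _) = fun t => iterint n (xsection B t)).
  exact: measurable_iterint.
apply/funext => t; congr iterint.
by apply/seteqP; split => w; rewrite /sect /xsection /= inE.
Qed.

Lemma measurable_sect (A : set seqspace) t : measurable A ->
  measurable (sect A t : set seqspace).
Proof.
move=> mA; rewrite -[sect A t]setTI.
have : measurable_fun setT (fun w : seqspace => scons t w : seqspace).
  by apply: measurable_seqspace => -[|i] //=; exact: measurable_coord.
exact.
Qed.

Lemma depends_on_sect n A t : depends_on n.+1 A -> depends_on n (sect A t).
Proof. by move=> dA w w' ww'; apply: dA => -[|i] //=; apply: ww'. Qed.

Lemma cylinder_sect A t : cylinder A -> cylinder (sect A t).
Proof.
move=> [mA [n dA]]; split; first exact: measurable_sect.
by exists n; apply: depends_on_sect; apply: depends_onW dA.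
Qed.

Lemma iterintS n A : depends_on n A -> iterint n.+1 A = iterint n A.
Proof.
elim: n A => [|n IH] A dA.
  rewrite /= (_ : (fun t => _) = cst (\1_A (fun=> point))%:E).
    exact: integral_prob_cst.
  apply/funext => t /=; congr (_%:E); rewrite !indicE; congr (_%:R).
  congr nat_of_bool.
  by apply/asboolP/asboolP => /= h; apply: dA h.
rewrite /=; apply: eq_integral => t _; rewrite -IH//.
exact: depends_on_sect.
Qed.

Lemma iterint_stable n m A : (n <= m)%N -> depends_on n A ->
  iterint m A = iterint n A.
Proof.
move=> nm dA; rewrite -(subnK nm); elim: (m - n)%N => // k IH.
rewrite addSn iterintS//; apply: depends_onW dA; lia.
Qed.

Lemma cylinder_level A : cylinder A -> depends_on (xget 0%N [set n | depends_on n A]) A.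
Proof. by move=> [_ [n dA]]; apply: (@xgetPex _ 0%N [set n | depends_on n A]); exists n. Qed.

(** [xget] picks an arbitrary level for [A]; by [precontentE] every level gives the same value. *)
Definition precontent (A : set cylspace) : \bar R :=
  iterint (xget 0%N [set n | depends_on n A]) A.

Lemma precontentE n A : cylinder A -> depends_on n A ->
  precontent A = iterint n A.
Proof.
move=> cA dA; rewrite /precontent; set m := xget _ _.
have dm : depends_on m A by exact: cylinder_level.
have [nm|/ltnW mn] := leqP n m; first exact: iterint_stable.
by rewrite -(iterint_stable mn).
Qed.

Lemma precontent_ge0 A : 0 <= precontent A. Proof. exact: iterint_ge0. Qed.

Lemma precontent_sectE A : cylinder A ->
  precontent A = \int[P]_t precontent (sect A t).
Proof.
move=> cA; have [_ [n dA]] := cA.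
rewrite (precontentE (n := n.+1) cA); last by apply: depends_onW dA.
apply: eq_integral => t _; rewrite (precontentE (n := n))//.
  exact: cylinder_sect.
by apply: depends_on_sect; apply: depends_onW dA.
Qed.

Lemma measurable_precontent_sect A : cylinder A ->
  measurable_fun setT (fun t => precontent (sect A t)).
Proof.
move=> cA; have [mA [n dA]] := cA.
rewrite (_ : (fun _ => _) = fun t => iterint n (sect A t)).
  exact: measurable_iterint_sect.
apply/funext => t; rewrite (precontentE (n := n))//.
  exact: cylinder_sect.
by apply: depends_on_sect; apply: depends_onW dA.
Qed.

Lemma precontent_le1 A : cylinder A -> precontent A <= 1.
Proof.
rewrite /precontent => cA; have [mA _] := cA.
move: {cA} (xget _ _) => n.
elim: n A mA => [|n IH] A mA /=.
  by rewrite lee_fin indicE lern1 leq_b1.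
apply: (@le_trans _ _ (\int[P]_t (cst 1 t))); last first.
  by rewrite integral_prob_cst.
apply: ge0_le_integral => //.
- by move=> t _; exact: iterint_ge0.
- exact: measurable_iterint_sect.
- by move=> t _ /=; apply: IH; exact: measurable_sect.
Qed.

Lemma iterint_additive n A B : measurable (A : set seqspace) ->
  measurable (B : set seqspace) -> A `&` B = set0 ->
  iterint n (A `|` B) = iterint n A + iterint n B.
Proof.
elim: n A B => [|n IH] A B mA mB AB /=.
  rewrite -EFinD; congr (_%:E); rewrite !indicE -natrD; congr (_%:R).
  rewrite in_setU.
  have : ~ ((fun=> point) \in A /\ (fun=> point) \in B).
    by rewrite !inE => -[a b]; have : (A `&` B) (fun=> point) by []; rewrite AB.
  by case: (_ \in A); case: (_ \in B) => //= /(_ (conj isT isT)).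
rewrite -ge0_integralD//; last 4 first.
- by move=> t _; exact: iterint_ge0.
- exact: measurable_iterint_sect.
- by move=> t _; exact: iterint_ge0.
- exact: measurable_iterint_sect.
apply: eq_integral => t _; rewrite -IH//; [exact: measurable_sect|exact: measurable_sect|].
by apply/seteqP; split => // w [a b]; have : (A `&` B) (scons t w) by []; rewrite AB.
Qed.

(* A point [t] where strict superadditivity survives in the section exists since
   otherwise integrating the reverse inequality gives subadditivity. *)
Lemma violation_sect A (F : nat -> set (nat -> T)) :
  cylinder A -> (forall i, cylinder (F i)) ->
  \sum_(i <oo) precontent (F i) < precontent A ->
  exists t, \sum_(i <oo) precontent (sect (F i) t) < precontent (sect A t).
Proof.
move=> cA cF; apply: contraPP => /forallNP H; apply/negP; rewrite -leNgt.
rewrite precontent_sectE//; under eq_eseriesr do rewrite precontent_sectE//.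
rewrite -integral_nneseries//; last 2 first.
- by move=> n; exact: measurable_precontent_sect.
- by move=> n t _; exact: precontent_ge0.
apply: ge0_le_integral => //.
- by move=> t _; exact: precontent_ge0.
- exact: measurable_precontent_sect.
- apply: ge0_emeasurable_sum => //.
  by move=> n t _ _; exact: precontent_ge0.
  by move=> n _; exact: measurable_precontent_sect.
- by move=> t _; rewrite leNgt; apply/negP; exact: H.
Qed.

Lemma precontent0 : precontent set0 = 0.
Proof. rewrite (precontentE (n := 0%N))//=; first by rewrite indicE in_set0.
exact: cylinder0. Qed.

(** By contradiction, without any topology on [T]. If the inequality fails for [A] and the [F i],
    [violation_sect] yields coordinates [w 0], [w 1], ... such that it still fails for all
    successive sections. Nonnegativity of the sum forces [w] into [A], hence into some [F i]; at a
    level that determines this [F i] its section is the whole space and has content 1, while the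
    section of [A] has content at most 1. *)
Lemma precontent_sigma_subadditive : measurable_subset_sigma_subadditive precontent.
Proof.
move=> A F mF mA AF; rewrite leNgt; apply/negP => viol.
have step (x : set (nat -> T) * (nat -> set (nat -> T))) :
    {t | cylinder x.1 -> (forall i, cylinder (x.2 i)) ->
      \sum_(i <oo) precontent (x.2 i) < precontent x.1 ->
      \sum_(i <oo) precontent (sect (x.2 i) t) < precontent (sect x.1 t)}.
  apply: cid; have [h|h] := pselect ([/\ cylinder x.1, (forall i, cylinder (x.2 i)) &
      \sum_(i <oo) precontent (x.2 i) < precontent x.1]).
    by case: h => h1 h2 h3; have [t ht] := violation_sect h1 h2 h3; exists t.
  by exists point => h1 h2 h3; exfalso; apply: h.
pose nxt x := (sect x.1 (sval (step x)), fun i => sect (x.2 i) (sval (step x))).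
pose st n := iter n nxt (A, F).
pose w n := sval (step (st n)).
have inv n : [/\ cylinder (st n).1, (forall i, cylinder ((st n).2 i)) &
      \sum_(i <oo) precontent ((st n).2 i) < precontent (st n).1].
  elim: n => [|n [h1 h2 h3]]; first by split.
  rewrite /st iterS -/(st n) /nxt /=; split.
  - exact: cylinder_sect.
  - by move=> i; exact: cylinder_sect.
  - exact: (svalP (step (st n)) h1 h2 h3).
(* [app n v] consists of the first [n] terms of [w] followed by [v]. *)
pose app n (v : nat -> T) i := if (i < n)%N then w i else v (i - n)%N.
have appS n v : app n (scons (w n) v) = app n.+1 v.
  apply/funext => i; rewrite /app.
  case: (ltngtP i n) => [ni|ni|->]; last by rewrite subnn ltnS leqnn.
    by rewrite ltnS ltnW.
  rewrite ltnS leqNgt ni /=; have -> : (i - n = (i - n.+1).+1)%N by lia.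
  by [].
have stE n : (st n).1 = [set v | A (app n v)] /\
             forall i, (st n).2 i = [set v | F i (app n v)].
  elim: n => [|n [IH1 IH2]].
    have app0 v : app 0%N v = v by apply/funext => i; rewrite /app subn0.
    by split => [|i]; apply/seteqP; split => v /=; rewrite app0.
  rewrite /st iterS -/(st n) /nxt /= -/(w n); split => [|i].
    by rewrite IH1; apply/seteqP; split => v; rewrite /sect /= appS.
  by rewrite IH2; apply/seteqP; split => v; rewrite /sect /= appS.
have Pfull (B : set (nat -> T)) n : depends_on n B ->
    cylinder [set v | B (app n v)] ->
    precontent [set v | B (app n v)] = (\1_B w)%:E.
  move=> dB cB; rewrite (precontentE (n := 0%N))//=.
    congr (_%:E); rewrite !indicE; congr (nat_of_bool _)%:R.
    apply/asboolP/asboolP => /= h; apply: dB h => i ni; by rewrite /app ni.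
  move=> v v' _ /=; apply: dB => i ni; by rewrite /app ni.
have [n dn] : exists n, depends_on n A by case: mA.
have Aw : A w.
  have [h1 h2 h3] := inv n; have [e1 e2] := stE n.
  rewrite e1 Pfull// -?e1// in h3.
  apply: contrapT => nAw; move: h3; apply/negP; rewrite -leNgt.
  rewrite indicE memNset//= nneseries_ge0// => *; exact: precontent_ge0.
have [i _ Fiw] := AF _ Aw.
have [m dm] : exists m, depends_on m (F i) by case: (mF i).
have [h1 h2 h3] := inv m; have [e1 e2] := stE m.
have : 1 <= \sum_(i <oo) precontent ((st m).2 i).
  have hi : precontent ((st m).2 i) = 1.
    by rewrite e2 Pfull// -?e2// indicE mem_set.
  rewrite -hi.
  apply: le_trans (nneseries_lim_ge i.+1 _); last by move=> *; exact: precontent_ge0.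
  rewrite big_mkord big_ord_recr /= leeDr// sume_ge0// => *; exact: precontent_ge0.
by move=> /le_lt_trans/(_ h3); rewrite ltNge precontent_le1.
Qed.

Lemma precontent_semi_additive : measure_function.semi_additive precontent.
Proof.
suff H2 : semi_additive2 precontent.
  apply/additive2P; first exact: precontent0.
  by rewrite -semi_additive2E.
move=> A B cA cB cAB AB.
have [[mA [n dA]] [mB [m dB]]] := (cA, cB).
have dA' : depends_on (maxn n m) A by apply: depends_onW dA; rewrite leq_maxl.
have dB' : depends_on (maxn n m) B by apply: depends_onW dB; rewrite leq_maxr.
have dAB : depends_on (maxn n m) (A `|` B).
  by move=> w w' ww' [/(dA' _ _ ww')|/(dB' _ _ ww')]; [left|right].
rewrite (precontentE cAB dAB) (precontentE cA dA') (precontentE cB dB').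
exact: iterint_additive.
Qed.

End sequence_space.

(** * Extension of the content to a probability on sequences *)

Section sequence_measure.
Context d (T : measurableType d) (R : realType) (P : probability T R).
Local Open Scope ereal_scope.

HB.instance Definition _ := isContent.Build _ (cylspace T) R (precontent P)
  (precontent_ge0 P) (@precontent_semi_additive _ _ _ P).
HB.instance Definition _ := Content_SigmaSubAdditive_isMeasure.Build _ R
  (cylspace T) (precontent P) (@precontent_sigma_subadditive _ _ _ P).

Definition seq_premeasure : {measure set cylspace T -> \bar R} :=
  [the {measure set cylspace T -> \bar R} of precontent P].

Lemma measurable_id_cylspace : measurable_fun setT
  (id : g_sigma_algebraType (@measurable _ (cylspace T)) -> seqspace T).
Proof.
apply: measurable_seqspace => i _ B mB; rewrite setTI.
apply: sub_sigma_algebra; split.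
  by rewrite -[X in measurable X]setTI; exact: (measurable_coord i).
by exists i.+1 => w w' ww' /=; rewrite -ww'.
Qed.

(** The extension lives on the sigma-algebra generated by the cylinders; pushing it forward along
    the identity moves it to the one generated by the coordinates, where measurability is checked
    coordinatewise. *)
Definition seq_measure : set (seqspace T) -> \bar R :=
  pushforward (measure_extension seq_premeasure) (id : _ -> seqspace T).

Let seq_measure0 : seq_measure set0 = 0.
Proof. by rewrite /seq_measure /pushforward preimage_set0 measure0. Qed.

Let seq_measure_ge0 A : 0 <= seq_measure A.
Proof. exact: (@measure_ge0 _ _ _ (measure_extension seq_premeasure) A). Qed.

Let seq_measure_sigma_additive : semi_sigma_additive seq_measure.
Proof.
move=> F mF tF mUF; rewrite /seq_measure /pushforward preimage_bigcup.
have mid (A : set (seqspace T)) : measurable A -> measurable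
    (A : set (g_sigma_algebraType (@measurable _ (cylspace T)))).
  by move=> mA; have := measurable_id_cylspace measurableT mA; rewrite setTI.
apply: measure_semi_sigma_additive => //; last exact: mid.
by move=> n; exact: (mid _ (mF n)).
Qed.

HB.instance Definition _ := isMeasure.Build _ _ _ seq_measure
  seq_measure0 seq_measure_ge0 seq_measure_sigma_additive.

Lemma seq_measureE (A : set (seqspace T)) : cylinder A ->
  seq_measure A = precontent P A.
Proof.
move=> cA; rewrite /seq_measure /pushforward preimage_id /measure_extension.
by rewrite measurable_mu_extE.
Qed.

Let seq_measure_setT : seq_measure setT = 1.
Proof.
have cT : cylinder [set: seqspace T] by split => //; exists 0%N.
rewrite seq_measureE// (precontentE P (n := 0%N))//=.
by rewrite indicE in_setT.
Qed.

HB.instance Definition _ := Measure_isProbability.Build _ _ _ seq_measure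
  seq_measure_setT.

Definition rectangle (n : nat) (B : nat -> set T) : set (seqspace T) :=
  [set w | forall i, (i < n)%N -> B i (w i)].

Lemma cylinder_rectangle n B : (forall i, measurable (B i)) ->
  cylinder (rectangle n B).
Proof.
move=> mB; split; last by exists n => w w' ww' h i ni; rewrite -ww'//; exact: h.
rewrite (_ : rectangle n B = \bigcap_(i in `I_n) ((fun w => w i) @^-1` B i)).
  apply: fin_bigcap_measurable => // i _.
  by rewrite -[X in measurable X]setTI; exact: (measurable_coord i).
by apply/seteqP; split => w h i; exact: h.
Qed.

Lemma seq_measure_rectangle n B : (forall i, measurable (B i)) ->
  seq_measure (rectangle n B) = \prod_(i < n) P (B i).
Proof.
move=> mB; have cR := cylinder_rectangle n mB; rewrite seq_measureE//.
rewrite (precontentE P (n := n))//; last first.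
  by move=> w w' ww' h i ni; rewrite -ww'//; exact: h.
elim: n B mB {cR} => [|n IH] B mB /=.
  by rewrite big_ord0 indicE mem_set.
rewrite big_ord_recl -(IH (B \o S))//; last by move=> i; exact: mB.
transitivity (\int[P]_t (iterint P n (rectangle n (B \o S)) * (\1_(B 0%N) t)%:E)).
  apply: eq_integral => t _; rewrite indicE.
  case: (boolP (t \in B 0%N)) => [/set_mem Bt|/negP Bt].
    rewrite mule1; congr iterint.
    apply/seteqP; split => w h; first by move=> i ni; exact: (h i.+1).
    by move=> -[|i] //= ni; exact: h.
  rewrite mule0 (_ : sect _ _ = set0); last first.
    by apply/seteqP; split => // w h; apply: Bt; apply: mem_set; exact: (h 0%N).
  by rewrite (iterint_stable P (n := 0%N))//= indicE in_set0.
rewrite ge0_integralZl//; last 2 first.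
- by apply/measurable_EFinP; exact: measurable_indic.
- exact: iterint_ge0.
by rewrite integral_indic// setIT muleC.
Qed.

(** Rectangles form a generating pi-system. Identities in law on sequences, such as [scons_law] and
    [mixcoord_law], reduce to finite products in this way. *)
Lemma seq_measure_unique (mu : probability (seqspace T) R) :
  (forall n B, (forall i, measurable (B i)) ->
     mu (rectangle n B) = \prod_(i < n) P (B i)) ->
  forall A, measurable A -> mu A = seq_measure A.
Proof.
move=> H A mA.
pose G : set (set (seqspace T)) :=
  [set A | exists n B, (forall i, measurable (B i)) /\ A = rectangle n B].
have mG : @measurable _ (seqspace T) = <<s G>>.
  apply/seteqP; split => [B|].
    apply: smallest_sub; first exact: smallest_sigma_algebra.
    move=> _ [i [C [mC ->]]]; apply: sub_sigma_algebra.
    exists i.+1, (fun j => if j == i then C else setT); split.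
      by move=> j; case: ifP.
    apply/seteqP; split => w; rewrite /rectangle /=.
      by move=> h j _; case: eqP => // ->.
    by move=> /(_ i (ltnSn _)); rewrite eqxx.
  apply: smallest_sub; first exact: sigma_algebra_measurable.
  by move=> _ [n [B [mB ->]]]; have [] := cylinder_rectangle n mB.
apply: (measure_unique G (fun=> setT)) => //.
- move=> _ _ [n [B [mB ->]]] [m [C [mC ->]]].
  exists (maxn n m), (fun i => (if (i < n)%N then B i else setT) `&`
                               (if (i < m)%N then C i else setT)); split.
    by move=> i; apply: measurableI; case: ifP.
  apply/seteqP; split => w /=.
    by move=> [h1 h2] i _; split; case: ifP => // hi; [exact: h1|exact: h2].
  move=> h; split => i im.
    by have := h i; rewrite leq_max im => /(_ isT) [].
  by have := h i; rewrite leq_max im orbT => /(_ isT) [].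
- by move=> _; exists 0%N, (fun=> setT); split => //; apply/seteqP; split.
- by rewrite bigcup_const//; exists 0%N.
- move=> _ [n [B [mB ->]]].
  exact: etrans (H n B mB) (esym (seq_measure_rectangle n mB)).
- by move=> k; rewrite /= probability_setT ltry.
Qed.

End sequence_measure.

(** * Expectations *)

Section expectation.
Context d (T : measurableType d) (R : realType) (P : probability T R).

Lemma bounded_integrable (f : T -> R) (M : R) : measurable_fun setT f ->
  (forall x, `|f x| <= M) -> P.-integrable setT (EFin \o f).
Proof.
move=> mf bf; apply: (le_integrable measurableT (g := EFin \o cst M)) => //.
- exact/measurable_EFinP.
- by move=> x _ /=; rewrite lee_fin (le_trans (bf x))// ler_norm.
- exact: finite_measure_integrable_cst.
Qed.

Lemma Rintegral_prob_cst (r : R) : \int[P]_x r = r.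
Proof. by rewrite /Rintegral [X in fine X](integral_prob_cst P r%:E). Qed.

Lemma RintegralE (f : T -> R) : P.-integrable setT (EFin \o f) ->
  (\int[P]_x f x)%:E = (\int[P]_x (f x)%:E)%E.
Proof. by move=> intf; rewrite fineK// integrable_fin_num. Qed.

Lemma Rintegral_bound (f : T -> R) (M : R) : P.-integrable setT (EFin \o f) ->
  (forall x, `|f x| <= M) -> `|\int[P]_x f x| <= M.
Proof.
move=> intf bf; apply: (le_trans (le_normr_Rintegral _ intf)) => //.
rewrite -[leRHS]Rintegral_prob_cst; apply: le_Rintegral => //.
- exact: integrable_norm.
- exact: finite_measure_integrable_cst.
Qed.

Lemma integrable_sumR (I : Type) (s : seq I) (f : I -> T -> R) :
  (forall i, P.-integrable setT (EFin \o f i)) ->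
  P.-integrable setT (EFin \o (fun x => \sum_(i <- s) f i x)).
Proof.
move=> intf.
rewrite (_ : EFin \o _ = (fun x => \sum_(i <- s) (EFin \o f i) x)%E).
  by apply: integrable_sum => // i _.
by apply/funext => x /=; rewrite sumEFin.
Qed.

Lemma Rintegral_sum (I : Type) (s : seq I) (f : I -> T -> R) :
  (forall i, P.-integrable setT (EFin \o f i)) ->
  \int[P]_x (\sum_(i <- s) f i x) = \sum_(i <- s) \int[P]_x f i x.
Proof.
move=> intf; elim: s => [|i s IH].
  under eq_Rintegral do rewrite big_nil.
  by rewrite big_nil Rintegral_prob_cst.
under eq_Rintegral do rewrite big_cons.
rewrite big_cons -IH RintegralD//.
exact: integrable_sumR.
Qed.

Lemma integrableZlR (f : T -> R) (r : R) : P.-integrable setT (EFin \o f) ->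
  P.-integrable setT (EFin \o (fun x => r * f x)).
Proof. by move=> /(integrableZl measurableT r). Qed.

Lemma integrableDR (f g : T -> R) : P.-integrable setT (EFin \o f) ->
  P.-integrable setT (EFin \o g) ->
  P.-integrable setT (EFin \o (fun x => f x + g x)).
Proof. by move=> mf mg; apply: (integrableD measurableT mf mg). Qed.

Lemma integrableBR (f g : T -> R) : P.-integrable setT (EFin \o f) ->
  P.-integrable setT (EFin \o g) ->
  P.-integrable setT (EFin \o (fun x => f x - g x)).
Proof. by move=> mf mg; apply: (integrableB measurableT mf mg). Qed.

Lemma integrable_prob_cst (r : R) : P.-integrable setT (EFin \o (fun=> r)).
Proof. exact: finite_measure_integrable_cst. Qed.

Lemma Rintegral_indic (A : set T) : measurable A -> \int[P]_x \1_A x = fine (P A).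
Proof. by move=> mA; rewrite /Rintegral integral_indic// setIT. Qed.

Lemma integrable_domR (f g : T -> R) : measurable_fun setT f ->
  (forall x, `|f x| <= g x) -> P.-integrable setT (EFin \o g) ->
  P.-integrable setT (EFin \o f).
Proof.
move=> mf fg; apply: le_integrable => //; first exact/measurable_EFinP.
by move=> x _ /=; rewrite lee_fin (le_trans (fg x))// ler_norm.
Qed.

End expectation.

Section product_expectation.
Context d1 d2 (T1 : measurableType d1) (T2 : measurableType d2) (R : realType).
Variables (P1 : probability T1 R) (P2 : probability T2 R).
Variables (f : T1 * T2 -> R) (M : R).
Hypotheses (mf : measurable_fun setT f) (bf : forall x, `|f x| <= M).

Lemma measurable_sect1 x : measurable_fun setT (fun y => f (x, y)).
Proof. exact: measurable_fun_pair2. Qed.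

Lemma measurable_sect2 y : measurable_fun setT (fun x => f (x, y)).
Proof. exact: measurable_fun_pair1. Qed.

Let int12 : (P1 \x P2)%E.-integrable setT (EFin \o f).
Proof. exact: bounded_integrable mf bf. Qed.

Let E2 x : (\int[P2]_y f (x, y))%:E = (\int[P2]_y (f (x, y))%:E)%E.
Proof.
apply: RintegralE; apply: (@bounded_integrable _ _ _ _ _ M) => //.
exact: measurable_sect1.
Qed.

Let E1 y : (\int[P1]_x f (x, y))%:E = (\int[P1]_x (f (x, y))%:E)%E.
Proof.
apply: RintegralE; apply: (@bounded_integrable _ _ _ _ _ M) => //.
exact: measurable_sect2.
Qed.

Lemma measurable_Rintegral2 : measurable_fun setT (fun x => \int[P2]_y f (x, y)).
Proof.
apply/measurable_EFinP.
rewrite (_ : EFin \o _ = fubini_F P2 (EFin \o f)).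
  by apply: measurable_fubini_F int12.
by apply/funext => x /=; rewrite E2.
Qed.

Lemma Rintegral_prod : \int[(P1 \x P2)%E]_z f z = \int[P1]_x \int[P2]_y f (x, y).
Proof.
rewrite /Rintegral -(integral12_prod_meas1 int12); congr fine.
by apply: eq_integral => x _; rewrite /fubini_F -E2.
Qed.

Lemma Rintegral_swap :
  \int[P1]_x \int[P2]_y f (x, y) = \int[P2]_y \int[P1]_x f (x, y).
Proof.
rewrite -Rintegral_prod /Rintegral -(integral21_prod_meas1 int12); congr fine.
by apply: eq_integral => x _; rewrite /fubini_G -E1.
Qed.

End product_expectation.

Lemma fst_law d1 d2 (T1 : measurableType d1) (T2 : measurableType d2) (R : realType)
    (P1 : probability T1 R) (P2 : probability T2 R) (A : set T1) : measurable A ->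
  (P1 \x P2)%E (fst @^-1` A) = P1 A.
Proof.
move=> mA; rewrite (_ : fst @^-1` A = A `*` setT); last by apply/seteqP; split => -[x y] //= [].
apply: etrans (product_measure1E P1 P2 mA measurableT) _.
by rewrite -[RHS]mule1; congr (_ * _)%E; exact: probability_setT.
Qed.

Lemma snd_law d1 d2 (T1 : measurableType d1) (T2 : measurableType d2) (R : realType)
    (P1 : probability T1 R) (P2 : probability T2 R) (A : set T2) : measurable A ->
  (P1 \x P2)%E (snd @^-1` A) = P2 A.
Proof.
move=> mA; rewrite (_ : snd @^-1` A = setT `*` A); last by apply/seteqP; split => -[x y] //= [].
apply: etrans (product_measure1E P1 P2 measurableT mA) _.
by rewrite -[RHS]mul1e; congr (_ * _)%E; exact: probability_setT.
Qed.

Lemma Rintegral_law d1 d2 (T1 : measurableType d1) (T2 : measurableType d2)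
    (R : realType) (P1 : probability T1 R) (P2 : probability T2 R)
    (phi : T1 -> T2) (f : T2 -> R) (M : R) :
  measurable_fun setT phi ->
  (forall A, measurable A -> P1 (phi @^-1` A) = P2 A) ->
  measurable_fun setT f -> (forall x, `|f x| <= M) ->
  \int[P1]_x f (phi x) = \int[P2]_x f x.
Proof.
move=> mphi law mf bf; rewrite /Rintegral; congr fine.
have intf : P1.-integrable (phi @^-1` setT) ((EFin \o f) \o phi).
  rewrite preimage_setT; apply: (@bounded_integrable _ _ _ _ _ M) => //.
  exact: measurableT_comp.
have -> : (\int[P2]_x (f x)%:E = \int[pushforward P1 phi]_x (EFin \o f) x)%E.
  by apply: eq_measure_integral => A mA _; rewrite /= -law.
rewrite (integral_pushforward mphi _ intf)//.
exact/measurable_EFinP.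
Qed.

Section sequence_expectation.
Context d (T : measurableType d) (R : realType) (P : probability T R).
Notation mu := (seq_measure P).

(** An i.i.d. sequence is one draw followed by an independent i.i.d. sequence; this lets an
    induction on the number of steps peel off the first observation. *)
Lemma scons_law (A : set (seqspace T)) : measurable A ->
  (P \x mu)%E ((fun x : T * seqspace T => scons x.1 x.2 : seqspace T) @^-1` A) = mu A.
Proof.
pose phi (x : T * seqspace T) : seqspace T := scons x.1 x.2.
pose phi' : {mfun (T * seqspace T)%type >-> seqspace T} :=
  HB.pack phi (isMeasurableFun.Build _ _ _ _ phi (@measurable_scons _ T)).
move=> mA; rewrite -(@seq_measure_unique _ _ _ P (distribution (P \x mu)%E phi'))//.
move=> [|n] B mB; rewrite /distribution /= /pushforward.
  rewrite big_ord0 (_ : _ @^-1` _ = setT); first exact: probability_setT.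
  by apply/seteqP; split.
rewrite (_ : _ @^-1` _ = B 0%N `*` rectangle n (B \o S)).
  rewrite product_measure1E//; last by have [] := cylinder_rectangle n (fun i => mB i.+1).
  rewrite big_ord_recl; congr (_ * _)%E.
  by apply: etrans (seq_measure_rectangle P n _) _ => // i; exact: mB.
apply/seteqP; split => -[t w] /=.
  by move=> h; split; [exact: (h 0%N)|move=> i ni; exact: (h i.+1)].
by move=> [Bt h] [|i] //= ni; exact: h.
Qed.

Lemma Rintegral_scons (f : seqspace T -> R) (M : R) :
  measurable_fun setT f -> (forall x, `|f x| <= M) ->
  \int[mu]_w f w = \int[P]_t \int[mu]_w f (scons t w).
Proof.
move=> mf bf; rewrite -(Rintegral_law (@measurable_scons _ T) scons_law mf bf).
rewrite (@Rintegral_prod _ _ _ _ _ P mu _ M)//.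
exact: (measurableT_comp mf (@measurable_scons _ T)).
Qed.

Lemma seq_measure_coord i B : measurable B ->
  mu ((fun w => w i) @^-1` B) = P B.
Proof.
move=> mB; pose C j := if j == i then B else setT.
have mC j : measurable (C j) by rewrite /C; case: ifP.
rewrite (_ : _ @^-1` _ = rectangle i.+1 C); last first.
  apply/seteqP; split => w; rewrite /rectangle /C /=.
    by move=> h j _; case: eqP => // ->.
  by move=> /(_ i (ltnSn _)); rewrite eqxx.
rewrite seq_measure_rectangle// big_ord_recr /= {2}/C eqxx big1 ?mul1e//.
move=> j _; rewrite /C ifN ?probability_setT//.
by rewrite neq_ltn ltn_ord.
Qed.

(** [phi] extracts the sequence from a larger space, so that the data and the Gaussian variables can
    be read off the same final product space. *)
Lemma mutually_independent_coord d' (S : measurableType d') (P' : probability S R)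
    (phi : S -> seqspace T) d'' (U : measurableType d'') (f : T -> U) :
  (forall A, measurable A -> P' (phi @^-1` A) = mu A) ->
  measurable_fun setT f ->
  mutually_independent P' (fun i w => f (phi w i)).
Proof.
move=> law mf s B us mB.
pose C j := if j \in s then f @^-1` B j else setT.
have mC j : measurable (C j).
  by rewrite /C; case: ifP => // _; rewrite -[X in measurable X]setTI; exact: mf.
pose n := (\max_(i <- s) i).+1.
have sn i : i \in s -> (i < n)%N by move=> si; rewrite ltnS leq_bigmax_seq.
rewrite (_ : [set w | _] = phi @^-1` rectangle n C); last first.
  apply/seteqP; split => w; rewrite /rectangle /C /=.
    by move=> h j _; case: ifPn => // /h.
  by move=> h i si; have := h i (sn i si); rewrite si.
rewrite law; last by have [] := cylinder_rectangle n mC.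
rewrite seq_measure_rectangle//.
transitivity (\prod_(i <- iota 0 n | i \in s) P (f @^-1` B i))%E.
  rewrite [RHS]big_mkcond -(big_mkord xpredT (fun i => P (C i))) /index_iota subn0.
  apply: eq_bigr => i _; rewrite /C; case: ifP => // _; exact: probability_setT.
rewrite -big_filter (perm_big s); last first.
  apply: uniq_perm => //; first by rewrite filter_uniq ?iota_uniq.
  move=> i; rewrite mem_filter mem_iota add0n leq0n /=.
  by case: (boolP (i \in s)) => // /sn ->.
apply: eq_big_seq => i si.
rewrite -(@seq_measure_coord i); last by have := mC i; rewrite /C si.
rewrite -law//; rewrite -[X in measurable X]setTI.
apply: (@measurable_coord _ T i) => //; by have := mC i; rewrite /C si.
Qed.

End sequence_expectation.

(** * The standard normal law *)

Section density.
Context d (T : measurableType d) (R : realType).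
Variables (mu nu : {measure set T -> \bar R}) (g : T -> R).
Local Open Scope ereal_scope.
Hypotheses (mg : measurable_fun setT g) (g0 : forall x, (0 <= g x)%R).
Hypothesis nug : forall A, measurable A -> nu A = \int[mu]_(x in A) (g x)%:E.

Import HBNNSimple.

Let integral_density_indic (r : R) E : (0 <= r)%R -> measurable E ->
  \int[nu]_x (r * \1_E x)%:E = \int[mu]_x ((r * \1_E x)%:E * (g x)%:E).
Proof.
move=> r0 mE.
under eq_integral do rewrite EFinM.
rewrite ge0_integralZl//; last exact/measurable_EFinP/measurable_indic.
under [RHS]eq_integral do rewrite EFinM -muleA.
rewrite ge0_integralZl//; last 2 first.
- by apply: emeasurable_funM; apply/measurable_EFinP => //; exact/measurable_indic.
- by move=> x _; rewrite mule_ge0// lee_fin.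
congr (_ * _); rewrite integral_indic// setIT nug// integral_mkcond.
apply: eq_integral => x _; rewrite patchE indicE.
by case: (x \in E); rewrite ?mul1e ?mul0e.
Qed.

Let integral_density_nnsfun (f : {nnsfun T >-> R}) :
  \int[nu]_x (f x)%:E = \int[mu]_x ((f x)%:E * (g x)%:E).
Proof.
under [LHS]eq_integral do rewrite fimfunE -fsumEFin//.
rewrite [LHS]ge0_integral_fsum//; last 2 first.
- by move=> r; exact/measurable_EFinP/measurableT_comp.
- by move=> n x _; rewrite EFinM nnfun_muleindic_ge0.
under [RHS]eq_integral.
  move=> x xD; rewrite fimfunE -fsumEFin// ge0_mule_fsuml; last first.
    by move=> r; rewrite EFinM nnfun_muleindic_ge0.
  over.
rewrite [RHS]ge0_integral_fsum//; last 2 first.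
- move=> r; apply: emeasurable_funM; last exact/measurable_EFinP.
  by apply/measurable_EFinP; apply/measurableT_comp.
- move=> n x _; apply: mule_ge0; last by rewrite lee_fin.
  by rewrite EFinM nnfun_muleindic_ge0.
apply: eq_fsbigr => r /set_mem [x _ <-]; rewrite integral_density_indic//.
Qed.

Lemma ge0_integral_density (f : T -> \bar R) : measurable_fun setT f ->
  (forall x, 0 <= f x) -> \int[nu]_x f x = \int[mu]_x (f x * (g x)%:E).
Proof.
move=> mf f0; pose f_ := nnsfun_approx measurableT mf.
transitivity (limn (fun n => \int[nu]_x (f_ n x)%:E)).
  rewrite -monotone_convergence//=.
  - by apply: eq_integral => ? _; apply/esym/cvg_lim => //=; exact: cvg_nnsfun_approx.
  - by move=> n; exact/measurable_EFinP/measurable_funTS.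
  - by move=> n ? _; rewrite lee_fin.
  - by move=> ? _ ? ? mn; rewrite lee_fin; exact/lefP/nd_nnsfun_approx.
transitivity (limn (fun n => \int[mu]_x ((f_ n x)%:E * (g x)%:E))).
  by apply: congr_lim; apply/funext => n; exact: integral_density_nnsfun.
rewrite -monotone_convergence//=.
- apply: eq_integral => x _; apply/cvg_lim => //.
  by apply: cvgeZr => //; exact: cvg_nnsfun_approx.
- by move=> n; apply: emeasurable_funM; exact/measurable_EFinP/measurable_funTS.
- by move=> n ? _; rewrite mule_ge0// lee_fin.
- move=> x _ n m nm; rewrite lee_wpmul2r ?lee_fin//.
  exact/lefP/nd_nnsfun_approx.
Qed.

End density.

(** * Remainders of the exponential series *)

Section exponential_taylor.
Variable R : realType.
Implicit Types (x y : R).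

Definition exp_taylor (n : nat) (y : R) : R := \sum_(i < n) (i`!%:R)^-1 * y ^+ i.

Lemma is_derive_exp_taylor n y :
  is_derive y 1 (exp_taylor n.+1) (exp_taylor n y).
Proof.
rewrite (_ : exp_taylor n.+1 =
   \sum_(i < n.+1) ((i`!%:R)^-1 \*: (fun x : R => x ^+ i))); last first.
  by apply/funext => x; rewrite fct_sumE.
have -> : exp_taylor n y = \sum_(i < n.+1) (i`!%:R)^-1 *: (i%:R * y ^+ i.-1).
  rewrite big_ord_recl mul0r scaler0 add0r; apply: eq_bigr => i _.
  rewrite lift0 factS natrM invfM /= /GRing.scale /=.
  by rewrite mulrACA mulVf ?mul1r// pnatr_eq0.
apply: is_derive_sum => i; apply: is_deriveZ.
have := is_deriveX i (is_derive_id y (1 : R)).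
rewrite /GRing.scale /= mulr1; congr (is_derive _ _ _ _).
by apply/funext => x; rewrite exprfctE.
Qed.

(** The remainder of order n + 1 vanishes at 0 and has the remainder of order n as derivative, so
    the mean value theorem carries the induction; the factor 1 / n! is given up on the way. *)
Lemma expR_taylor n y : `|expR y - exp_taylor n y| <= `|y| ^+ n * expR `|y|.
Proof.
elim: n y => [|n IH] y.
  rewrite /exp_taylor big_ord0 subr0 expr0 mul1r ger0_norm ?expR_ge0//.
  by rewrite ler_expR ler_norm.
pose f x := expR x - exp_taylor n.+1 x.
have df x : is_derive x 1 f (expR x - exp_taylor n x).
  by apply: is_deriveB; exact: is_derive_exp_taylor.
have f0 : f 0 = 0.
  rewrite /f expR0 /exp_taylor big_ord_recl big1 ?addr0 /=.
    by rewrite fact0 invr1 mulr1 subrr.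
  by move=> i _; rewrite /bump expr0n mulr0.
have cf a b : {within `[a, b], continuous f}.
  by apply: derivable_within_continuous => x _; have [] := df x.
have bnd c : `|c| <= `|y| -> `|expR c - exp_taylor n c| * `|y| <= `|y| ^+ n.+1 * expR `|y|.
  move=> cy; rewrite exprSr -mulrA (mulrC `|y|) mulrA ler_wpM2r//.
  apply: (le_trans (IH c)); apply: ler_pM => //; rewrite ?exprn_ge0 ?expR_ge0//.
    by rewrite lerXn2r// nnegrE.
  by rewrite ler_expR.
rewrite -/(f y).
have [y0|y0|->] := ltgtP y 0; last by rewrite f0 normr0 mulr_ge0// ?exprn_ge0 ?expR_ge0.
  have [c cy] := MVT y0 (fun x _ => df x) (cf y 0).
  rewrite f0 !sub0r => /eqP; rewrite eqr_oppLR => /eqP ->.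
  rewrite mulrN opprK normrM; apply: bnd; move: cy; rewrite in_itv /= => /andP[yc c0].
  by rewrite !ltr0_norm// lerN2 ltW.
have [c cy] := MVT y0 (fun x _ => df x) (cf 0 y).
rewrite f0 !subr0 => ->.
rewrite normrM; apply: bnd; move: cy; rewrite in_itv /= => /andP[yc c0].
by rewrite !gtr0_norm// ltW.
Qed.

End exponential_taylor.

(** * Convolution, moments and tails of the standard normal law *)

Section gaussian.
Variable R : realType.
Notation mu := (@lebesgue_measure R).
Definition std_normal : probability (measurableTypeR R) R := normal_prob 0 1.
Notation N := std_normal.

Lemma ge0_integral_lebesgue_affine (b m : R) (f : R -> \bar R) : 0 < b ->
  measurable_fun setT f -> (forall x, 0 <= f x)%E ->
  (\int[mu]_y f y = \int[mu]_z (b%:E * f (b * z + m)%R))%E.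
Proof.
move=> b0 mf f0.
pose phi : measurableTypeR R -> measurableTypeR R := fun z => b * z + m.
have mphi : measurable_fun setT phi.
  by apply: measurable_funD => //; apply: measurable_funM.
rewrite ge0_integralZl//; last 2 first.
- exact: (measurableT_comp mf mphi).
- by rewrite lee_fin ltW.
rewrite -(@ge0_integral_pushforward _ _ _ _ _ _ mphi mu setT f)//.
have b0' : 0 <= b by exact: ltW.
pose bn := NngNum b0'.
rewrite -(@ge0_integral_mscale _ _ _ _ _ measurableT bn)//.
apply: eq_measure_integral => A mA _.
apply: lebesgue_measure_unique => // _ [[x y]] _ <- /=.
rewrite /mscale /pushforward /=.
rewrite /pushforward.
have -> : phi @^-1` `]x, y] = `](x - m) / b, (y - m) / b]%classic.
  by apply/seteqP; split => z; rewrite /phi /= !in_itv /=;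
    rewrite ltr_pdivrMr// ler_pdivlMr// ltrBlDr lerBrDr (mulrC z).
rewrite !lebesgue_measure_itv /= !lte_fin ltr_pM2r ?invr_gt0// ltrD2r.
case: ifP => _; last by rewrite mule0.
by rewrite -!EFinB -EFinM; congr (_%:E); field; rewrite gt_eqF.
Qed.

Lemma std_normalE (A : set R) : N A = (\int[mu]_(x in A) (normal_pdf 0 1 x)%:E)%E.
Proof. by []. Qed.

Lemma ge0_integral_std_normal (f : R -> \bar R) : measurable_fun setT f ->
  (forall x, 0 <= f x)%E ->
  (\int[N]_x f x = \int[mu]_x (f x * (normal_pdf 0 1 x)%:E))%E.
Proof.
move=> mf f0; apply: ge0_integral_density => //.
- exact: measurable_normal_pdf.
- by move=> x; exact: normal_pdf_ge0.
Qed.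

(** With [z] standard normal and independent of [g], the pair of [g] and [a * g + b * z] is
    exchangeable: the two sides are its joint density, and (y - a g)^2 + b^2 g^2 is symmetric in y
    and g. *)
Lemma normal_pdf_swap (a b g y : R) : b != 0 -> a ^+ 2 + b ^+ 2 = 1 ->
  normal_pdf 0 1 g * normal_pdf (a * g) b y =
  normal_pdf 0 1 y * normal_pdf (a * y) b g.
Proof.
move=> b0 ab; rewrite !normal_pdfE// ?oner_neq0// /normal_fun.
rewrite mulrACA [RHS]mulrACA -!expRD; congr (_ * expR _).

have e : (y - a * g) ^+ 2 + b ^+ 2 * g ^+ 2 = (g - a * y) ^+ 2 + b ^+ 2 * y ^+ 2.
  have -> : b ^+ 2 = 1 - a ^+ 2 by rewrite -ab; ring.
  by ring.
have e2 : (y - a * g) ^+ 2 = (g - a * y) ^+ 2 + b ^+ 2 * y ^+ 2 - b ^+ 2 * g ^+ 2.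
  by rewrite -e; ring.
by rewrite e2; field.
Qed.

Lemma normal_pdf_affine (b m y : R) : 0 < b ->
  b * normal_pdf m b (b * y + m) = normal_pdf 0 1 y.
Proof.
move=> b0; have bn0 : b != 0 by rewrite gt_eqF.
rewrite !normal_pdfE// ?oner_neq0// /normal_peak /normal_fun mulrA; congr (_ * expR _).
  rewrite -(mulrnAr _ pi) sqrtrM ?sqr_ge0// sqrtr_sqr gtr0_norm//.
  by rewrite -(mulrnAr _ pi) expr1n mul1r invfM mulrA mulfV// mul1r.
by field.
Qed.

(** After [normal_pdf_swap] exchanges the roles of the two variables, Tonelli integrates [g] out to
    total mass 1 and leaves the standard normal density of [y]. *)
Lemma std_normal_convolution (a b : R) (B : set R) : 0 < b -> a ^+ 2 + b ^+ 2 = 1 ->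
  measurable B ->
  (\int[N]_g N [set z | B (b * z + a * g)%R] = N B)%E.
Proof.
move=> b0 ab mB; have bn0 : b != 0 by rewrite gt_eqF.
have mpdf (m s : R) := measurable_normal_pdf m s.
have inner g : (N [set z | B (b * z + a * g)%R] =
    \int[mu]_y ((normal_pdf (a * g) b y)%:E * (\1_B y)%:E))%E.
  rewrite (ge0_integral_lebesgue_affine (a * g) b0)//; last 2 first.
  - apply: emeasurable_funM; apply/measurable_EFinP => //.
  - by move=> x; rewrite mule_ge0 ?lee_fin ?normal_pdf_ge0.
  rewrite std_normalE integral_mkcond; apply: eq_integral => z _.
  rewrite patchE -!EFinM mulrA normal_pdf_affine// indicE.
  have -> : (z \in [set z | B (b * z + a * g)]) = (b * z + a * g \in B).
    by apply/idP/idP; rewrite !inE.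
  by case: (_ \in B); rewrite ?mulr1 ?mulr0.
under eq_integral do rewrite inner.
have mf : measurable_fun setT (fun x : R * R =>
     ((normal_pdf (a * x.1) b x.2)%:E * (\1_B x.2)%:E)%E).
  apply: emeasurable_funM; apply/measurable_EFinP; last first.
    exact: (measurableT_comp (measurable_indic mB) measurable_snd).
  rewrite (_ : (fun x => _) = (fun x => normal_peak b *
      expR (- (x.2 - a * x.1) ^+ 2 / (b ^+ 2 *+ 2)))); last first.
    by apply/funext => x; rewrite normal_pdfE.
  apply: measurable_funM => //; apply: measurableT_comp => //.
  apply: measurable_funM => //; apply: measurableT_comp => //.
  apply: measurable_funX; apply: measurable_funB => //.
  by apply: measurable_funM => //.
have f0 x : (0 <= (normal_pdf (a * x.1) b x.2)%:E * (\1_B x.2)%:E)%E.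
  by rewrite mule_ge0 ?lee_fin ?normal_pdf_ge0.
rewrite (@ge0_integral_std_normal (fun g =>
   \int[mu]_y ((normal_pdf (a * g) b y)%:E * (\1_B y)%:E))%E); last 2 first.
- have := @measurable_fun_fubini_tonelli_F _ _ _ _ R mu _ mf f0.
  by [].
- by move=> g; apply: integral_ge0 => y _; exact: (f0 (g, y)).
pose h (x : R * R) : \bar R := ((normal_pdf (a * x.1) b x.2)%:E * (\1_B x.2)%:E *
  (normal_pdf 0 1 x.1)%:E)%E.
have h0 x : (0 <= h x)%E by rewrite mule_ge0// lee_fin normal_pdf_ge0.
have mh : measurable_fun setT h.
  apply: emeasurable_funM => //; apply/measurable_EFinP.
  exact: (measurableT_comp (mpdf 0 1) measurable_fst).
transitivity (\int[mu]_g \int[mu]_y h (g, y))%E.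
  apply: eq_integral => g _; rewrite -ge0_integralZr//.
  - apply: emeasurable_funM; apply/measurable_EFinP; first exact: mpdf.
    exact: measurable_indic.
  - by move=> y _; exact: (f0 (g, y)).
  - by rewrite lee_fin normal_pdf_ge0.
rewrite fubini_tonelli// std_normalE [RHS]integral_mkcond.
apply: eq_integral => y _; rewrite patchE.
under eq_integral => g _.
  rewrite /h /= muleAC -EFinM (mulrC (normal_pdf (a * g) b y)) normal_pdf_swap//.
  rewrite (mulrC (normal_pdf 0 1 y)) -mulrA EFinM.
  over.
rewrite ge0_integralZr//; last 3 first.
- by apply/measurable_EFinP; exact: mpdf.
- by move=> x _; rewrite lee_fin normal_pdf_ge0.
- by rewrite lee_fin mulr_ge0// ?normal_pdf_ge0.
rewrite integral_normal_pdf mul1e indicE.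
by case: (y \in B); rewrite ?mulr1 ?mulr0.
Qed.

Lemma std_normal_mgf (s : R) : (\int[N]_x (expR (s * x))%:E = (expR (s ^+ 2 / 2))%:E)%E.
Proof.
rewrite ge0_integral_std_normal//; last first.
  by apply/measurable_EFinP; apply: measurableT_comp => //; exact: measurable_funM.
transitivity (\int[mu]_x ((expR (s ^+ 2 / 2))%:E * (normal_pdf s 1 x)%:E))%E.
  apply: eq_integral => x _; rewrite -!EFinM; congr (_%:E).
  rewrite !normal_pdfE ?oner_neq0// /normal_fun !(mulrCA (expR _)) -!expRD.
  by congr (_ * expR _); field.
rewrite ge0_integralZl//; last 2 first.
- by apply/measurable_EFinP; exact: measurable_normal_pdf.
- by move=> x _; rewrite lee_fin normal_pdf_ge0.
by rewrite integral_normal_pdf mule1.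
Qed.

Lemma integrable_std_normal_exp (s : R) :
  N.-integrable setT (EFin \o (fun x => expR (s * x))).
Proof.
apply/integrableP; split.
  by apply/measurable_EFinP; apply: measurableT_comp => //; exact: measurable_funM.
under eq_integral do rewrite /= ger0_norm ?expR_ge0//.
by rewrite std_normal_mgf ltry.
Qed.

Lemma Rintegral_std_normal_exp (s : R) : \int[N]_x expR (s * x) = expR (s ^+ 2 / 2).
Proof. by rewrite /Rintegral std_normal_mgf. Qed.

Lemma integrable_std_normal_expabs (k : R) :
  N.-integrable setT (EFin \o (fun x : R => expR (k * `|x|))).
Proof.
apply: (@integrable_domR _ _ _ N _ (fun x : R => expR (k * x) + expR (- k * x))).
- by apply: measurableT_comp => //; apply: measurable_funM => //; exact: measurableT_comp.
- move=> x; rewrite ger0_norm ?expR_ge0//; case: (lerP 0 x) => x0.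
    by rewrite ger0_norm// lerDl expR_ge0.
  by rewrite ltr0_norm// mulrN -mulNr lerDr expR_ge0.
- by apply: integrableDR; exact: integrable_std_normal_exp.
Qed.

Lemma expR_ge_pow (n : nat) (x : R) : 0 <= x -> x ^+ n <= n`!%:R * expR x.
Proof.
case: n => [|n] x0; first by rewrite expr0 fact0 mul1r -expR0 ler_expR.
rewrite -ler_pdivrMl ?ltr0n ?fact_gt0// mulrC (le_trans _ (expR_ge1Dxn n x0))//.
by rewrite lerDr.
Qed.

Lemma integrable_std_normal_pow (n : nat) (c : R) :
  N.-integrable setT (EFin \o (fun x : R => `|x| ^+ n * expR (c * `|x|))).
Proof.
apply: (@integrable_domR _ _ _ N _ (fun x : R => n`!%:R * expR ((c + 1) * `|x|))).
- apply: measurable_funM; first by apply: measurable_funX; exact: normr_measurable.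
  by apply: measurableT_comp => //; apply: measurable_funM => //; exact: measurableT_comp.
- move=> x; rewrite ger0_norm ?mulr_ge0 ?exprn_ge0 ?expR_ge0//.
  rewrite mulrDl mul1r addrC expRD mulrA ler_wpM2r ?expR_ge0//.
  exact: expR_ge_pow.
- by apply: integrableZlR; exact: integrable_std_normal_expabs.
Qed.

Lemma integrable_std_normal_abspow (n : nat) :
  N.-integrable setT (EFin \o (fun x : R => `|x| ^+ n)).
Proof.
have := integrable_std_normal_pow n 0; congr (_.-integrable _ (EFin \o _)).
by apply/funext => x; rewrite mul0r expR0 mulr1.
Qed.

Lemma integrable_std_normal_Xn (n : nat) :
  N.-integrable setT (EFin \o (fun x => x ^+ n)).
Proof.
apply: integrable_domR (integrable_std_normal_abspow n) => //.
by move=> x; rewrite normrX.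
Qed.

(** Used to identify moments: expanding the moment generating function at [s] and [- s] bounds the
    error of the mean, and of the variance, by a multiple of s^2 for all small [s]. *)
Lemma le_epsilon_sq (x C : R) : (forall s, 0 < s -> s <= 1 -> `|x| <= C * s ^+ 2) -> x = 0.
Proof.
move=> H; apply/eqP; rewrite -normr_eq0 eq_le normr_ge0 andbT leNgt; apply/negP => x0.
have C0 : 0 < C.
  have := H 1 ltr01 (lexx _); rewrite expr1n mulr1; exact: lt_le_trans.
pose s := Num.min 1 (`|x| / (2 * C)).
have s0 : 0 < s by rewrite lt_min ltr01 divr_gt0// mulr_gt0.
have s1 : s <= 1 by rewrite ge_min lexx.
have := H s s0 s1; apply/negP; rewrite -ltNge.
have : s ^+ 2 <= s by rewrite expr2 ger_pMr.
have : s <= `|x| / (2 * C) by rewrite ge_min lexx orbT.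
rewrite ler_pdivlMr ?mulr_gt0// => h1 h2.
have : C * s ^+ 2 <= C * s by rewrite ler_pM2l.
have : s * (2 * C) = 2 * (C * s) by ring.
move: x0 h1; lra.
Qed.

Lemma std_normal_mean : \int[N]_x x = 0.
Proof.
pose K := \int[N]_x (`|x| ^+ 3 * expR (1 * `|x|)).
apply: (@le_epsilon_sq _ K) => s s0 s1.
have ints (r : R) := integrable_std_normal_exp r.
have i1 : N.-integrable setT (EFin \o (fun x : R => x)).
  exact: (integrable_std_normal_Xn 1).
(* The odd part of the exponential minus its linear term, of order s^3. As the moment generating
   function is even, its integral is [- s] times the mean. *)
pose D x := 2^-1 * (expR (s * x) - expR (- s * x)) - s * x.
have iD : N.-integrable setT (EFin \o D).
  apply: integrableBR; last exact: integrableZlR.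
  by apply: integrableZlR; apply: integrableBR.
have e : \int[N]_x D x = - (s * \int[N]_x x).
  rewrite RintegralB//; last 2 first.
  - by apply: integrableZlR; apply: integrableBR.
  - exact: integrableZlR.
  rewrite !RintegralZl//; last exact: integrableBR.
  by rewrite RintegralB// !Rintegral_std_normal_exp sqrrN subrr mulr0 sub0r.
have bD x : `|D x| <= s ^+ 3 * (`|x| ^+ 3 * expR (1 * `|x|)).
  have h (r : R) : `|r| = s -> `|expR (r * x) - exp_taylor 3 (r * x)| <=
       s ^+ 3 * (`|x| ^+ 3 * expR (1 * `|x|)).
    move=> rs; apply: (le_trans (expR_taylor 3 _)).
    rewrite normrM rs exprMn -mulrA ler_wpM2l ?exprn_ge0 ?(ltW s0)//.
    rewrite ler_wpM2l ?exprn_ge0// ler_expR mul1r ler_piMl//.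
  have h1 := h s (gtr0_norm s0).
  have h2 : `|- s| = s by rewrite normrN gtr0_norm.
  have {}h2 := h (- s) h2.
  rewrite (_ : D x = 2^-1 * (expR (s * x) - exp_taylor 3 (s * x)) -
                     2^-1 * (expR (- s * x) - exp_taylor 3 (- s * x))).
    apply: (le_trans (ler_normB _ _)); rewrite !normrM (ger0_norm (_ : 0 <= 2^-1))//.
    by move: h1 h2; lra.
  rewrite /exp_taylor !big_ord_recr !big_ord0 /D /=.
  by rewrite !factS fact0 /=; field.
have : `|\int[N]_x D x| <= s ^+ 3 * K.
  apply: (le_trans (le_normr_Rintegral _ iD)) => //.
  rewrite -RintegralZl//; last exact: integrable_std_normal_pow.
  apply: le_Rintegral => //; first exact: integrable_norm.
  by apply: integrableZlR; exact: integrable_std_normal_pow.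
rewrite e normrN normrM gtr0_norm// exprS -mulrA ler_pM2l//.
by rewrite mulrC.
Qed.

Lemma std_normal_variance : \int[N]_x (x ^+ 2) = 1.
Proof.
pose K := \int[N]_x (`|x| ^+ 4 * expR (1 * `|x|)).
apply/eqP; rewrite -subr_eq0; apply/eqP.
apply: (@le_epsilon_sq _ (2 * K + 1 * expR 1)) => s s0 s1.
have ints (r : R) := integrable_std_normal_exp r.
have i2 := integrable_std_normal_Xn 2.
pose D x := (expR (s * x) + expR (- s * x)) - 2 - s ^+ 2 * x ^+ 2.
have iA : N.-integrable setT (EFin \o (fun x => expR (s * x) + expR (- s * x) - 2)).
  apply: integrableBR; [exact: integrableDR|exact: integrable_prob_cst].
have iD : N.-integrable setT (EFin \o D).
  by apply: integrableBR => //; exact: integrableZlR.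
have e : \int[N]_x D x = 2 * expR (s ^+ 2 / 2) - 2 - s ^+ 2 * \int[N]_x (x ^+ 2).
  rewrite RintegralB//; last exact: integrableZlR.
  rewrite RintegralZl//; congr (_ - _).
  rewrite RintegralB//; [|exact: integrableDR|exact: integrable_prob_cst].
  rewrite RintegralD// !Rintegral_std_normal_exp sqrrN Rintegral_prob_cst.
  by rewrite mulr_natl mulr2n.
have bD x : `|D x| <= 2 * (s ^+ 4 * (`|x| ^+ 4 * expR (1 * `|x|))).
  have h (r : R) : `|r| = s -> `|expR (r * x) - exp_taylor 4 (r * x)| <=
       s ^+ 4 * (`|x| ^+ 4 * expR (1 * `|x|)).
    move=> rs; apply: (le_trans (expR_taylor 4 _)).
    rewrite normrM rs exprMn -mulrA ler_wpM2l ?exprn_ge0 ?(ltW s0)//.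
    rewrite ler_wpM2l ?exprn_ge0// ler_expR mul1r ler_piMl//.
  have h1 := h s (gtr0_norm s0).
  have h2 : `|- s| = s by rewrite normrN gtr0_norm.
  have {}h2 := h (- s) h2.
  rewrite (_ : D x = (expR (s * x) - exp_taylor 4 (s * x)) +
                     (expR (- s * x) - exp_taylor 4 (- s * x))).
    apply: (le_trans (ler_normD _ _)).
    by move: h1 h2; lra.
  rewrite /exp_taylor !big_ord_recr !big_ord0 /D /=.
  by rewrite !factS fact0 /=; field.
have h1 : `|\int[N]_x D x| <= 2 * (s ^+ 4 * K).
  apply: (le_trans (le_normr_Rintegral _ iD)) => //.
  have ip := integrable_std_normal_pow 4 1.
  rewrite -RintegralZl// -RintegralZl//; last exact: integrableZlR.
  apply: le_Rintegral => //; first exact: integrable_norm.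
  by do 2 apply: integrableZlR.
have h2 : `|2 * expR (s ^+ 2 / 2) - 2 - s ^+ 2| <= s ^+ 4 * expR 1.
  have := expR_taylor 2 (s ^+ 2 / 2).
  rewrite /exp_taylor !big_ord_recr !big_ord0 /= !factS fact0 /=.
  set u := s ^+ 2 / 2; have u0 : 0 <= u by rewrite divr_ge0// sqr_ge0.
  have u1 : u <= 1.
    have : s ^+ 2 <= 1 by rewrite exprn_ile1// ltW.
    by rewrite /u; lra.
  rewrite (ger0_norm u0) => h.
  have -> : 2 * expR u - 2 - s ^+ 2 =
     2 * (expR u - (0 + 1^-1 * u ^+ 0 + (1 * 1)%:R^-1 * u ^+ 1)).
    by rewrite /u; field.
  rewrite normrM ger0_norm//.
  have -> : s ^+ 4 = 4 * u ^+ 2 by rewrite /u; field.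
  have h1' : u ^+ 2 * expR u <= u ^+ 2 * expR 1.
    by rewrite ler_wpM2l ?sqr_ge0// ler_expR.
  have h2' : 0 <= u ^+ 2 * expR 1 by rewrite mulr_ge0 ?sqr_ge0 ?expR_ge0.
  rewrite -mulrA; move: h h1' h2'; lra.
have s2 : 0 < s ^+ 2 by rewrite exprn_gt0.
rewrite -(ler_pM2l s2) -{1}(gtr0_norm s2) -normrM.
have -> : s ^+ 2 * (\int[N]_x x ^+ 2 - 1) =
   (2 * expR (s ^+ 2 / 2) - 2 - s ^+ 2) - \int[N]_x D x.
  by rewrite e; ring.
apply: (le_trans (ler_normB _ _)).
apply: (le_trans (lerD h2 h1)).
by rewrite le_eqVlt; apply/orP; left; apply/eqP; ring.
Qed.

Lemma std_normal_expabs : \int[N]_x expR `|x| <= 2 * expR 2^-1.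
Proof.
have ints (r : R) := integrable_std_normal_exp r.
apply: (@le_trans _ _ (\int[N]_x (expR (1 * x) + expR (- 1 * x)))).
  apply: le_Rintegral => //.
  - have := integrable_std_normal_expabs 1; congr (_.-integrable _ (EFin \o _)).
    by apply/funext => x; rewrite mul1r.
  - exact: integrableDR.
  move=> x _; case: (lerP 0 x) => x0.
    by rewrite ger0_norm// mul1r lerDl expR_ge0.
  by rewrite ltr0_norm// mulN1r lerDr expR_ge0.
rewrite RintegralD// !Rintegral_std_normal_exp sqrrN expr1n !mul1r; lra.
Qed.

Lemma std_normal_tail (t : R) :
  (N [set x | (t < `|x|)%R] <= (2 * expR (2^-1) * expR (- t))%:E)%E.
Proof.
set A := [set x | _].
have mA : measurable (A : set (measurableTypeR R)).
  rewrite (_ : A = (fun x => `|x|) @^-1` `]t, +oo[); last first.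
    by apply/seteqP; split => x; rewrite /A /= in_itv /= andbT.
  by rewrite -[X in measurable X]setTI; apply: measurableT_comp.
rewrite -[leLHS]fineK ?fin_num_measure// -Rintegral_indic// lee_fin.
have ie : N.-integrable setT (EFin \o (fun x : R => expR `|x|)).
  have := integrable_std_normal_expabs 1; congr (_.-integrable _ (EFin \o _)).
  by apply/funext => x; rewrite mul1r.
apply: (@le_trans _ _ (\int[N]_x (expR (- t) * expR `|x|))); last first.
  by rewrite RintegralZl// mulrC ler_wpM2r ?expR_ge0// std_normal_expabs.
apply: le_Rintegral => //.
- exact: integrable_indic.
- exact: integrableZlR.
move=> x _; rewrite indicE; case: (boolP (x \in A)) => [/set_mem Ax|_].
  by rewrite -expRD -expR0 ler_expR addrC subr_ge0 ltW.
by rewrite mulr_ge0 ?expR_ge0.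
Qed.

End gaussian.

(** * Smooth classes and the smooth maximum *)

Section spline.
Variable R : realType.
Implicit Types x y z : R.

Definition pospart x : R := Num.max 0 x.

Lemma pospart_case x : (x <= 0 /\ pospart x = 0) \/ (0 < x /\ pospart x = x).
Proof. by rewrite /pospart; case: ltP => h; [right|left]. Qed.

(** The second derivative 6 x_+ of x_+^3 is 6-Lipschitz, which gives the constant 1 in the cubic
    remainder. *)
Lemma pospart_cube_taylor x y :
  `|pospart y ^+ 3 - pospart x ^+ 3 - 3 * pospart x ^+ 2 * (y - x)
    - 3 * pospart x * (y - x) ^+ 2| <= `|y - x| ^+ 3.
Proof.
set d := y - x; have -> : y = x + d by rewrite /d; ring.
have nd3 : `|d| ^+ 3 = `|d ^+ 3| by rewrite normrX.
case: (pospart_case x) => -[x0 ->]; case: (pospart_case (x + d)) => -[y0 ->].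
- by rewrite !expr0n /= !(mulr0,mul0r,subr0) normr0 exprn_ge0.
- rewrite !expr0n /= !(mulr0,mul0r,subr0) normrX lerXn2r ?nnegrE//.
  by rewrite !gtr0_norm//; lra.
- rewrite nd3 [X in `|X|](_ : _ = d ^+ 3 - (x + d) ^+ 3); last by ring.
  have d0 : d <= 0 by lra.
  have -> : `|d ^+ 3| = - d ^+ 3.
    by rewrite normrX ler0_norm// !exprS expr0; ring.
  rewrite ler_norml; apply/andP; split; last first.
    have := sqr_ge0 d; have := sqr_ge0 (x + d).
    have : (x + d) ^+ 3 >= d ^+ 3.
      rewrite -subr_ge0 (_ : _ - _ = x * (x ^+ 2 + 3 * x * d + 3 * d ^+ 2)); last by ring.
      rewrite mulr_ge0// ?ltW//; nra.
    have : d ^+ 3 <= 0 by rewrite exprS mulr_le0_ge0// sqr_ge0.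
    lra.
  have : (x + d) ^+ 3 <= 0 by rewrite exprS mulr_le0_ge0// sqr_ge0.
  lra.
- by rewrite nd3 [X in `|X|](_ : _ = d ^+ 3)//; ring.
Qed.

(** The distribution function of the sum of three independent uniform variables on [0, 1]: a third
    difference of x_+^3 / 6, twice continuously differentiable, 0 before 0 and 1 after 3. [sstep1]
    and [sstep2] are its first two derivatives. *)
Definition sstep x : R := (pospart x ^+ 3 - 3 * pospart (x - 1) ^+ 3
  + 3 * pospart (x - 2) ^+ 3 - pospart (x - 3) ^+ 3) / 6.
Definition sstep1 x : R := (pospart x ^+ 2 - 3 * pospart (x - 1) ^+ 2
  + 3 * pospart (x - 2) ^+ 2 - pospart (x - 3) ^+ 2) / 2.
Definition sstep2 x : R := pospart x - 3 * pospart (x - 1)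
  + 3 * pospart (x - 2) - pospart (x - 3).

Lemma sstep_taylor x d :
  `|sstep (x + d) - sstep x - sstep1 x * d - 2^-1 * sstep2 x * d ^+ 2| <= 2 * `|d| ^+ 3.
Proof.
pose r (a : R) := pospart (x + d - a) ^+ 3 - pospart (x - a) ^+ 3 -
  3 * pospart (x - a) ^+ 2 * d - 3 * pospart (x - a) * d ^+ 2.
have T (a : R) : `|r a| <= `|d| ^+ 3.
  have := pospart_cube_taylor (x - a) (x + d - a).
  by have -> : x + d - a - (x - a) = d by ring.
rewrite [X in `|X|](_ : _ = 6^-1 * (r 0 - 3 * r 1 + 3 * r 2 - r 3)); last first.
  by rewrite /r /sstep /sstep1 /sstep2 !subr0; field.
have h : 0 <= `|d| ^+ 3 by rewrite exprn_ge0.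
have h1 := ler_normB (r 0 - 3 * r 1 + 3 * r 2) (r 3).
have h2 := ler_normD (r 0 - 3 * r 1) (3 * r 2).
have h3 := ler_normB (r 0) (3 * r 1).
rewrite !normrM !(ger0_norm (_ : 0 <= 3)) ?(ger0_norm (_ : 0 <= 6^-1))// in h2 h3 *.
have := T 0; have := T 1; have := T 2; have := T 3; move: h h1 h2 h3.
by rewrite ?invr_ge0//; lra.
Qed.

Lemma sstep_le0 x : x <= 0 -> [/\ sstep x = 0, sstep1 x = 0 & sstep2 x = 0].
Proof.
move=> x0; have p0 z : z <= 0 -> pospart z = 0 by rewrite /pospart => /max_idPl.
rewrite /sstep /sstep1 /sstep2 !p0; [by split; ring|lra..].
Qed.

Lemma sstep_ge3 x : 3 <= x -> [/\ sstep x = 1, sstep1 x = 0 & sstep2 x = 0].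
Proof.
move=> x0; have p0 z : 0 <= z -> pospart z = z by rewrite /pospart => /max_idPr.
rewrite /sstep /sstep1 /sstep2 !p0; [by split; field|lra..].
Qed.

Lemma pospart_le0 x : x <= 0 -> pospart x = 0.
Proof. by rewrite /pospart => /max_idPl. Qed.

Lemma pospart_ge0 x : 0 <= x -> pospart x = x.
Proof. by rewrite /pospart => /max_idPr. Qed.

(** The difference is the density of the sum of four independent uniform variables, checked to be
    nonnegative piece by piece. Distance one is the case of interest because [hat] is a difference
    of unit translates. *)
Lemma sstep_mono1 x : sstep (x - 1) <= sstep x.
Proof.
have e1 : x - 1 - 1 = x - 2 by ring.
have e2 : x - 1 - 2 = x - 3 by ring.
have e3 : x - 1 - 3 = x - 4 by ring.
rewrite /sstep e1 e2 e3.
have [h|h] := lerP x 0; first by rewrite !pospart_le0; lra.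
have [h1|h1] := lerP x 1.
  rewrite (@pospart_ge0 x (ltW h)) !pospart_le0; try lra.
  have : 0 <= x ^+ 3 by rewrite exprn_ge0// ltW.
  lra.
have [h2|h2] := lerP x 2.
  rewrite (@pospart_ge0 x) ?(@pospart_ge0 (x - 1)) ?(@pospart_le0 (x - 2))
    ?(@pospart_le0 (x - 3)) ?(@pospart_le0 (x - 4)); try lra.
  set u := x - 1; have -> : x = u + 1 by rewrite /u; ring.
  have u0 : 0 <= u by rewrite /u; lra.
  have u1 : 0 <= 1 - u by rewrite /u; lra.
  have h3 : 0 <= u ^+ 2 * (1 - u) by rewrite mulr_ge0// sqr_ge0.
  have : (u + 1) ^+ 3 - 4 * u ^+ 3 = 3 * (u ^+ 2 * (1 - u)) + 3 * u + 1 by ring.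
  lra.
have [h3|h3] := lerP x 3.
  rewrite (@pospart_ge0 x) ?(@pospart_ge0 (x - 1)) ?(@pospart_ge0 (x - 2))
    ?(@pospart_le0 (x - 3)) ?(@pospart_le0 (x - 4)); try lra.
  set u := 3 - x; have -> : x = 3 - u by rewrite /u; ring.
  have u0 : 0 <= u by rewrite /u; lra.
  have u1 : 0 <= 1 - u by rewrite /u; lra.
  have h4 : 0 <= u ^+ 2 * (1 - u) by rewrite mulr_ge0// sqr_ge0.
  have : (3 - u) ^+ 3 - 4 * (3 - u - 1) ^+ 3 + 6 * (3 - u - 2) ^+ 3 =
     3 * (u ^+ 2 * (1 - u)) + 3 * u + 1 by ring.
  lra.
have [h4|h4] := lerP x 4.
  rewrite (@pospart_ge0 x) ?(@pospart_ge0 (x - 1)) ?(@pospart_ge0 (x - 2))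
    ?(@pospart_ge0 (x - 3)) ?(@pospart_le0 (x - 4)); try lra.
  set u := 4 - x; have -> : x = 4 - u by rewrite /u; ring.
  have u0 : 0 <= u ^+ 3 by rewrite exprn_ge0// /u; lra.
  have : (4 - u) ^+ 3 - 4 * (4 - u - 1) ^+ 3 + 6 * (4 - u - 2) ^+ 3
     - 4 * (4 - u - 3) ^+ 3 = u ^+ 3 by ring.
  lra.
by rewrite !pospart_ge0; lra.
Qed.

(** Three unit shifts reach the constant pieces of [sstep], so the bounds follow from [sstep_mono1]
    and the values there. *)
Lemma sstep_bnd x : 0 <= sstep x <= 1.
Proof.
have e y (a b c : R) : a - b = c -> sstep (y - 1) <= sstep y by move=> _; exact: sstep_mono1.
apply/andP; split.
  have [h|h] := lerP x 3; last by have [-> _ _] := sstep_ge3 (ltW h).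
  have [e0 _ _] := @sstep_le0 (x - 1 - 1 - 1) ltac:(lra).
  by rewrite -e0 (le_trans (sstep_mono1 _))// (le_trans (sstep_mono1 _))// sstep_mono1.
have [h|h] := lerP 0 x; last by have [-> _ _] := sstep_le0 (ltW h).
have [e0 _ _] := @sstep_ge3 (x + 3) ltac:(lra).
have h1 := sstep_mono1 (x + 1); have h2 := sstep_mono1 (x + 2).
have h3 := sstep_mono1 (x + 3).
have e1 : x + 1 - 1 = x by ring.
have e2 : x + 2 - 1 = x + 1 by ring.
have e3 : x + 3 - 1 = x + 2 by ring.
rewrite e1 in h1; rewrite e2 in h2; rewrite e3 e0 in h3.
by rewrite (le_trans h1)// (le_trans h2).
Qed.

Lemma sstep1_bnd x : `|sstep1 x| <= 1.
Proof.
rewrite /sstep1 ler_norml.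
have [h|h] := lerP x 0; first by rewrite !pospart_le0; lra.
have [h1|h1] := lerP x 1.
  rewrite (@pospart_ge0 x (ltW h)) !pospart_le0; try lra.
  have : 0 <= x ^+ 2 by rewrite sqr_ge0.
  have : x ^+ 2 <= 1 by rewrite exprn_ile1// ltW.
  lra.
have [h2|h2] := lerP x 2.
  rewrite (@pospart_ge0 x) ?(@pospart_ge0 (x - 1)) ?(@pospart_le0 (x - 2))
    ?(@pospart_le0 (x - 3)); try lra.
  set u := x - 1; have -> : x = u + 1 by rewrite /u; ring.
  have u0 : 0 <= u by rewrite /u; lra.
  have u1 : 0 <= 1 - u by rewrite /u; lra.
  have h3 : 0 <= u * (1 - u) by rewrite mulr_ge0.
  have h4 : u * (1 - u) <= 1 * 1 by apply: ler_pM => //; lra.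
  have : (u + 1) ^+ 2 - 3 * u ^+ 2 = 2 * (u * (1 - u)) + 1 by ring.
  move: h3 h4; set v := u * (1 - u); have : v <= 2^-1.
    rewrite /v; have := sqr_ge0 (u - 2^-1); rewrite (_ : (u - 2^-1) ^+ 2 = 4^-1 - u * (1 - u)).
      lra.
    by field.
  lra.
have [h3|h3] := lerP x 3.
  rewrite (@pospart_ge0 x) ?(@pospart_ge0 (x - 1)) ?(@pospart_ge0 (x - 2))
    ?(@pospart_le0 (x - 3)); try lra.
  have e : x ^+ 2 - 3 * (x - 1) ^+ 2 + 3 * (x - 2) ^+ 2 = (3 - x) ^+ 2 by ring.
  have : 0 <= (3 - x) ^+ 2 by rewrite sqr_ge0.
  have : (3 - x) ^+ 2 <= 1 by rewrite exprn_ile1//; lra.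
  lra.
by rewrite !pospart_ge0; lra.
Qed.

Lemma sstep2_bnd x : `|sstep2 x| <= 2.
Proof.
rewrite /sstep2 ler_norml.
have [h|h] := lerP x 0; first by rewrite !pospart_le0; lra.
have [h1|h1] := lerP x 1; first by rewrite (@pospart_ge0 x (ltW h)) !pospart_le0; lra.
have [h2|h2] := lerP x 2.
  by rewrite (@pospart_ge0 x) ?(@pospart_ge0 (x - 1)) ?(@pospart_le0 (x - 2))
    ?(@pospart_le0 (x - 3)); lra.
have [h3|h3] := lerP x 3.
  by rewrite (@pospart_ge0 x) ?(@pospart_ge0 (x - 1)) ?(@pospart_ge0 (x - 2))
    ?(@pospart_le0 (x - 3)); lra.
by rewrite !pospart_ge0; lra.
Qed.

Lemma count_unit (y : R) (J : nat) :
  \sum_(i < J) ((y <= i%:R < y + 1)%R%:R : R) <= (y <= J%:R - 1)%R%:R.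
Proof.
elim: J => [|J IH]; first by rewrite big_ord0 ler0n.
rewrite big_ord_recr /= -natr1 addrK.
apply: (le_trans (lerD IH (lexx _))).
have [h1|h1] := boolP (y <= J%:R - 1).
  have -> : (J%:R < y + 1) = false by apply/negbTE; rewrite -leNgt; lra.
  have -> : y <= J%:R by lra.
  by rewrite andbF addr0.
by rewrite add0r; case: (y <= J%:R); case: (_ < _); rewrite //= ler01.
Qed.

Lemma count_window (y : R) (J m : nat) :
  \sum_(i < J) ((y <= i%:R < y + m%:R)%R%:R : R) <= m%:R.
Proof.
elim: m => [|m IH].
  by rewrite big1// => i _; rewrite addr0; case: leP.
have -> : (m.+1%:R : R) = m%:R + 1 by rewrite natr1.
apply: (@le_trans _ _ (\sum_(i < J) ((y <= i%:R < y + m%:R)%R%:R +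
   (y + m%:R <= i%:R < y + m%:R + 1)%R%:R : R))).
  apply: ler_sum => i _; rewrite -natrD ler_nat addrA.
  have m0 : 0 <= m%:R :> R by rewrite ler0n.
  case: (lerP y i%:R) => //= h1; case: (ltrP i%:R (y + m%:R + 1)) => //= h2.
  by case: (ltrP i%:R (y + m%:R)).
rewrite big_split lerD//; apply: (le_trans (count_unit _ _)).
by rewrite lern1 leq_b1.
Qed.

End spline.

(** * A partition of unity by unit translates *)

Section smooth_partition.
Variables (R : realType) (J : nat).

(** The plateaus decrease from the constant 1 at [j = 0] to 0 beyond [J], so the differences [hat]
    telescope to 1; the first class collects everything to the left, the last one everything to the
    right. *)
Definition plateau (j : nat) (x : R) : R :=
  if j is 0 then 1 else if (J < j)%N then 0 else sstep (x - j%:R).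

Definition hat (j : nat) (x : R) : R := plateau j x - plateau j.+1 x.

Lemma plateau_bnd j x : 0 <= plateau j x <= 1.
Proof.
by case: j => [|j] /=; rewrite ?ler01 ?lexx//; case: ifP => _; rewrite ?ler01 ?lexx// sstep_bnd.
Qed.

Lemma hat_ge0 j x : 0 <= hat j x.
Proof.
rewrite /hat subr_ge0; case: j => [|j]; first by have /andP[] := plateau_bnd 1 x.
have /andP[p0 _] := plateau_bnd j.+1 x.
rewrite /plateau in p0 *; case: ltnP => // jJ; rewrite ltnNge (ltnW jJ) /=.
by rewrite -(natr1 j.+1) opprD addrA sstep_mono1.
Qed.

Lemma hat_le1 j x : hat j x <= 1.
Proof.
rewrite /hat; have /andP[_ p1] := plateau_bnd j x.
have /andP[p0 _] := plateau_bnd j.+1 x; lra.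
Qed.

Lemma sum_hat x : \sum_(j < J.+1) hat j x = 1.
Proof.
rewrite -(big_mkord xpredT (fun j => hat j x)).
transitivity (- \sum_(0 <= j < J.+1) (plateau j.+1 x - plateau j x)).
  by rewrite -sumrN; apply: eq_bigr => j _; rewrite opprB.
by rewrite telescope_sumr// /plateau ltnSn sub0r opprK.
Qed.

(** The width 4 is the unit spacing plus the rise length 3 of [sstep]. Class 0 is unbounded to the
    left, whence [0 <= x]; the function applied later is [smax], which is nonnegative. *)
Lemma hat_support j x : (j < J)%N -> 0 <= x -> 0 < hat j x ->
  j%:R <= x <= j%:R + 4.
Proof.
move=> jJ x0; rewrite /hat {2}/plateau ltnNge jJ /= => h; apply/andP; split.
  case: j jJ h => [|j] jJ h //; rewrite leNgt; apply/negP => xj.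
  move: h; rewrite /plateau ltnNge (ltnW jJ) /=.
  have [-> _ _] := @sstep_le0 _ (x - j.+1%:R) ltac:(lra).
  by have /andP[h _] := sstep_bnd (x - j.+2%:R); rewrite sub0r oppr_gt0 ltNge h.
rewrite leNgt; apply/negP => xj; move: h.
have [-> _ _] := @sstep_ge3 _ (x - j.+1%:R) ltac:(by rewrite -(natr1 j); lra).
case: j jJ xj => [|j] jJ xj; first by rewrite subrr ltxx.
rewrite /plateau ltnNge (ltnW jJ) /=; have /andP[_ h] := sstep_bnd (x - j.+1%:R).
by rewrite subr_gt0 ltNge h.
Qed.

Lemma hat_last x : 0 < hat J x -> (0 < J)%N -> J%:R <= x.
Proof.
rewrite /hat /plateau ltnSn ltnn subr0; case: J => // j + _.
rewrite leNgt => h; apply/negP => xj.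
by move: h; have [-> _ _] := @sstep_le0 _ (x - j.+1%:R) ltac:(lra); rewrite ltxx.
Qed.

Variable s : nat -> R.
Hypothesis s_bnd : forall j, `|s j| <= 1.

Definition signed_hat x := \sum_(j < J.+1) s j * hat j x.

Lemma signed_hat_bnd x : `|signed_hat x| <= 1.
Proof.
apply: (le_trans (ler_norm_sum _ _ _)); rewrite -[leRHS](sum_hat x).
apply: ler_sum => j _; rewrite normrM (ger0_norm (hat_ge0 _ _)).
by rewrite ler_piMl// hat_ge0.
Qed.

Lemma signed_hatE x :
  signed_hat x = s 0 + \sum_(j < J) (s j.+1 - s j) * sstep (x - j.+1%:R).
Proof.
rewrite /signed_hat big_ord_recr /=.
transitivity (\sum_(j < J) (s j * plateau j x - s j * sstep (x - j.+1%:R)) + s J * plateau J x).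
  congr (_ + _).
    apply: eq_bigr => j _; rewrite /hat mulrBr; congr (_ - _ * _).
    by rewrite /plateau ltnNge ltn_ord.
  by rewrite /hat {2}/plateau ltnSn subr0.
rewrite sumrB addrAC -(big_ord_recr J (fun j => s j * plateau j x)) /=.
rewrite big_ord_recl /= mulr1 -addrA; congr (_ + _).
rewrite -sumrB; apply: eq_bigr => j _.
by rewrite /hat /= ltnNge ltn_ord /= mulrBl.
Qed.

Lemma signed_hat_taylor x : exists f1 f2 : R, [/\ `|f1| <= 48, `|f2| <= 48 &
  forall d, `|d| <= 1 -> `|signed_hat (x + d) - signed_hat x - f1 * d -
     2^-1 * f2 * d ^+ 2| <= 48 * `|d| ^+ 3].
Proof.
have sd j : `|s j.+1 - s j| <= 2.
  by apply: (le_trans (ler_normB _ _)); have := s_bnd j; have := s_bnd j.+1; lra.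
(* Outside this window [x - j.+1] is at most -1 or at least 4, where [sstep] stays constant under
   moves with [|d| <= 1]. *)
pose W (j : 'I_J) : R := (x - 5 <= j%:R < x - 5 + 6%:R)%R%:R.
have cW : \sum_(j < J) W j <= 6 by exact: count_window.
have W01 j : 0 <= W j by rewrite /W ler0n.
have loc (j : 'I_J) : W j = 1 \/ (x - j.+1%:R <= -1) \/ (4 <= x - j.+1%:R).
  rewrite /W -(natr1 j); case: (lerP (x - 5) j%:R) => h1 /=; last by right; right; lra.
  by case: (ltrP j%:R (x - 5 + 6%:R)) => h2; [left|right; left; lra].
exists (\sum_(j < J) (s j.+1 - s j) * sstep1 (x - j.+1%:R)).
exists (\sum_(j < J) (s j.+1 - s j) * sstep2 (x - j.+1%:R)).
have gen (t K : R) (g : 'I_J -> R) : 0 <= t -> 0 <= K -> (forall j, `|g j| <= K * t * W j) ->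
   `|\sum_(j < J) (s j.+1 - s j) * g j| <= 12 * K * t.
  move=> t0 K0 hg; apply: (le_trans (ler_norm_sum _ _ _)).
  apply: (@le_trans _ _ (\sum_(j < J) 2 * (K * t) * W j)).
    by apply: ler_sum => j _; rewrite normrM -mulrA; apply: ler_pM.
  rewrite -mulr_sumr.
  have : 2 * (K * t) * \sum_(j < J) W j <= 2 * (K * t) * 6.
    by rewrite ler_wpM2l// mulr_ge0// mulr_ge0.
  by move/le_trans; apply; rewrite le_eqVlt; apply/orP; left; apply/eqP; ring.
split.
- apply: (@le_trans _ _ (12 * 1 * 1)); last by lra.
  apply: gen => // j; rewrite !mul1r; case: (loc j) => [->|[h|h]]; first exact: sstep1_bnd.
    by have [_ -> _] := @sstep_le0 _ (x - j.+1%:R) ltac:(lra); rewrite normr0.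
  by have [_ -> _] := @sstep_ge3 _ (x - j.+1%:R) ltac:(lra); rewrite normr0.
- apply: (@le_trans _ _ (12 * 2 * 1)); last by lra.
  apply: gen => // j; rewrite mulr1; case: (loc j) => [->|[h|h]].
  + by rewrite mulr1 sstep2_bnd.
  + by have [_ _ ->] := @sstep_le0 _ (x - j.+1%:R) ltac:(lra); rewrite normr0 mulr_ge0.
  + by have [_ _ ->] := @sstep_ge3 _ (x - j.+1%:R) ltac:(lra); rewrite normr0 mulr_ge0.
move=> d d1; rewrite !signed_hatE.
pose g (j : 'I_J) := sstep (x - j.+1%:R + d) - sstep (x - j.+1%:R) -
   sstep1 (x - j.+1%:R) * d - 2^-1 * sstep2 (x - j.+1%:R) * d ^+ 2.
rewrite [X in `|X|](_ : _ = \sum_(j < J) (s j.+1 - s j) * g j).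
  apply: (@le_trans _ _ (12 * 2 * `|d| ^+ 3)); last first.
    by rewrite ler_wpM2r ?exprn_ge0//; lra.
  apply: gen => // j.
  case: (loc j) => [->|[h|h]]; first by rewrite mulr1 sstep_taylor.
    have [e0 e1 e2] := @sstep_le0 _ (x - j.+1%:R) ltac:(lra).
    have [e3 _ _] := @sstep_le0 _ (x - j.+1%:R + d) ltac:(move: d1; rewrite ler_norml; lra).
    by rewrite /g e0 e1 e2 e3 !(mul0r,mulr0,subr0) normr0 !mulr_ge0 ?exprn_ge0.
  have [e0 e1 e2] := @sstep_ge3 _ (x - j.+1%:R) ltac:(lra).
  have [e3 _ _] := @sstep_ge3 _ (x - j.+1%:R + d) ltac:(move: d1; rewrite ler_norml; lra).
  by rewrite /g e0 e1 e2 e3 !(mul0r,mulr0,subr0,subrr) normr0 !mulr_ge0 ?exprn_ge0.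
rewrite opprD addrACA subrr add0r mulr_suml -!sumrB mulr_sumr mulr_suml -sumrB.
apply: eq_bigr => j _; rewrite /g (_ : x + d - j.+1%:R = x - j.+1%:R + d); last by ring.
ring.
Qed.

End smooth_partition.

(** * Hyperbolic cosines and the logarithm of their sums *)

Section softmax.
Variable R : realType.
Implicit Types (x y : R).

Definition coshR x : R := (expR x + expR (- x)) / 2.
Definition sinhR x : R := (expR x - expR (- x)) / 2.

Lemma coshRD x y : coshR (x + y) = coshR x * coshR y + sinhR x * sinhR y.
Proof. by rewrite /coshR /sinhR opprD !expRD; field. Qed.

Lemma coshR_ge1 x : 1 <= coshR x.
Proof.
have := expR_ge1Dx x; have := expR_ge1Dx (- x); rewrite /coshR; lra.
Qed.

Lemma sinhR_le_coshR x : `|sinhR x| <= coshR x.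
Proof.
rewrite /sinhR /coshR ler_norml; have := expR_gt0 x; have := expR_gt0 (- x); lra.
Qed.

Lemma coshR_abs x : coshR `|x| = coshR x.
Proof.
by case: (lerP 0 x) => h; [rewrite ger0_norm|rewrite ltr0_norm// /coshR opprK addrC].
Qed.

Lemma coshR_shift x y : coshR (x + y) <= expR `|y| * coshR x.
Proof.
rewrite /coshR opprD !expRD.
have h1 : expR y <= expR `|y| by rewrite ler_expR ler_norm.
have h2 : expR (- y) <= expR `|y| by rewrite ler_expR -normrN ler_norm.
have a1 : expR x * expR y <= expR `|y| * expR x by rewrite mulrC ler_wpM2r ?expR_ge0.
have a2 : expR (- x) * expR (- y) <= expR `|y| * expR (- x) by rewrite mulrC ler_wpM2r ?expR_ge0.
lra.
Qed.

Lemma expR1_le4 : expR 1 <= 4 :> R.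
Proof.
have h : expR 1 = expR 2^-1 ^+ 2 :> R.
  by rewrite -expRM_natl; congr expR; field.
have := expR_taylor 2 (2^-1 : R).
rewrite /exp_taylor !big_ord_recr big_ord0 /= !factS fact0 /=.
rewrite (ger0_norm (_ : 0 <= 2^-1))// ler_norml => /andP[_ h1].
have h2 : expR 2^-1 <= 2 :> R by lra.
have h3 : 0 <= expR 2^-1 :> R by rewrite expR_ge0.
rewrite h expr2; nra.
Qed.

Lemma exp_taylor_le1 n (y : R) : `|y| <= 1 -> `|expR y - exp_taylor n y| <= 4 * `|y| ^+ n.
Proof.
move=> y1; apply: (le_trans (expR_taylor n y)); rewrite mulrC ler_wpM2r ?exprn_ge0//.
by apply: le_trans expR1_le4; rewrite ler_expR.
Qed.

Lemma coshR_taylor (y : R) : `|y| <= 1 -> `|coshR y - 1 - y ^+ 2 / 2| <= 4 * `|y| ^+ 3.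
Proof.
move=> y1; have h1 := exp_taylor_le1 3 y1.
have := @exp_taylor_le1 3 (- y); rewrite normrN => /(_ y1).
move: h1; rewrite /exp_taylor !big_ord_recr !big_ord0 /= !factS fact0 /= /coshR.
set b := `|y| ^+ 3; rewrite !ler_norml; lra.
Qed.

Lemma sinhR_taylor (y : R) : `|y| <= 1 -> `|sinhR y - y| <= 4 * `|y| ^+ 3.
Proof.
move=> y1; have h1 := exp_taylor_le1 3 y1.
have := @exp_taylor_le1 3 (- y); rewrite normrN => /(_ y1).
move: h1; rewrite /exp_taylor !big_ord_recr !big_ord0 /= !factS fact0 /= /sinhR.
set b := `|y| ^+ 3; rewrite !ler_norml; lra.
Qed.

(* [log (1 + Y)] where [Y] is the relative increment of a sum of hyperbolic cosines when one
   of its terms, of relative weight [q], has its argument moved by [y]. *)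
Lemma ln_coshR_increment (q q' y z : R) : 0 <= q -> q <= 1 -> `|q'| <= q ->
  `|y| <= 1 -> `|z| <= 1 -> expR z = 1 + (q * (coshR y - 1) + q' * sinhR y) ->
  [/\ `|z| <= 16 * (q * `|y|),
      `|z - q' * y - 2^-1 * (q - q' ^+ 2) * y ^+ 2| <= 200 ^+ 2 * (q * `|y| ^+ 3) &
      `|z ^+ 2 - q' ^+ 2 * y ^+ 2| <= 200 ^+ 2 * (q * `|y| ^+ 3)].
Proof.
set Y := _ + _ * sinhR y => q0 q1 q'q y1 z1 ez.
set t := `|y|; have t0 : 0 <= t by exact: normr_ge0.
have t1 : t <= 1 by [].
have hc := coshR_taylor y1; have hs := sinhR_taylor y1.
have Y1 : `|Y - q' * y - 2^-1 * q * y ^+ 2| <= 8 * (q * t ^+ 3).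
  rewrite [X in `|X|](_ : _ = q * (coshR y - 1 - y ^+ 2 / 2) + q' * (sinhR y - y)); last first.
    by rewrite /Y; field.
  apply: (le_trans (ler_normD _ _)); rewrite !normrM (ger0_norm q0).
  have a1 : q * `|coshR y - 1 - y ^+ 2 / 2| <= q * (4 * t ^+ 3) by rewrite ler_wpM2l.
  have a2 : `|q'| * `|sinhR y - y| <= q * (4 * t ^+ 3) by apply: ler_pM.
  have -> : 8 * (q * t ^+ 3) = q * (4 * t ^+ 3) + q * (4 * t ^+ 3) by ring.
  exact: lerD.
have qt0 : 0 <= q * t by rewrite mulr_ge0.
have Y2 : `|Y| <= 4 * (q * t).
  have ch : 0 <= coshR y - 1 by rewrite subr_ge0 coshR_ge1.
  apply: (@le_trans _ _ (q * (coshR y - 1) + q * `|sinhR y|)).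
    apply: (le_trans (ler_normD _ _)); rewrite !normrM (ger0_norm q0) (ger0_norm ch).
    by rewrite lerD2l ler_wpM2r.
  rewrite -mulrDr mulrCA ler_wpM2l//.
  have -> : coshR y - 1 + `|sinhR y| = expR t - 1.
    rewrite -(coshR_abs y) -/t; have -> : `|sinhR y| = sinhR t.
      rewrite /t; case: (lerP 0 y) => h.
        rewrite ger0_norm ?(ger0_norm h)//.
        by rewrite /sinhR divr_ge0// subr_ge0 ler_expR; lra.
      rewrite ltr0_norm ?(ltr0_norm h)/sinhR; first by rewrite opprK; field.
      by rewrite pmulr_llt0 ?invr_gt0// subr_lt0 ltr_expR; lra.
    by rewrite /coshR /sinhR; field.
  have := @exp_taylor_le1 1 t; rewrite ger0_norm// => /(_ t1).
  rewrite /exp_taylor big_ord_recr big_ord0 /= fact0 invr1 expr0 mulr1 add0r expr1.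
  by rewrite ler_norml => /andP[].
have Yz : Y = expR z - 1 by rewrite ez; ring.
have zY : `|z| <= 4 * `|Y|.
  rewrite Yz; case: (lerP 0 z) => h.
    rewrite !ger0_norm//; last by rewrite subr_ge0 -expR0 ler_expR.
    by have := expR_ge1Dx z; lra.
  have ez1 : expR z <= 1 by rewrite -expR0 ler_expR ltW.
  rewrite !ltr0_norm//; last first.
    by rewrite subr_lt0 expR_lt1.
  have h1 : 1 + - z <= expR (- z) by exact: expR_ge1Dx.
  have h2 : expR z * expR (- z) = 1 by rewrite -expRD subrr expR0.
  have h3 : expR (- z) <= 4.
    by apply: le_trans expR1_le4; rewrite ler_expR; move: z1; rewrite ler_norml; lra.
  have h4 : 0 < expR z by rewrite expR_gt0.
  nra.
have z2 : `|z| <= 16 * (q * t) by lra.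
(* Every cubic error keeps one factor [q], as (q t)^3 <= q t^3 for [q <= 1]; this factor is what
   later sums to 1 over the coordinates. *)
have P3 (a b : R) : 0 <= a -> a <= b * (q * t) -> 0 <= b -> a ^+ 3 <= b ^+ 3 * (q * t ^+ 3).
  move=> a0 ab b0; apply: (@le_trans _ _ ((b * (q * t)) ^+ 3)).
    by rewrite lerXn2r ?nnegrE// mulr_ge0.
  rewrite exprMn ler_wpM2l ?exprn_ge0// exprMn ler_wpM2r ?exprn_ge0//.
  by rewrite exprS ler_piMr// exprn_ile1.
have z3 : `|z - Y + z ^+ 2 / 2| <= 4 * 16 ^+ 3 * (q * t ^+ 3).
  have := exp_taylor_le1 3 z1.
  rewrite /exp_taylor !big_ord_recr !big_ord0 /= !factS fact0 /= => h.
  rewrite -normrN [X in `|X|](_ : _ = expR z - (0 + 1^-1 * z ^+ 0 + (1 * 1)%:R^-1 * z ^+ 1 +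
       (2 * (1 * 1))%:R^-1 * z ^+ 2)); last by rewrite Yz; field.
  apply: (le_trans h); have := P3 `|z| 16 (normr_ge0 _) z2; lra.
have q2 : q ^+ 2 <= q by rewrite expr2 ler_piMr.
have qt1 : q * t <= 1 by rewrite -[leRHS]mulr1 ler_pM.
have qt2 : (q * t) ^+ 2 * (q * t) <= q * t ^+ 3.
  have -> : (q * t) ^+ 2 * (q * t) = q ^+ 2 * (q * t ^+ 3) by ring.
  rewrite ler_piMl ?mulr_ge0 ?exprn_ge0//.
  by rewrite exprn_ile1.
have z2sq : z ^+ 2 <= 256 * (q * t) ^+ 2.
  rewrite -real_normK ?num_real//; apply: (@le_trans _ _ ((16 * (q * t)) ^+ 2)).
    by rewrite lerXn2r ?nnegrE// mulr_ge0.
  by rewrite exprMn; lra.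
have z4 : `|z - Y| <= 1152 * (q * t) ^+ 2.
  have := exp_taylor_le1 2 z1.
  rewrite /exp_taylor !big_ord_recr !big_ord0 /= !factS fact0 /= => h.
  rewrite -normrN [X in `|X|](_ : _ = expR z - (0 + 1^-1 * z ^+ 0 + (1 * 1)%:R^-1 * z ^+ 1));
    last by rewrite Yz; field.
  apply: (le_trans h); rewrite real_normK ?num_real//.
  by have := sqr_ge0 (q * t); lra.
have z5 : `|z ^+ 2 - Y ^+ 2| <= 1152 * 20 * (q * t ^+ 3).
  rewrite subr_sqr normrM.
  apply: (@le_trans _ _ ((1152 * (q * t) ^+ 2) * (20 * (q * t)))).
    apply: ler_pM => //; apply: (le_trans (ler_normD _ _)); lra.
  have -> : 1152 * (q * t) ^+ 2 * (20 * (q * t)) = 1152 * 20 * ((q * t) ^+ 2 * (q * t)) by ring.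
  by apply: ler_wpM2l; [lra|exact: qt2].
have yt2 : y ^+ 2 = t ^+ 2 by rewrite real_normK ?num_real.
have t2 : t ^+ 2 <= t by rewrite expr2 ler_piMr.
have t32 : t ^+ 3 <= t ^+ 2 by rewrite exprS ler_piMl ?sqr_ge0.
have z6 : `|Y ^+ 2 - q' ^+ 2 * y ^+ 2| <= 50 * (q * t ^+ 3).
  rewrite -exprMn subr_sqr normrM.
  have a1 : `|Y - q' * y| <= 9 * (q * t ^+ 2).
    have e : Y - q' * y = (Y - q' * y - 2^-1 * q * y ^+ 2) + 2^-1 * q * y ^+ 2 by ring.
    rewrite e; apply: (le_trans (ler_normD _ _)).
    have yq : 2^-1 * q * y ^+ 2 = 2^-1 * (q * t ^+ 2) by rewrite yt2; ring.
    have yq0 : 0 <= 2^-1 * q * y ^+ 2.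
      by apply: mulr_ge0; [apply: mulr_ge0|exact: sqr_ge0].
    rewrite [X in _ + X]ger0_norm//.
    have b1 : q * t ^+ 3 <= q * t ^+ 2 by rewrite ler_wpM2l.
    have b2 : 0 <= q * t ^+ 2 by rewrite mulr_ge0 ?sqr_ge0.
    by move: Y1 b1 b2 yq; lra.
  have a2 : `|Y + q' * y| <= 5 * t.
    apply: (le_trans (ler_normD _ _)); rewrite normrM -/t.
    have b1 : q * t <= t by rewrite ler_piMl.
    have b2 : `|q'| * t <= t by rewrite ler_piMl// (le_trans q'q).
    lra.
  apply: (le_trans (ler_pM (normr_ge0 _) (normr_ge0 _) a1 a2)).
  rewrite (_ : 9 * (q * t ^+ 2) * (5 * t) = 45 * (q * t ^+ 3)); last by ring.
  by rewrite ler_wpM2r ?mulr_ge0 ?exprn_ge0//; lra.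
have qt3 : 0 <= q * t ^+ 3 by rewrite mulr_ge0// exprn_ge0.
split => //.
  rewrite [X in `|X|](_ : _ = (z - Y + z ^+ 2 / 2) - 2^-1 * (z ^+ 2 - Y ^+ 2)
    - 2^-1 * (Y ^+ 2 - q' ^+ 2 * y ^+ 2) + (Y - q' * y - 2^-1 * q * y ^+ 2)); last by field.
  apply: (le_trans (ler_normD _ _)).
  have h1 := ler_normB (z - Y + z ^+ 2 / 2 - 2^-1 * (z ^+ 2 - Y ^+ 2)) (2^-1 * (Y ^+ 2 - q' ^+ 2 *
    y ^+ 2)).
  have h2 := ler_normB (z - Y + z ^+ 2 / 2) (2^-1 * (z ^+ 2 - Y ^+ 2)).
  rewrite !normrM !(ger0_norm (_ : 0 <= 2^-1))// in h1 h2.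
  lra.
rewrite -(subrKA (Y ^+ 2)) (le_trans (ler_normD _ _))//; lra.
Qed.
End softmax.

(** * The smoothed maximum and its expansion along one coordinate *)

Section smoothmax.
Variables (R : realType) (N : nat) (beta lam : R).
Hypotheses (N_gt0 : (0 < N)%N) (lam_ge0 : 0 <= lam) (lam_le1 : lam <= 1).
Implicit Types w v : nat -> R.

(** The hyperbolic cosine handles [w c] and [- w c] together, and being at least 1 it keeps the
    logarithm nonnegative, so that on the values of [smax] class 0 is bounded as well. *)
Definition coshsum w : R := \sum_(c < N) coshR (beta * w c).
Definition smax w : R := lam * ln (coshsum w).
Definition shift w (c : nat) (x : R) : nat -> R := fun i => if i == c then w i + x else w i.

Lemma coshsum_ge1 w : 1 <= coshsum w.
Proof.
rewrite /coshsum (bigD1 (Ordinal N_gt0))//= (le_trans (coshR_ge1 (beta * w 0%N)))//.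
by rewrite lerDl sumr_ge0// => i _; apply: le_trans (coshR_ge1 _); exact: ler01.
Qed.

Lemma coshsum_gt0 w : 0 < coshsum w.
Proof. exact: lt_le_trans ltr01 (coshsum_ge1 w). Qed.

Lemma smax_ge0 w : 0 <= smax w.
Proof. by rewrite mulr_ge0// ln_ge0// coshsum_ge1. Qed.

Lemma coshsum_le w v a : (forall c, (c < N)%N -> `|beta * (w c - v c)| <= a) ->
  coshsum w <= expR a * coshsum v.
Proof.
move=> h; rewrite /coshsum mulr_sumr; apply: ler_sum => c _.
have -> : beta * w c = beta * v c + beta * (w c - v c) by ring.
apply: (le_trans (coshR_shift _ _)); rewrite ler_wpM2r//.
  by apply: le_trans (coshR_ge1 _); exact: ler01.
by rewrite ler_expR h.
Qed.

Lemma ln_coshsum_lip w v a : (forall c, (c < N)%N -> `|beta * (w c - v c)| <= a) ->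
  `|ln (coshsum w) - ln (coshsum v)| <= a.
Proof.
move=> h; have h' c : (c < N)%N -> `|beta * (v c - w c)| <= a.
  by move=> cN; rewrite -normrN -mulrN opprB h.
have l1 := coshsum_le h; have l2 := coshsum_le h'.
have g x y : coshsum x <= expR a * coshsum y -> ln (coshsum x) <= a + ln (coshsum y).
  move=> xy; rewrite -[a in a + _](expRK a) -lnM ?posrE ?expR_gt0 ?coshsum_gt0//.
  by rewrite ler_ln// ?posrE ?mulr_gt0 ?expR_gt0 ?coshsum_gt0.
by have := g _ _ l1; have := g _ _ l2; rewrite ler_norml; lra.
Qed.

Lemma smax_lip w v a : (forall c, (c < N)%N -> `|beta * (w c - v c)| <= a) ->
  `|smax w - smax v| <= lam * a.
Proof.
by move=> h; rewrite /smax -mulrBr normrM (ger0_norm lam_ge0) ler_wpM2l// ln_coshsum_lip.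
Qed.

(** The addition formula puts the relative increment of the sum in the form required by
    [ln_coshR_increment], with the weights [q] and [q'] given by cosh and sinh divided by the
    sum. *)
Lemma coshsum_shift w c x : (c < N)%N ->
  coshsum (shift w c x) = coshsum w * (1 +
    (coshR (beta * w c) / coshsum w * (coshR (beta * x) - 1) +
     sinhR (beta * w c) / coshsum w * sinhR (beta * x))).
Proof.
move=> cN; have D0 : coshsum w != 0 by rewrite gt_eqF// coshsum_gt0.
transitivity (coshsum w + (coshR (beta * w c) * (coshR (beta * x) - 1) +
     sinhR (beta * w c) * sinhR (beta * x))); last by field.
rewrite {1 2}/coshsum (bigD1 (Ordinal cN))//= [in RHS](bigD1 (Ordinal cN))//=.
rewrite /shift eqxx mulrDr coshRD.
under eq_bigr => i ic do rewrite ifN//.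
by ring.
Qed.

(** The weights [q c] are the cosh terms divided by their sum, so they add up to 1. Moves with
    [|beta * x| <= 1] go through [ln_coshR_increment] and the expansion of [f], powers of [lam <= 1]
    being reduced to [lam]. For larger moves [|f| <= 1] bounds the increment by 2, and the
    subtracted Taylor terms are absorbed in the cubic bound. *)
Lemma smax_taylor (f : R -> R) (K : R) : 0 <= K -> (forall x, `|f x| <= 1) ->
  (forall x, exists f1 f2 : R, [/\ `|f1| <= K, `|f2| <= K &
     forall d, `|d| <= 1 -> `|f (x + d) - f x - f1 * d - 2^-1 * f2 * d ^+ 2| <= K * `|d| ^+ 3]) ->
  forall w, exists q b e : nat -> R, [/\ forall c, 0 <= q c, \sum_(c < N) q c <= 1 &
    forall c x, (c < N)%N ->
      `|f (smax (shift w c x)) - f (smax w) - b c * x - e c * x ^+ 2|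
      <= K * 300 ^+ 2 * (lam * (q c * `|beta * x| ^+ 3)) + 2 * (1 < `|beta * x|)%R%:R].
Proof.
move=> K0 f_bnd f_taylor w.
have [f1 [f2 [f1K f2K fT]]] := f_taylor (smax w).
pose D := coshsum w; have D0 : 0 < D := coshsum_gt0 w.
pose q c := coshR (beta * w c) / D; pose q' c := sinhR (beta * w c) / D.
have q_ge0 c : 0 <= q c by rewrite divr_ge0 ?(ltW D0)// (le_trans ler01)// coshR_ge1.
have sumq : \sum_(c < N) q c = 1 by rewrite -mulr_suml mulfV ?gt_eqF.
have q_le1 c : (c < N)%N -> q c <= 1.
  by move=> cN; rewrite -sumq (bigD1 (Ordinal cN))//= lerDl sumr_ge0.
have q'q c : `|q' c| <= q c.
  by rewrite /q' normrM (@ger0_norm _ D^-1) ?invr_ge0 ?(ltW D0)// ler_wpM2r ?invr_ge0 ?(ltW D0)//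
    sinhR_le_coshR.
(* Chain rule: along coordinate [c] the logarithmic sum has derivatives [beta * q'] and
   [beta ^+ 2 * (q - q' ^+ 2)]. With [f1], [f2] for the derivatives of [f], [b] is the first and [e]
   half the second derivative of [f] composed with [smax]. *)
pose b c := f1 * (lam * q' c) * beta.
pose e c := 2^-1 * (f1 * (lam * (q c - q' c ^+ 2)) + f2 * (lam ^+ 2 * q' c ^+ 2)) * beta ^+ 2.
exists q, b, e; split => //; first by rewrite sumq.
move=> c x cN; set y := beta * x; set t := `|y|.
have t0 : 0 <= t by exact: normr_ge0.
have t3 : 0 <= lam * (q c * t ^+ 3).
  by apply: mulr_ge0 => //; apply: mulr_ge0 => //; exact: exprn_ge0.
have KK : 0 <= K * (lam * (q c * t ^+ 3)) by rewrite mulr_ge0.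
set F := f (smax (shift w c x)) - f (smax w).
have -> : F - b c * x - e c * x ^+ 2 = F - f1 * (lam * q' c) * y -
   2^-1 * (f1 * (lam * (q c - q' c ^+ 2)) + f2 * (lam ^+ 2 * q' c ^+ 2)) * y ^+ 2.
  by rewrite /b /e /y; ring.
have q'2 : 0 <= q' c ^+ 2 <= q c.
  rewrite sqr_ge0 /= -real_normK ?num_real// (@le_trans _ _ (q c ^+ 2))//.
    by rewrite lerXn2r ?nnegrE.
  by rewrite expr2 ler_piMr// q_le1.
have [ht|ht] := ltrP 1 t.
  have a1 : `|F| <= 2.
    by apply: (le_trans (ler_normB _ _)); have := f_bnd (smax (shift w c x)); have := f_bnd (smax
      w); lra.
  have tt1 : t <= t ^+ 3 by rewrite exprS ler_peMr// exprn_ege1// ltW.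
  have tt2 : t ^+ 2 <= t ^+ 3 by rewrite exprS ler_peMl ?sqr_ge0// ltW.
  have a2 : `|f1 * (lam * q' c) * y| <= K * (lam * (q c * t ^+ 3)).
    rewrite (normrM _ y) (normrM f1) (normrM lam) (ger0_norm lam_ge0) -/t.
    rewrite -(mulrA `|f1|) -(mulrA lam).
    apply: ler_pM => //; first by apply: mulr_ge0 => //; exact: mulr_ge0.
    by apply: ler_wpM2l => //; apply: ler_pM.
  have a3 : `|2^-1 * (f1 * (lam * (q c - q' c ^+ 2)) + f2 * (lam ^+ 2 * q' c ^+ 2)) * y ^+ 2|
      <= K * (lam * (q c * t ^+ 3)).
    have yt2 : y ^+ 2 = t ^+ 2 by rewrite real_normK ?num_real.
    have c1 : `|f1 * (lam * (q c - q' c ^+ 2))| <= K * (lam * q c).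
      rewrite (normrM f1) (normrM lam) (ger0_norm lam_ge0); apply: ler_pM => //.
        exact: mulr_ge0.
      by apply: ler_wpM2l => //; rewrite ger0_norm; move: q'2 => /andP[]; lra.
    have c2 : `|f2 * (lam ^+ 2 * q' c ^+ 2)| <= K * (lam * q c).
      rewrite (normrM f2) (normrM (lam ^+ 2)) (ger0_norm (sqr_ge0 lam)).
      rewrite (ger0_norm (sqr_ge0 (q' c))); apply: ler_pM => //.
        by apply: mulr_ge0; exact: sqr_ge0.
      move: q'2 => /andP[q1 q2].
      by apply: ler_pM => //; [exact: sqr_ge0|rewrite expr2 ler_piMr].
    rewrite (normrM _ (y ^+ 2)) (normrM 2^-1) (ger0_norm (_ : 0 <= 2^-1))// yt2 (ger0_norm
      (sqr_ge0 t)).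
    apply: (@le_trans _ _ (K * (lam * q c) * t ^+ 2)).
      rewrite ler_wpM2r ?sqr_ge0//.
      by have := ler_normD (f1 * (lam * (q c - q' c ^+ 2))) (f2 * (lam ^+ 2 * q' c ^+ 2)); lra.
    rewrite -(mulrA K) -(mulrA lam); apply: ler_wpM2l => //; apply: ler_wpM2l => //.
    exact: ler_wpM2l.
  have n1 := ler_normB (F - f1 * (lam * q' c) * y) (2^-1 * (f1 * (lam * (q c - q' c ^+ 2)) + f2 *
    (lam ^+ 2 * q' c ^+ 2)) * y ^+ 2).
  have n2 := ler_normB F (f1 * (lam * q' c) * y).
  have -> : K * 300 ^+ 2 * (lam * (q c * t ^+ 3)) = 300 ^+ 2 * (K * (lam * (q c * t ^+ 3))).
    by ring.
  rewrite mulr1; lra.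
rewrite mulr0 addr0.
pose z := ln (coshsum (shift w c x)) - ln D.
have z1 : `|z| <= t.
  apply: ln_coshsum_lip => i iN; rewrite /shift; case: eqP => [->|_].
    by rewrite addrC addKr.
  by rewrite subrr mulr0 normr0.
have ez : expR z = 1 + (q c * (coshR y - 1) + q' c * sinhR y).
  rewrite /z -ln_div ?posrE ?coshsum_gt0// lnK ?posrE ?divr_gt0 ?coshsum_gt0//.
  by rewrite coshsum_shift// mulrAC mulfV ?mul1r// gt_eqF.
have [Z1 Z2 Z3] := ln_coshR_increment (q_ge0 c) (q_le1 c cN) (q'q c) ht (le_trans z1 ht) ez.
have eF : smax (shift w c x) = smax w + lam * z by rewrite /smax /z -/D; ring.
have lz : `|lam * z| <= 1.
  by rewrite normrM (ger0_norm lam_ge0) mulr_ile1// (le_trans z1).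
have T := fT _ lz; rewrite -eF -/F in T.
have b1 : K * `|lam * z| ^+ 3 <= 16 ^+ 3 * (K * (lam * (q c * t ^+ 3))).
  rewrite (normrM lam) (ger0_norm lam_ge0) (mulrCA (16 ^+ 3)); apply: ler_wpM2l => //.
  rewrite exprMn.
  have l3 : lam ^+ 3 <= lam by rewrite exprS ler_piMr// exprn_ile1.
  have z3 : `|z| ^+ 3 <= 16 ^+ 3 * (q c * t ^+ 3).
    apply: (@le_trans _ _ ((16 * (q c * t)) ^+ 3)).
      by rewrite lerXn2r ?nnegrE//; apply: mulr_ge0 => //; exact: mulr_ge0.
    rewrite exprMn; apply: ler_wpM2l; first exact: exprn_ge0.
    rewrite exprMn; apply: ler_wpM2r; first exact: exprn_ge0.
    by rewrite exprS ler_piMr// exprn_ile1// q_le1.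
  by rewrite (mulrCA (16 ^+ 3)); apply: ler_pM => //; rewrite exprn_ge0.
have b2 : `|f1 * lam * (z - q' c * y - 2^-1 * (q c - q' c ^+ 2) * y ^+ 2)| <=
    200 ^+ 2 * (K * (lam * (q c * t ^+ 3))).
  rewrite (normrM (f1 * lam)) (normrM f1) (ger0_norm lam_ge0) -mulrA.
  rewrite (mulrCA (200 ^+ 2)); apply: ler_pM => //; first exact: mulr_ge0.
  by rewrite (mulrCA (200 ^+ 2)); apply: ler_wpM2l.
have b3 : `|f2 * lam ^+ 2 * (z ^+ 2 - q' c ^+ 2 * y ^+ 2)| <=
    200 ^+ 2 * (K * (lam * (q c * t ^+ 3))).
  rewrite (normrM (f2 * lam ^+ 2)) (normrM f2) (ger0_norm (sqr_ge0 lam)) -mulrA.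
  rewrite (mulrCA (200 ^+ 2)); apply: ler_pM => //.
    by apply: mulr_ge0 => //; exact: sqr_ge0.
  rewrite (mulrCA (200 ^+ 2)); apply: ler_pM => //; first exact: sqr_ge0.
  by rewrite expr2 ler_piMr.
have -> : F - f1 * (lam * q' c) * y - 2^-1 * (f1 * (lam * (q c - q' c ^+ 2)) +
      f2 * (lam ^+ 2 * q' c ^+ 2)) * y ^+ 2 =
   (F - f1 * (lam * z) - 2^-1 * f2 * (lam * z) ^+ 2)
   + f1 * lam * (z - q' c * y - 2^-1 * (q c - q' c ^+ 2) * y ^+ 2)
   + 2^-1 * (f2 * lam ^+ 2 * (z ^+ 2 - q' c ^+ 2 * y ^+ 2)) by ring.
have n1 := ler_normD (F - f1 * (lam * z) - 2^-1 * f2 * (lam * z) ^+ 2 + f1 * lam * (z - q' c * y -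
  2^-1 * (q c - q' c ^+ 2) * y ^+ 2)) (2^-1 * (f2 * lam ^+ 2 * (z ^+ 2 - q' c ^+ 2 * y ^+ 2))).
have n2 := ler_normD (F - f1 * (lam * z) - 2^-1 * f2 * (lam * z) ^+ 2) (f1 * lam * (z - q' c * y -
  2^-1 * (q c - q' c ^+ 2) * y ^+ 2)).
rewrite (normrM 2^-1) (ger0_norm (_ : 0 <= 2^-1))// in n1.
have -> : K * 300 ^+ 2 * (lam * (q c * t ^+ 3)) = 300 ^+ 2 * (K * (lam * (q c * t ^+ 3))).
  by ring.
lra.
Qed.

Definition maxabs w : R := \big[Order.max/0]_(c < N) `|w c|.

Lemma maxabs_ge0 w : 0 <= maxabs w.
Proof. by rewrite /maxabs; elim/big_ind : _ => // x y x0 y0; rewrite le_max x0. Qed.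

Lemma maxabs_ge w c : (c < N)%N -> `|w c| <= maxabs w.
Proof. by move=> cN; rewrite /maxabs (le_bigmax _ (fun c : 'I_N => `|w c|) (Ordinal cN)). Qed.

Lemma maxabs_le w a : 0 <= a -> (forall c, (c < N)%N -> `|w c| <= a) -> maxabs w <= a.
Proof. by move=> a0 h; apply/bigmax_leP; split => // i _; exact: h. Qed.

Lemma maxabs_attained w : exists2 c, (c < N)%N & maxabs w = `|w c|.
Proof.
rewrite /maxabs (bigmax_eq_arg _ (Ordinal N_gt0))//.
by eexists; last reflexivity; exact: ltn_ord.
Qed.

(** The sum lies between exp(beta M) / 2 and N exp(beta M), where M is the maximum. *)
Lemma ln_coshsum_max w : 0 <= beta ->
  `|ln (coshsum w) - beta * maxabs w| <= ln (2 * N%:R).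
Proof.
move=> b0; have N1 : 1 <= N%:R :> R by rewrite ler1n.
have D0 := coshsum_gt0 w; set M := maxabs w.
have M0 : 0 <= M := maxabs_ge0 w.
have ln2 : 0 <= ln 2 :> R by rewrite ln_ge0//; lra.
have lnN : 0 <= ln N%:R :> R by rewrite ln_ge0.
have e0 (a : R) : a = ln (expR a) by rewrite expRK.
rewrite lnM ?posrE//; last by lra.
rewrite ler_norml; apply/andP; split.
  have [c cN Mc] := maxabs_attained w.
  have : ln (expR (beta * M) / 2) <= ln (coshsum w).
    rewrite ler_ln ?posrE ?divr_gt0 ?expR_gt0//.
    rewrite /coshsum (bigD1 (Ordinal cN))//= -[leLHS]addr0 lerD//; last first.
      by rewrite sumr_ge0// => i _; apply: le_trans (coshR_ge1 _).
    rewrite -coshR_abs normrM (ger0_norm b0) -Mc /coshR ler_wpM2r ?invr_ge0//.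
    by rewrite lerDl expR_ge0.
  by rewrite ln_div ?posrE ?expR_gt0// expRK; lra.
have : ln (coshsum w) <= ln (N%:R * expR (beta * M)).
  rewrite ler_ln ?posrE ?mulr_gt0 ?expR_gt0//; last by lra.
  rewrite mulr_natl -[X in _ *+ X](card_ord N) -sumr_const; apply: ler_sum => c _.
  rewrite -coshR_abs normrM (ger0_norm b0) /coshR.
  have a1 : expR (beta * `|w c|) <= expR (beta * M).
    by rewrite ler_expR ler_wpM2l// maxabs_ge.
  have a2 : expR (- (beta * `|w c|)) <= expR (beta * M).
    rewrite ler_expR (@le_trans _ _ 0)// ?oppr_le0 mulr_ge0//.
  lra.
by rewrite lnM ?posrE ?expR_gt0// ?expRK; lra.
Qed.

End smoothmax.

(** * Lindeberg replacement *)

Lemma shiftE (R : realType) (w : nat -> R) c x :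
  shift w c x = fun i => w i + (c == i)%:R * x.
Proof.
apply/funext => i; rewrite /shift eq_sym; case: eqP => _; first by rewrite mul1r.
by rewrite mul0r addr0.
Qed.

Notation RR R := (measurableTypeR R).
Arguments std_normal : simpl never.

Section onestep.
Context d (T : measurableType d) (R : realType) (P : probability T R).
Variables (N : nat) (L : T -> nat) (xi : T -> R).
Hypotheses (mL : forall c, measurable_fun setT (fun t => (L t == c)%:R : R))
  (mxi : measurable_fun setT xi) (LN : forall t, (L t < N)%N)
  (xi3 : P.-integrable setT (EFin \o (fun t => `|xi t| ^+ 3))).
Variables (F : (nat -> R) -> R) (beta B : R).
Hypotheses (mF : measurable_fun setT (F : seqspace (RR R) -> R)) (F1 : forall w, `|F w| <= 1).
Hypothesis B0 : 0 <= B.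

Definition cellmoment (k : nat) (c : nat) : R := \int[P]_t ((L t == c)%:R * xi t ^+ k).
Definition cellabs3 (c : nat) : R := \int[P]_t ((L t == c)%:R * `|xi t| ^+ 3).

Lemma integrable_cell k c : (k <= 3)%N ->
  P.-integrable setT (EFin \o (fun t => (L t == c)%:R * xi t ^+ k)).
Proof.
move=> k3; apply: (@integrable_domR _ _ _ P _ (fun t => 1 + `|xi t| ^+ 3)).
- by apply: measurable_funM => //; exact: measurable_funX.
- move=> t; rewrite normrM normrX ger0_norm ?ler0n//.
  apply: (@le_trans _ _ (`|xi t| ^+ k)).
    by rewrite ler_piMl// ?exprn_ge0//; case: (_ == _).
  have [h|h] := lerP `|xi t| 1.
    by rewrite (@le_trans _ _ 1)// ?exprn_ile1// lerDl exprn_ge0.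
  rewrite (@le_trans _ _ (`|xi t| ^+ 3))//; last by rewrite lerDr.
  by rewrite ler_weXn2l// ltW.
- by apply: integrableDR => //; exact: integrable_prob_cst.
Qed.

Lemma integrable_cellabs3 c :
  P.-integrable setT (EFin \o (fun t => (L t == c)%:R * `|xi t| ^+ 3)).
Proof.
apply: (@integrable_domR _ _ _ P _ (fun t => `|xi t| ^+ 3)) => //.
  apply: measurable_funM => //; apply: measurable_funX.
  by apply: measurableT_comp => //; exact: normr_measurable.
move=> t; rewrite normrM normrX normr_id ger0_norm ?ler0n//.
by rewrite ler_piMl// ?exprn_ge0//; case: (_ == _).
Qed.

Lemma sum_cell (g : nat -> R) t : \sum_(c < N) (L t == c)%:R * g c = g (L t).
Proof.
rewrite (bigD1 (Ordinal (LN t)))//= eqxx mul1r big1 ?addr0// => c.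
by rewrite -val_eqE /= eq_sym => /negPf ->; rewrite mul0r.
Qed.

Lemma measurable_shift (w : nat -> R) :
  measurable_fun setT (fun t => shift w (L t) (xi t) : seqspace (RR R)).
Proof.
apply: measurable_seqspace => i; under eq_fun do rewrite shiftE.
by apply: measurable_funD => //; apply: measurable_funM.
Qed.

(** The first-order term vanishes cell by cell because the steps are centred. Label and step are
    arbitrary, so that the bound serves for an observation and, with a constant label, for a
    Gaussian jump. *)
Lemma onestep w (q b e : nat -> R) :
  (forall c x, (c < N)%N -> `|F (shift w c x) - F w - b c * x - e c * x ^+ 2|
      <= B * (q c * `|x| ^+ 3) + 2 * (1 < `|beta * x|)%R%:R) ->
  (forall c, (c < N)%N -> cellmoment 1 c = 0) ->
  `|\int[P]_t F (shift w (L t) (xi t)) - F w - \sum_(c < N) e c * cellmoment 2 c|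
   <= B * \sum_(c < N) q c * cellabs3 c + 2 * fine (P [set t | 1 < `|beta * xi t|]%R).
Proof.
move=> HT m1.
have mA : measurable [set t | 1 < `|beta * xi t|]%R.
  rewrite -[X in measurable X]setTI; apply: (measurable_fun_ltr (f := cst 1)) => //.
  apply: measurableT_comp; first exact: normr_measurable.
  exact: measurable_funM.
have iF : P.-integrable setT (EFin \o (fun t => F (shift w (L t) (xi t)))).
  apply: (@bounded_integrable _ _ _ _ _ 1) => //.
  exact: (measurableT_comp mF (measurable_shift w)).
pose S1 t := \sum_(c < N) b c * ((L t == c)%:R * xi t ^+ 1).
pose S2 t := \sum_(c < N) e c * ((L t == c)%:R * xi t ^+ 2).
pose S3 t := \sum_(c < N) q c * ((L t == c)%:R * `|xi t| ^+ 3).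
have iS1 : P.-integrable setT (EFin \o S1).
  by apply: integrable_sumR => c; apply: integrableZlR; exact: integrable_cell.
have iS2 : P.-integrable setT (EFin \o S2).
  by apply: integrable_sumR => c; apply: integrableZlR; exact: integrable_cell.
have iS3 : P.-integrable setT (EFin \o S3).
  by apply: integrable_sumR => c; apply: integrableZlR; exact: integrable_cellabs3.
have e1 : \int[P]_t S1 t = 0.
  rewrite Rintegral_sum; last by move=> c; apply: integrableZlR; exact: integrable_cell.
  apply: big1 => c _; rewrite RintegralZl//; last exact: integrable_cell.
  by have := m1 c (ltn_ord c); rewrite /cellmoment => ->; rewrite mulr0.
have e2 : \int[P]_t S2 t = \sum_(c < N) e c * cellmoment 2 c.
  rewrite Rintegral_sum; last by move=> c; apply: integrableZlR; exact: integrable_cell.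
  by apply: eq_bigr => c _; rewrite RintegralZl//; exact: integrable_cell.
have e3 : \int[P]_t S3 t = \sum_(c < N) q c * cellabs3 c.
  rewrite Rintegral_sum; last by move=> c; apply: integrableZlR; exact: integrable_cellabs3.
  by apply: eq_bigr => c _; rewrite RintegralZl//; exact: integrable_cellabs3.
pose r t := F (shift w (L t) (xi t)) - F w - S1 t - S2 t.
have i1 : P.-integrable setT (EFin \o (fun t => F (shift w (L t) (xi t)) - F w)).
  by apply: integrableBR => //; exact: integrable_prob_cst.
have i2 : P.-integrable setT (EFin \o (fun t => F (shift w (L t) (xi t)) - F w - S1 t)).
  exact: integrableBR.
have ir : P.-integrable setT (EFin \o r) by exact: integrableBR.
have er : \int[P]_t r t = \int[P]_t F (shift w (L t) (xi t)) - F w -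
     \sum_(c < N) e c * cellmoment 2 c.
  rewrite RintegralB// RintegralB// RintegralB//; last exact: integrable_prob_cst.
  by rewrite Rintegral_prob_cst e1 e2 subr0.
rewrite -er; apply: (le_trans (le_normr_Rintegral _ ir)) => //.
have iI : P.-integrable setT (EFin \o (\1_[set t | 1 < `|beta * xi t|]%R : T -> R)).
  exact: integrable_indic.
rewrite -e3 -Rintegral_indic// -!RintegralZl// -RintegralD//; try exact: integrableZlR.
apply: le_Rintegral => //.
- exact: integrable_norm.
- by apply: integrableDR; exact: integrableZlR.
move=> t _; rewrite /r.
have -> : S1 t = b (L t) * xi t.
  rewrite -(sum_cell (fun c => b c * xi t)); apply: eq_bigr => c _; rewrite expr1; ring.
have -> : S2 t = e (L t) * xi t ^+ 2.
  by rewrite -(sum_cell (fun c => e c * xi t ^+ 2)); apply: eq_bigr => c _; ring.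
have -> : S3 t = q (L t) * `|xi t| ^+ 3.
  by rewrite -(sum_cell (fun c => q c * `|xi t| ^+ 3)); apply: eq_bigr => c _; ring.
rewrite indicE (_ : (t \in _) = (1 < `|beta * xi t|)); first exact: HT.
by apply/idP/idP; rewrite inE.
Qed.

End onestep.

(** * Merging of independent Gaussian variables *)

Section gaussian_smoothing.
Variable R : realType.
Notation gs := (@std_normal R).
Notation Omega := (seqspace (RR R)).
Definition gauss_seq : probability Omega R := seq_measure gs.

(** The added case [b = 0] occurs at a Gaussian jump in a coordinate whose variance is still
    zero. *)
Lemma std_normal_convolution' (a b : R) (B : set R) : 0 <= a -> 0 <= b ->
  a ^+ 2 + b ^+ 2 = 1 -> measurable B ->
  (\int[gs]_g gs [set z | B (b * z + a * g)%R] = gs B)%E.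
Proof.
move=> a0; rewrite le_eqVlt => /predU1P[<-|b0] ab mB; last exact: std_normal_convolution.
have a1 : a = 1.
  apply/eqP; rewrite -(@eqrXn2 _ 2)// ?ler01// expr1n -ab expr0n addr0//.
transitivity (\int[gs]_g (\1_B g)%:E)%E; last by rewrite integral_indic// setIT.
apply: eq_integral => g _; rewrite indicE.
case: (boolP (g \in B)) => [/set_mem Bg|/negP Bg].
  rewrite (_ : [set z | _] = setT); first exact: probability_setT.
  by apply/seteqP; split => z //= _; rewrite mul0r add0r a1 mul1r.
rewrite (_ : [set z | _] = set0) ?measure0//.
by apply/seteqP; split => z //=; rewrite mul0r add0r a1 mul1r => h; apply: Bg; exact: mem_set.
Qed.

(* Variance [V c] of the [c]-th coordinate is increased by [a ^+ 2]: the standardized coordinate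
   mixes the old one with a fresh independent Gaussian. *)
Definition mixcoord (c : nat) (a b : R) (x : R * Omega) : Omega :=
  fun i => if i == c then b * x.2 i + a * x.1 else x.2 i.

Lemma measurable_mixcoord c a b :
  measurable_fun setT (mixcoord c a b : (RR R * Omega)%type -> Omega).
Proof.
apply: measurable_seqspace => i; rewrite /mixcoord; case: eqP => _.
  apply: measurable_funD; apply: measurable_funM => //.
  exact: (measurableT_comp (@measurable_coord _ (RR R) i) measurable_snd).
exact: (measurableT_comp (@measurable_coord _ (RR R) i) measurable_snd).
Qed.

Lemma mixcoord_law c a b A : 0 <= a -> 0 <= b -> a ^+ 2 + b ^+ 2 = 1 ->
  measurable A -> (gs \x gauss_seq)%E (mixcoord c a b @^-1` A) = gauss_seq A.
Proof.
move=> a0 b0 ab mA.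
pose phi : {mfun (RR R * Omega)%type >-> Omega} :=
  HB.pack (mixcoord c a b : (RR R * Omega)%type -> Omega)
    (isMeasurableFun.Build _ _ _ _ (mixcoord c a b : (RR R * Omega)%type -> Omega)
      (measurable_mixcoord c a b)).
suff : distribution (gs \x gauss_seq)%E phi A = seq_measure gs A by [].
apply: seq_measure_unique => // n B mB.
change ((gs \x gauss_seq)%E (mixcoord c a b @^-1` rectangle n B) = \prod_(i < n) gs (B i))%E.
pose B' g i := if i == c then [set z | B i (b * z + a * g)] else B i.
have mB' g i : measurable (B' g i).
  rewrite /B'; case: eqP => _; last exact: mB.
  have : measurable_fun setT (fun z : RR R => b * z + a * g : RR R).
    by apply: measurable_funD => //; exact: measurable_funM.
  by move=> /(_ measurableT _ (mB i)); rewrite setTI.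
transitivity (\int[gs]_g \prod_(i < n) gs (B' g i))%E.
  rewrite /product_measure1; apply: eq_integral => g _ /=.
  rewrite -(seq_measure_rectangle gs n (mB' g)); congr (seq_measure _ _).
  apply/seteqP; split => z; rewrite /xsection /rectangle /= inE /B' /mixcoord /= => h i ni;
    by have := h i ni; case: eqP.
have [cn|nc] := ltnP c n; last first.
  under eq_integral => g _.
    rewrite (eq_bigr (fun i : 'I_n => gs (B i))); last first.
      by move=> i _; rewrite /B' ifN// neq_ltn (leq_trans (ltn_ord i) nc).
    over.
  exact: (integral_prob_cst gs).
rewrite [RHS](bigD1 (Ordinal cn))//=.
under eq_integral => g _.
  rewrite (bigD1 (Ordinal cn))//= {1}/B' eqxx.
  rewrite (eq_bigr (fun i : 'I_n => gs (B i))); last first.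
    by move=> i; rewrite -val_eqE /= /B' => /negPf ->.
  over.
have fp : (\prod_(i < n | i != Ordinal cn) gs (B i))%E \is a fin_num.
  by apply: prode_fin_num => i _; exact: (fin_num_measure gs _ (mB i)).
rewrite -(std_normal_convolution' a0 b0 ab (mB c)).
rewrite -[in LHS](fineK fp) -[in RHS](fineK fp) ge0_integralZr//.
- have mC : measurable [set x : (RR R * RR R)%type | B c (b * x.2 + a * x.1)].
    rewrite -[X in measurable X]setTI.
    have : measurable_fun setT (fun x : (RR R * RR R)%type => b * x.2 + a * x.1 : RR R).
      by apply: measurable_funD => //; apply: measurable_funM.
    by apply.
  have := measurable_fun_xsection gs mC; congr (measurable_fun _ _).
  apply/funext => g /=; congr (gs _); apply/seteqP; split => z;
  by rewrite /xsection /= inE.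
- rewrite fineK// prode_ge0// => *; exact: measure_ge0.
Qed.

End gaussian_smoothing.

(** * Averages over random cell counts *)

Section label_average.
Variables (R : realType) (N : nat) (p a : nat -> R).
Hypotheses (p_ge0 : forall c, 0 <= p c) (p_sum : \sum_(c < N) p c = 1).

(* Expectation of [h] over the random variance profile obtained from [V] by [n] independent draws
   of a label, label [c] adding [a c ^+ 2] to coordinate [c]. *)
Fixpoint label_avg (n : nat) (h : (nat -> R) -> R) (V : nat -> R) : R :=
  if n is m.+1 then \sum_(c < N) p c * label_avg m h (shift V c (a c ^+ 2)) else h V.

Definition nonneg_profile (V : nat -> R) := forall i, 0 <= V i.

Lemma nonneg_shift V c x : nonneg_profile V -> 0 <= x -> nonneg_profile (shift V c x).
Proof. by move=> V0 x0 i; rewrite /shift; case: eqP => // _; rewrite addr_ge0. Qed.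

Lemma label_avg_le n h h' V : nonneg_profile V ->
  (forall V, nonneg_profile V -> h V <= h' V) -> label_avg n h V <= label_avg n h' V.
Proof.
move=> V0 hh; elim: n V V0 => [|n IH] V V0 /=; first exact: hh.
apply: ler_sum => c _; apply: ler_wpM2l => //; apply: IH.
by apply: nonneg_shift => //; exact: sqr_ge0.
Qed.

Lemma label_avgD n h h' V :
  label_avg n (fun V => h V + h' V) V = label_avg n h V + label_avg n h' V.
Proof.
elim: n V => [|n IH] V //=; rewrite -big_split; apply: eq_bigr => c _.
by rewrite IH mulrDr.
Qed.

Lemma label_avgZ n k h V : label_avg n (fun V => k * h V) V = k * label_avg n h V.
Proof.
elim: n V => [|n IH] V //=; rewrite mulr_sumr; apply: eq_bigr => c _.
by rewrite IH mulrCA.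
Qed.

Lemma label_avg_cst n k V : label_avg n (fun=> k) V = k.
Proof.
elim: n V => [|n IH] V //=; under eq_bigr do rewrite IH.
by rewrite -mulr_suml p_sum mul1r.
Qed.

Lemma label_avg_sum n (I : Type) (s : seq I) (h : I -> (nat -> R) -> R) V :
  label_avg n (fun V => \sum_(i <- s) h i V) V = \sum_(i <- s) label_avg n (h i) V.
Proof.
elim: s => [|i s IH]; first by under eq_fun do rewrite big_nil; rewrite label_avg_cst big_nil.
by under eq_fun do rewrite big_cons; rewrite label_avgD IH big_cons.
Qed.

Lemma label_avg_dist n h h' k V : nonneg_profile V ->
  (forall V, nonneg_profile V -> `|h V - h' V| <= k V) ->
  `|label_avg n h V - label_avg n h' V| <= label_avg n k V.
Proof.
move=> V0 hk; rewrite ler_norml; apply/andP; split.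
  rewrite lerBrDr addrC lerBlDr -label_avgD; apply: label_avg_le => // U U0.
  by have := hk U U0; rewrite ler_norml; lra.
rewrite lerBlDr -label_avgD; apply: label_avg_le => // U U0.
by have := hk U U0; rewrite ler_norml; lra.
Qed.

Lemma label_avg_bound n h k V : nonneg_profile V ->
  (forall V, nonneg_profile V -> `|h V| <= k) -> `|label_avg n h V| <= k.
Proof.
move=> V0 hk; have := @label_avg_dist n h (fun=> 0) (fun=> k) V V0.
by rewrite !label_avg_cst subr0; apply => U U0; rewrite subr0 hk.
Qed.

(** The recursion splits off the first label; here the last one is split off, since the induction of
    [lindeberg] appends its jump at the end. *)
Lemma label_avgS n h V :
  label_avg n (fun V => \sum_(c < N) p c * h (shift V c (a c ^+ 2))) V = label_avg n.+1 h V.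
Proof.
elim: n V => [|n IH] V //=; apply: eq_bigr => c _; congr (_ * _); exact: IH.
Qed.

(** The increment of [V c] is [a c ^+ 2] times a binomial variable with parameters [n] and [p c],
    and this is its moment generating function; [label_avg_exp_le] bounds it by the Poisson one. *)
Lemma label_avg_exp (c : nat) (s : R) n V : (c < N)%N ->
  label_avg n (fun V => expR (s * V c)) V =
  (1 + p c * (expR (s * a c ^+ 2) - 1)) ^+ n * expR (s * V c).
Proof.
move=> cN; elim: n V => [|n IH] V /=; first by rewrite expr0 mul1r.
under eq_bigr do rewrite IH.
set k := 1 + _; rewrite exprSr -mulrA.
transitivity (k ^+ n * \sum_(i < N) p i * expR (s * shift V i (a i ^+ 2) c)).
  by rewrite mulr_sumr; apply: eq_bigr => i _; ring.
congr (_ * _); rewrite (bigD1 (Ordinal cN))//= {1}/shift eqxx.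
rewrite (eq_bigr (fun i : 'I_N => p i * expR (s * V c))); last first.
  by move=> i; rewrite -val_eqE /= eq_sym /shift => /negPf ->.
rewrite -mulr_suml.
have : \sum_(i < N | i != Ordinal cN) p i = 1 - p c.
  by rewrite -p_sum [in RHS](bigD1 (Ordinal cN))//=; ring.
by move=> ->; rewrite mulrDr expRD /k; ring.
Qed.

Lemma label_avg_exp_le (c : nat) (s : R) n : (c < N)%N ->
  label_avg n (fun V => expR (s * V c)) (fun=> 0) <=
  expR (n%:R * (p c * (expR (s * a c ^+ 2) - 1))).
Proof.
move=> cN; rewrite label_avg_exp// mulr0 expR0 mulr1 expRM_natl.
have pc1 : p c <= 1 by rewrite -p_sum (bigD1 (Ordinal cN))//= lerDl sumr_ge0.
rewrite lerXn2r ?nnegrE ?expR_ge0//; last exact: expR_ge1Dx.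
have : 0 <= p c * expR (s * a c ^+ 2) by rewrite mulr_ge0 ?expR_ge0.
by rewrite mulrBr mulr1; lra.
Qed.

End label_average.

(** * Replacement of the steps one at a time *)

Section lindeberg.
Context d (T : measurableType d) (R : realType) (P : probability T R).
Variables (N : nat) (L : T -> nat) (xi : T -> R).
Hypotheses (mL : forall c, measurable_fun setT (fun t => (L t == c)%:R : R))
  (mxi : measurable_fun setT xi) (LN : forall t, (L t < N)%N)
  (xi3 : P.-integrable setT (EFin \o (fun t => `|xi t| ^+ 3))).
Variables (F : (nat -> R) -> R) (beta B kappa tail : R) (p a : nat -> R).
Hypotheses (mF : measurable_fun setT (F : seqspace (RR R) -> R)) (F1 : forall w, `|F w| <= 1).
Hypotheses (B0 : 0 <= B) (kappa0 : 0 <= kappa).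
Hypotheses (p_ge0 : forall c, 0 <= p c) (p_sum : \sum_(c < N) p c = 1).
Hypothesis a_gt0 : forall c, 0 < a c.
Hypothesis taylor : forall w, exists q b e : nat -> R,
  [/\ forall c, 0 <= q c, \sum_(c < N) q c <= 1 &
    forall c x, (c < N)%N -> `|F (shift w c x) - F w - b c * x - e c * x ^+ 2|
      <= B * (q c * `|x| ^+ 3) + 2 * (1 < `|beta * x|)%R%:R].
Hypothesis moment1 : forall c, (c < N)%N -> cellmoment P L xi 1 c = 0.
Hypothesis moment2 : forall c, (c < N)%N -> cellmoment P L xi 2 c = p c * a c ^+ 2.
Hypothesis moment3 : forall c, (c < N)%N -> cellabs3 P L xi c <= kappa.
Hypothesis gauss3 : forall c, (c < N)%N ->
  p c * (a c ^+ 3 * \int[@std_normal R]_x (`|x| ^+ 3)) <= kappa.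
Hypothesis tail_xi : fine (P [set t | 1 < `|beta * xi t|]%R) <= tail.
Hypothesis tail_gauss : forall c, (c < N)%N ->
  fine (@std_normal R [set x | 1 < `|beta * (a c * x)|]%R) <= tail.

Notation gs := (@std_normal R).
Notation Omega := (seqspace (RR R)).

Lemma gauss_step w c (q b e : nat -> R) : (c < N)%N ->
  (forall c x, (c < N)%N -> `|F (shift w c x) - F w - b c * x - e c * x ^+ 2|
      <= B * (q c * `|x| ^+ 3) + 2 * (1 < `|beta * x|)%R%:R) ->
  `|\int[gs]_x F (shift w c (a c * x)) - F w - e c * a c ^+ 2|
   <= B * (q c * (a c ^+ 3 * \int[gs]_x (`|x| ^+ 3))) + 2 * tail.
Proof.
move=> cN HT.
have ix3 : gs.-integrable setT (EFin \o (fun x => `|a c * x| ^+ 3)).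
  have := integrableZlR (a c ^+ 3) (integrable_std_normal_abspow R 3).
  congr (_.-integrable _ (EFin \o _)); apply/funext => x.
  by rewrite normrM exprMn (gtr0_norm (a_gt0 c)).
have mx : measurable_fun setT (fun x : RR R => a c * x : R) by exact: measurable_funM.
have := @onestep _ (RR R) R gs N (fun=> c) (fun x => a c * x)
  (fun c' => measurable_cst _) mx (fun=> cN) ix3 F beta B mF F1 w q b e HT.
rewrite (bigD1 (Ordinal cN))//= [X in _ <= B * X + _](bigD1 (Ordinal cN))//=.
have z k : (k <= 3)%N -> gs.-integrable setT (EFin \o (fun x : R => x ^+ k)).
  by move=> _; exact: integrable_std_normal_Xn.
have -> : cellmoment gs (fun=> c) (fun x => a c * x) 2 c = a c ^+ 2.
  rewrite /cellmoment eqxx; under eq_Rintegral do rewrite mul1r exprMn.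
  by rewrite RintegralZl// ?std_normal_variance ?mulr1//; exact: z.
have -> : cellabs3 gs (fun=> c) (fun x => a c * x) c = a c ^+ 3 * \int[gs]_x (`|x| ^+ 3).
  rewrite /cellabs3 eqxx; under eq_Rintegral do rewrite mul1r normrM exprMn (gtr0_norm (a_gt0 c)).
  by rewrite RintegralZl//; exact: integrable_std_normal_abspow.
rewrite big1 ?addr0; last first.
  move=> i; rewrite -val_eqE /= /cellmoment eq_sym => /negPf ->.
  by under eq_Rintegral do rewrite mul0r; rewrite Rintegral_prob_cst mulr0.
rewrite big1 ?addr0; last first.
  move=> i; rewrite -val_eqE /= /cellabs3 eq_sym => /negPf ->.
  by under eq_Rintegral do rewrite mul0r; rewrite Rintegral_prob_cst mulr0.
move=> H; apply: le_trans (H _) _.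
  move=> c' c'N; rewrite /cellmoment; case: eqP => _; last first.
    by under eq_Rintegral do rewrite mul0r; rewrite Rintegral_prob_cst.
  under eq_Rintegral do rewrite mul1r expr1.
  by rewrite RintegralZl ?std_normal_mean ?mulr0//; exact: (z 1).
by rewrite lerD2l ler_wpM2l// tail_gauss.
Qed.

(** By the moment hypotheses both expansions share their terms of order one and two, so only the
    remainders are left. [kappa] bounds the third moment restricted to any single cell, and the
    weights [q] average these bounds. *)
Lemma swap_step w :
  `|\int[P]_t F (shift w (L t) (xi t)) - \sum_(c < N) p c * \int[gs]_x F (shift w c (a c * x))|
  <= 2 * (B * kappa) + 4 * tail.
Proof.
have [q [b [e [q0 q1 HT]]]] := taylor w.
have D1 := onestep mL mxi LN xi3 mF F1 HT moment1.
set A := \int[P]_t _ in D1 *.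
pose G c := \int[gs]_x F (shift w c (a c * x)).
have D2 : `|\sum_(c < N) p c * G c - F w - \sum_(c < N) e c * (p c * a c ^+ 2)| <= B * kappa + 2 *
  tail.
  rewrite [X in `|X|](_ : _ = \sum_(c < N) p c * (G c - F w - e c * a c ^+ 2)); last first.
    under [RHS]eq_bigr do rewrite !mulrBr.
    rewrite !sumrB -mulr_suml p_sum mul1r; congr (_ - _).
    by apply: eq_bigr => c _; ring.
  apply: (le_trans (ler_norm_sum _ _ _)).
  apply: (@le_trans _ _ (\sum_(c < N) (B * (q c * kappa) + p c * (2 * tail)))).
    apply: ler_sum => c _; rewrite normrM (ger0_norm (p_ge0 c)).
    apply: (le_trans (ler_wpM2l (p_ge0 c) (gauss_step (ltn_ord c) HT))).
    rewrite mulrDr lerD2r mulrCA; apply: ler_wpM2l => //.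
    by rewrite mulrCA; apply: ler_wpM2l => //; exact: gauss3.
  rewrite big_split /= -mulr_suml p_sum mul1r lerD2r -mulr_sumr -mulr_suml.
  by apply: ler_wpM2l => //; rewrite -[leRHS]mul1r ler_wpM2r.
have D1' : `|A - F w - \sum_(c < N) e c * (p c * a c ^+ 2)| <= B * kappa + 2 * tail.
  rewrite (eq_bigr (fun c : 'I_N => e c * cellmoment P L xi 2 c)); last first.
    by move=> c _; rewrite moment2.
  apply: (le_trans D1); apply: lerD; last by rewrite ler_wpM2l.
  apply: ler_wpM2l => //.
  apply: (@le_trans _ _ (\sum_(c < N) q c * kappa)).
    by apply: ler_sum => c _; apply: ler_wpM2l => //; exact: moment3.
  by rewrite -mulr_suml -[leRHS]mul1r ler_wpM2r.
rewrite -/(G _) in D2 *.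
move: D1' D2; rewrite !ler_norml; lra.
Qed.

Definition Gam (V w : nat -> R) : R :=
  \int[gauss_seq R]_z F (fun i => w i + Num.sqrt (V i) * z i).

Lemma measurable_affine_seq d' (U : measurableType d') (u : U -> Omega) (s : nat -> R) (v : U ->
  Omega) :
  measurable_fun setT u -> measurable_fun setT v ->
  measurable_fun setT (fun x => (fun i => u x i + s i * v x i) : Omega).
Proof.
move=> mu mv; apply: measurable_seqspace => i.
apply: measurable_funD; first exact: (measurableT_comp (@measurable_coord _ (RR R) i) mu).
by apply: measurable_funM => //; exact: (measurableT_comp (@measurable_coord _ (RR R) i) mv).
Qed.

Lemma measurable_shift_seq d' (U : measurableType d') (u : U -> Omega) (l : U -> nat) (y : U -> R) :
  measurable_fun setT u -> (forall c, measurable_fun setT (fun x => (l x == c)%:R : R)) ->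
  measurable_fun setT y -> measurable_fun setT (fun x => shift (u x) (l x) (y x) : Omega).
Proof.
move=> mu ml my; apply: measurable_seqspace => i.
rewrite (_ : (fun x => _) = fun x => u x i + (l x == i)%:R * y x); last first.
  by apply/funext => x; rewrite shiftE.
apply: measurable_funD; last exact: measurable_funM.
exact: (measurableT_comp (@measurable_coord _ (RR R) i) mu).
Qed.

Lemma Gam_bnd V w : `|Gam V w| <= 1.
Proof.
apply: Rintegral_bound => //; apply: (@bounded_integrable _ _ _ _ _ 1) => //.
apply: (measurableT_comp mF).
exact: (@measurable_affine_seq _ Omega (fun=> w) (fun i => Num.sqrt (V i)) id).
Qed.

Lemma measurable_Gam V : measurable_fun setT (Gam V : Omega -> R).
Proof.
apply: (@measurable_Rintegral2 _ _ Omega Omega R (gauss_seq R) (gauss_seq R) (fun x => F (fun i =>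
  x.1 i + Num.sqrt (V i) * x.2 i)) 1) => //.
apply: (measurableT_comp mF).
exact: (@measurable_affine_seq _ (Omega * Omega)%type fst (fun i => Num.sqrt (V i)) snd).
Qed.

Lemma Gam0 w : Gam (fun=> 0) w = F w.
Proof.
rewrite /Gam -[RHS](Rintegral_prob_cst (gauss_seq R)); apply: eq_Rintegral => z _.
by congr F; apply/funext => i; rewrite sqrtr0 mul0r addr0.
Qed.

(** The semigroup property of [Gam]: independent centred normals of variances [V c] and [a c ^+ 2]
    add up to one of variance [V c + a c ^+ 2], which [mixcoord] realizes with the normalized
    weights [a'] and [b']. *)
Lemma Gam_merge V w c : nonneg_profile V ->
  \int[gs]_x Gam V (shift w c (a c * x)) = Gam (shift V c (a c ^+ 2)) w.
Proof.
move=> V0; set V' := shift V c (a c ^+ 2).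
have V'c : V' c = V c + a c ^+ 2 by rewrite /V' /shift eqxx.
have V'0 : 0 < V' c by rewrite V'c ltr_wpDl// exprn_gt0.
have s0 : 0 < Num.sqrt (V' c) by rewrite sqrtr_gt0.
pose a' := a c / Num.sqrt (V' c); pose b' := Num.sqrt (V c) / Num.sqrt (V' c).
have ab : a' ^+ 2 + b' ^+ 2 = 1.
  rewrite !expr_div_n !sqr_sqrtr ?(ltW V'0)// -mulrDl V'c addrC mulfV//.
  by rewrite -V'c gt_eqF.
have a'0 : 0 <= a' by rewrite divr_ge0 ?sqrtr_ge0// ltW.
have b'0 : 0 <= b' by rewrite divr_ge0 ?sqrtr_ge0.
have mG : measurable_fun setT (fun z : Omega => F (fun i => w i + Num.sqrt (V' i) * z i)).
  apply: (measurableT_comp mF).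
  exact: (@measurable_affine_seq _ Omega (fun=> w) (fun i => Num.sqrt (V' i)) id).
have E1 := Rintegral_law (measurable_mixcoord c a' b') (fun A => mixcoord_law c a'0 b'0 ab (A :=
  A)) mG (fun z => F1 _).
have mGm := measurableT_comp mG (measurable_mixcoord c a' b').
have E2 := @Rintegral_prod _ _ _ _ _ gs (gauss_seq R) _ 1 mGm (fun z => F1 _).
apply: etrans (etrans _ (esym E2)) E1; rewrite /comp.
apply: eq_Rintegral => x _; apply: eq_Rintegral => z _; congr F; apply/funext => i.
rewrite /mixcoord /shift /V' /=; case: eqP => [->|ic]; last by rewrite /shift; case: eqP ic.
rewrite -/V' -addrA; congr (_ + _).
have : Num.sqrt (V' c) != 0 by rewrite gt_eqF.
by rewrite /b' /a' => h; field.
Qed.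

(** For a fixed Gaussian point [z] the shift commutes with the added noise, so [swap_step] applies
    from the starting point [sh z]; the order of integration is exchanged to get there. *)
Lemma Gam_swap_step V w : nonneg_profile V ->
  `|\int[P]_t Gam V (shift w (L t) (xi t)) - \sum_(c < N) p c * Gam (shift V c (a c ^+ 2)) w|
  <= 2 * (B * kappa) + 4 * tail.
Proof.
move=> V0; under eq_bigr do rewrite -Gam_merge//.
pose sh z i : R := w i + Num.sqrt (V i) * z i.
have shE c x z : (fun i => shift w c x i + Num.sqrt (V i) * z i) = shift (sh z) c x.
  by apply/funext => i; rewrite /shift /sh; case: eqP => // _; ring.
have msh : measurable_fun setT (sh : Omega -> Omega).
  exact: (@measurable_affine_seq _ Omega (fun=> w) (fun i => Num.sqrt (V i)) id).
have m1 : measurable_fun setT (fun x : T * Omega => F (shift (sh x.2) (L x.1) (xi x.1))).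
  apply: (measurableT_comp mF).
  apply: (@measurable_shift_seq _ (T * Omega)%type (sh \o snd) (L \o fst) (xi \o fst)).
  - exact: (measurableT_comp msh measurable_snd).
  - by move=> c; exact: (measurableT_comp (mL c) measurable_fst).
  - exact: (measurableT_comp mxi measurable_fst).
have m2 c : measurable_fun setT (fun x : RR R * Omega => F (shift (sh x.2) c (a c * x.1))).
  apply: (measurableT_comp mF).
  apply: (@measurable_shift_seq _ (RR R * Omega)%type (sh \o snd) (fun=> c) (fun x => a c * x.1))
    => //.
  - exact: (measurableT_comp msh measurable_snd).
  - exact: measurable_funM.
have -> : \int[P]_t Gam V (shift w (L t) (xi t)) =
    \int[gauss_seq R]_z \int[P]_t F (shift (sh z) (L t) (xi t)).
  rewrite -(@Rintegral_swap _ _ _ _ _ P (gauss_seq R) _ 1 m1 (fun=> F1 _)).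
  by apply: eq_Rintegral => t _; apply: eq_Rintegral => z _; rewrite shE.
have ez c : \int[gs]_x Gam V (shift w c (a c * x)) =
    \int[gauss_seq R]_z \int[gs]_x F (shift (sh z) c (a c * x)).
  rewrite -(@Rintegral_swap _ _ _ _ _ gs (gauss_seq R) _ 1 (m2 c) (fun=> F1 _)).
  by apply: eq_Rintegral => t _; apply: eq_Rintegral => z _; rewrite shE.
under eq_bigr do rewrite ez.
have i1 : (gauss_seq R).-integrable setT (EFin \o (fun z => \int[P]_t F (shift (sh z) (L t) (xi
  t)))).
  apply: (@bounded_integrable _ _ _ _ _ 1).
    exact: (@measurable_Rintegral2 _ _ _ _ _ (gauss_seq R) P _ 1
      (measurableT_comp m1 (@measurable_swap _ _ Omega T)) (fun=> F1 _)).
  move=> z; apply: Rintegral_bound => //; apply: (@bounded_integrable _ _ _ _ _ 1) => //.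
  exact: (@measurable_sect2 _ _ _ _ _ _ m1 z).
have i2 c : (gauss_seq R).-integrable setT (EFin \o (fun z => \int[gs]_x F (shift (sh z) c (a c *
  x)))).
  apply: (@bounded_integrable _ _ _ _ _ 1).
    exact: (@measurable_Rintegral2 _ _ _ _ _ (gauss_seq R) gs _ 1
      (measurableT_comp (m2 c) (@measurable_swap _ _ Omega (RR R))) (fun=> F1 _)).
  move=> z; apply: Rintegral_bound => //; apply: (@bounded_integrable _ _ _ _ _ 1) => //.
  exact: (@measurable_sect2 _ _ _ _ _ _ (m2 c) z).
under eq_bigr do rewrite -RintegralZl//.
rewrite -Rintegral_sum; last by move=> c; exact: integrableZlR.
rewrite -RintegralB//; last by apply: integrable_sumR => c; exact: integrableZlR.
apply: Rintegral_bound => [|z]; last exact: swap_step.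
by apply: integrableBR => //; apply: integrable_sumR => c; exact: integrableZlR.
Qed.

Fixpoint walk (n : nat) (t : nat -> T) (w : nat -> R) : nat -> R :=
  if n is m.+1 then walk m (fun i => t i.+1) (shift w (L (t 0%N)) (xi (t 0%N))) else w.

Lemma walkE n t w i :
  walk n t w i = w i + \sum_(l < n) (L (t l) == i)%:R * xi (t l).
Proof.
elim: n t w => [|n IH] t w /=; first by rewrite big_ord0 addr0.
by rewrite IH shiftE big_ord_recl addrA.
Qed.

Lemma measurable_walk n d' (U : measurableType d') (t : U -> seqspace T) (w : U -> Omega) :
  measurable_fun setT t -> measurable_fun setT w ->
  measurable_fun setT (fun x => walk n (t x) (w x) : Omega).
Proof.
move=> mt mw; apply: measurable_seqspace => i.
under eq_fun do rewrite walkE.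
apply: measurable_funD; first exact: (measurableT_comp (@measurable_coord _ (RR R) i) mw).
apply: measurable_sum => l; apply: measurable_funM.
  exact: (measurableT_comp (mL i) (measurableT_comp (@measurable_coord _ T l) mt)).
exact: (measurableT_comp mxi (measurableT_comp (@measurable_coord _ T l) mt)).
Qed.

Lemma measurable_label_avg n d' (U : measurableType d') (u : U -> Omega) V :
  measurable_fun setT u ->
  measurable_fun setT (fun x => label_avg N p a n (Gam^~ (u x)) V).
Proof.
move=> mu; elim: n V => [|n IH] V /=; first exact: (measurableT_comp (measurable_Gam V) mu).
by apply: measurable_sum => c; apply: measurable_funM.
Qed.

Lemma label_avg_Gam_bnd n w V : nonneg_profile V -> `|label_avg N p a n (Gam^~ w) V| <= 1.
Proof. by move=> V0; apply: label_avg_bound => // U _; exact: Gam_bnd. Qed.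

Lemma Rintegral_label_avg n (u : T -> Omega) V : measurable_fun setT u -> nonneg_profile V ->
  \int[P]_t label_avg N p a n (Gam^~ (u t)) V =
  label_avg N p a n (fun V => \int[P]_t Gam V (u t)) V.
Proof.
move=> mu; elim: n V => [|n IH] V V0 //=.
have V0' c : nonneg_profile (shift V c (a c ^+ 2)) by apply: nonneg_shift => //; exact: sqr_ge0.
have ii c : P.-integrable setT (EFin \o (fun t => label_avg N p a n (Gam^~ (u t)) (shift V c (a c
  ^+ 2)))).
  apply: (@bounded_integrable _ _ _ _ _ 1); first exact: measurable_label_avg.
  by move=> t; exact: label_avg_Gam_bnd.
rewrite Rintegral_sum; last by move=> c; exact: integrableZlR.
by apply: eq_bigr => c _; rewrite RintegralZl// IH.
Qed.

(** [j] counts the Gaussian jumps already present and [n] the observations still to be replaced. The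
    first observation is held fixed while the induction hypothesis replaces the others from the
    shifted start; it is itself replaced last, under the average over the variance profiles of the
    other [j + n] jumps. Each replacement costs the same. *)
Theorem lindeberg n j w V : nonneg_profile V ->
  `|\int[seq_measure P]_t label_avg N p a j (Gam^~ (walk n t w)) V
    - label_avg N p a (j + n) (Gam^~ w) V| <= n%:R * (2 * (B * kappa) + 4 * tail).
Proof.
set K := 2 * _ + _; elim: n j w V => [|n IH] j w V V0.
  by rewrite addn0 mul0r /= Rintegral_prob_cst subrr normr0.
have mid : measurable_fun setT (id : seqspace T -> seqspace T) by exact: measurable_id.
rewrite (@Rintegral_scons _ _ _ P _ 1); last 2 first.
- apply: measurable_label_avg; exact: (measurable_walk n.+1 mid (measurable_cst (w : Omega))).
- by move=> t; exact: label_avg_Gam_bnd.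
pose u t : Omega := shift w (L t) (xi t).
have mu : measurable_fun setT u by exact: measurable_shift.
pose g1 t := \int[seq_measure P]_s label_avg N p a j (Gam^~ (walk n s (u t))) V.
pose g2 t := label_avg N p a (j + n) (Gam^~ (u t)) V.
have mw : measurable_fun setT (fun x : T * seqspace T => label_avg N p a j (Gam^~ (walk n x.2 (u
  x.1))) V).
  apply: measurable_label_avg; apply: measurable_walk => //.
  exact: (measurableT_comp mu measurable_fst).
have g1b t : `|g1 t| <= 1.
  apply: Rintegral_bound => [|s]; last exact: label_avg_Gam_bnd.
  apply: (@bounded_integrable _ _ _ _ _ 1) => [|s]; last exact: label_avg_Gam_bnd.
  exact: (measurable_sect1 mw t).
have i1 : P.-integrable setT (EFin \o g1).
  apply: (@bounded_integrable _ _ _ _ _ 1) => //.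
  by apply: (@measurable_Rintegral2 _ _ _ _ _ P (seq_measure P) _ 1 mw) => x; exact:
    label_avg_Gam_bnd.
have i2 : P.-integrable setT (EFin \o g2).
  apply: (@bounded_integrable _ _ _ _ _ 1) => [|s]; last exact: label_avg_Gam_bnd.
  exact: measurable_label_avg.
rewrite -/(\int[P]_t g1 t).
have D1 : `|\int[P]_t g1 t - \int[P]_t g2 t| <= n%:R * K.
  rewrite -RintegralB//; apply: Rintegral_bound; first exact: integrableBR.
  by move=> t; exact: IH.
have D2 : `|\int[P]_t g2 t - label_avg N p a (j + n.+1) (Gam^~ w) V| <= K.
  rewrite Rintegral_label_avg// addnS -label_avgS -[leRHS](label_avg_cst a p_sum (j + n) K V).
  by apply: label_avg_dist => // U U0; exact: Gam_swap_step.
rewrite -natr1 mulrDl mul1r -(subrKA (\int[P]_t g2 t)).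
by apply: (le_trans (ler_normD _ _)); exact: lerD.
Qed.

Corollary lindeberg_walk n :
  `|\int[seq_measure P]_t F (walk n t (fun=> 0)) - label_avg N p a n (Gam^~ (fun=> 0)) (fun=> 0)|
  <= n%:R * (2 * (B * kappa) + 4 * tail).
Proof.
have := @lindeberg n 0 (fun=> 0) (fun=> 0) (fun=> lexx 0); rewrite add0n /=.
by under eq_Rintegral do rewrite Gam0.
Qed.

End lindeberg.

(** * Concentration of the cell counts *)

Section count_deviation.
Variables (R : realType) (N : nat) (p a : nat -> R) (n : nat) (u pmin : R).
Hypotheses (p_ge0 : forall c, 0 <= p c) (p_sum : \sum_(c < N) p c = 1).
Hypotheses (p_gt0 : forall c, (c < N)%N -> 0 < p c) (n_gt0 : (0 < n)%N).
Hypothesis aE : forall c, (c < N)%N -> a c ^+ 2 = (n%:R * p c)^-1.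
Hypotheses (u_gt0 : 0 < u) (pmin_le : forall c, (c < N)%N -> pmin <= p c).

Definition deviates (V : nat -> R) (c : nat) : R := (u < `|Num.sqrt (V c) - 1|)%R%:R.

(** [V c] is the count divided by its mean n p_c. The choice of [tau] with [expR tau] equal to the
    threshold [b ^+ 2] minimizes the Poisson exponent, which becomes the mean count times
    [b ^+ 2 - 1 - b ^+ 2 * tau]. *)
Lemma label_avg_chernoff c b tau : (c < N)%N -> expR tau = b ^+ 2 ->
  b ^+ 2 - 1 - b ^+ 2 * tau <= - u ^+ 2 ->
  label_avg N p a n (fun V => expR (n%:R * p c * tau * (V c - b ^+ 2))) (fun=> 0)
   <= expR (- (n%:R * pmin * u ^+ 2)).
Proof.
move=> cN eb hb; set m := n%:R * p c; have m0 : 0 < m by rewrite mulr_gt0 ?ltr0n// p_gt0.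
rewrite (_ : (fun V => _) = fun V => expR (- (m * tau * b ^+ 2)) * expR (m * tau * V c)); last
  first.
  by apply/funext => V; rewrite -expRD; congr expR; ring.
rewrite label_avgZ; apply: (@le_trans _ _ (expR (- (m * tau * b ^+ 2)) *
    expR (n%:R * (p c * (expR (m * tau * a c ^+ 2) - 1))))).
  by apply: ler_wpM2l; [exact: expR_ge0|exact: label_avg_exp_le].
rewrite -expRD ler_expR aE// -/m.
have -> : m * tau / m = tau by field; rewrite gt_eqF.
rewrite eb.
have -> : - (m * tau * b ^+ 2) + n%:R * (p c * (b ^+ 2 - 1)) = m * (b ^+ 2 - 1 - b ^+ 2 * tau).
  by rewrite /m; ring.
apply: (@le_trans _ _ (m * (- u ^+ 2))); first by rewrite ler_wpM2l// ltW.
rewrite mulrN lerN2 ler_wpM2r ?sqr_ge0//.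
by rewrite /m ler_wpM2l ?ler0n// pmin_le.
Qed.

(* With [b = 1 + u] the exponent is [h(b^2 - 1)], [h] the Poisson rate function, and
   [ln b >= 1 - 1 / b] turns it into [u^2]; likewise with [b = 1 - u]. *)
Lemma chernoff_exponent (b : R) : 0 < b ->
  b ^+ 2 - 1 - b ^+ 2 * (2 * ln b) <= - (b - 1) ^+ 2.
Proof.
move=> b0.
have h : ln (b^-1) <= b^-1 - 1.
  have := expR_ge1Dx (ln b^-1); rewrite lnK ?posrE ?invr_gt0//; lra.
rewrite lnV ?posrE// in h.
have h2 : b ^+ 2 * (- ln b) <= b ^+ 2 * (b^-1 - 1) by rewrite ler_wpM2l ?sqr_ge0.
have h3 : b ^+ 2 * (b^-1 - 1) = b - b ^+ 2 by field; rewrite gt_eqF.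
have : b ^+ 2 * (2 * ln b) = - 2 * (b ^+ 2 * (- ln b)) by ring.
rewrite (_ : (b - 1) ^+ 2 = b ^+ 2 - 2 * b + 1); last by ring.
lra.
Qed.

Lemma label_avg_deviates c : (c < N)%N ->
  label_avg N p a n (fun V => deviates V c) (fun=> 0) <= 2 * expR (- (n%:R * pmin * u ^+ 2)).
Proof.
move=> cN; have u0 := u_gt0; set E := expR _; have E0 : 0 <= E by exact: expR_ge0.
have m0 : 0 < n%:R * p c by rewrite mulr_gt0 ?ltr0n// p_gt0.
pose h b V := expR (n%:R * p c * (2 * ln b) * (V c - b ^+ 2)).
have eb (b : R) : 0 < b -> expR (2 * ln b) = b ^+ 2 by move=> b0; rewrite expRM_natl lnK.
have up V : nonneg_profile V -> 1 + u < Num.sqrt (V c) -> 1 <= h (1 + u) V.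
  move=> V0 hu; rewrite -[leLHS]expR0 ler_expR mulr_ge0//.
    apply: mulr_ge0; first exact: ltW.
    by apply: mulr_ge0 => //; apply: ln_ge0; rewrite lerDl ltW.
  by rewrite subr_ge0 -[leRHS]sqr_sqrtr ?V0// lerXn2r ?nnegrE ?sqrtr_ge0//; move: u_gt0 hu; lra.
have hb1 : (1 + u) ^+ 2 - 1 - (1 + u) ^+ 2 * (2 * ln (1 + u)) <= - u ^+ 2.
  by have := @chernoff_exponent (1 + u) ltac:(lra); rewrite (_ : 1 + u - 1 = u)//; ring.
(* For [u >= 1] a square root cannot fall below [1 - u], and [ln (1 - u)] would be a default value:
   only the upper tail is bounded. *)
have [u1|u1] := lerP 1 u.
  apply: (@le_trans _ _ (label_avg N p a n (h (1 + u)) (fun=> 0))).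
    apply: label_avg_le => // V V0; rewrite /deviates; case: ltrP => hd; last exact: expR_ge0.
    apply: up => //; have s0 := sqrtr_ge0 (V c); move: hd.
    by rewrite lter_normr => /orP[]; lra.
  apply: (@le_trans _ _ E); last by lra.
  by apply: label_avg_chernoff => //; apply: eb; lra.
have lo V : nonneg_profile V -> Num.sqrt (V c) < 1 - u -> 1 <= h (1 - u) V.
  move=> V0 hu; rewrite -[leLHS]expR0 ler_expR mulr_le0//.
    apply: mulr_ge0_le0; first exact: ltW.
    by apply: mulr_ge0_le0 => //; apply: ln_le0; rewrite gerBl ltW.
  by rewrite subr_le0 -[leLHS]sqr_sqrtr ?V0// lerXn2r ?nnegrE ?sqrtr_ge0//; move: u1 hu; lra.
have hb2 : (1 - u) ^+ 2 - 1 - (1 - u) ^+ 2 * (2 * ln (1 - u)) <= - u ^+ 2.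
  by have := @chernoff_exponent (1 - u) ltac:(lra); rewrite (_ : 1 - u - 1 = - u) ?sqrrN//; ring.
apply: (@le_trans _ _ (label_avg N p a n (fun V => h (1 + u) V + h (1 - u) V) (fun=> 0))).
  apply: label_avg_le => // V V0; rewrite /deviates; case: ltrP => hd; last first.
    by rewrite addr_ge0 ?expR_ge0.
  change (1 <= h (1 + u) V + h (1 - u) V).
  move: hd; rewrite lter_normr => /orP[hd|hd].
    have := up V V0 ltac:(lra); have := expR_ge0 (n%:R * p c * (2 * ln (1 - u)) * (V c - (1 - u)
      ^+ 2)).
    by rewrite /h; lra.
  have := lo V V0 ltac:(lra); have := expR_ge0 (n%:R * p c * (2 * ln (1 + u)) * (V c - (1 + u) ^+
    2)).
  by rewrite /h; lra.
rewrite label_avgD (_ : 2 * E = E + E); last by ring.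
by apply: lerD; apply: label_avg_chernoff => //; apply: eb; lra.
Qed.

End count_deviation.

(** * Distance between the class distributions *)

Section measurability_smax.
Variables (R : realType) (N : nat) (beta lam : R).
Notation Omega := (seqspace (RR R)).

Lemma measurable_pospart (k : R) : measurable_fun setT (fun x : R => pospart (x - k)).
Proof. by apply: measurable_maxr => //; exact: measurable_funB. Qed.

Lemma measurable_sstep (k : R) : measurable_fun setT (fun x : R => sstep (x - k)).
Proof.
have m (l : R) : measurable_fun setT (fun x : R => pospart (x - k - l) ^+ 3).
  apply: measurable_funX.
  by have := measurable_pospart (k + l); under eq_fun do rewrite opprD addrA.
have m0 : measurable_fun setT (fun x : R => pospart (x - k) ^+ 3).
  by apply: measurable_funX; exact: measurable_pospart.
rewrite /sstep; apply: measurable_funM => //; apply: measurable_funB => //.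
apply: measurable_funD; last exact: measurable_funM.
by apply: measurable_funB => //; exact: measurable_funM.
Qed.

Lemma measurable_hat J j : measurable_fun setT (hat J j : R -> R).
Proof.
have m i : measurable_fun setT (plateau J i : R -> R).
  case: i => [|i]; first exact: measurable_cst.
  rewrite /plateau; case: (J < i.+1)%N; first exact: measurable_cst.
  exact: measurable_sstep.
exact: measurable_funB.
Qed.

Lemma measurable_coshsum : measurable_fun setT (coshsum N beta : Omega -> R).
Proof.
apply: measurable_sum => c.
have mc : measurable_fun setT (fun w : Omega => beta * w c).
  by apply: measurable_funM => //; exact: (@measurable_coord _ (RR R) c).
apply: measurable_funM => //; apply: measurable_funD.
  exact: (measurableT_comp (@measurable_expR R) mc).
apply: (measurableT_comp (@measurable_expR R)).
exact: (measurableT_comp (@oppr_measurable R setT) mc).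
Qed.

Lemma measurable_smax : measurable_fun setT (smax N beta lam : Omega -> R).
Proof.
apply: measurable_funM => //; exact: (measurableT_comp (@measurable_ln R) measurable_coshsum).
Qed.

End measurability_smax.

(** * The expected maximum of Gaussian variables *)

Section gaussian_maximum.
Variables (R : realType) (N : nat).
Notation Omega := (seqspace (RR R)).

Lemma measurable_maxabs : measurable_fun setT (maxabs N : Omega -> R).
Proof.
rewrite (_ : maxabs N = fun w : Omega => \big[Order.max/0]_(c <- index_enum 'I_N) `|w c|)//.
elim: (index_enum _) => [|c s IH].
  rewrite (_ : (fun w : Omega => _) = fun=> 0); first exact: measurable_cst.
  by apply/funext => w; rewrite big_nil.
rewrite (_ : (fun w : Omega => _) =
  fun w : Omega => Num.max `|w c| (\big[Order.max/0]_(j <- s) `|w j|)); last first.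
  by apply/funext => w; rewrite big_cons.
apply: measurable_maxr => //.
apply: (measurableT_comp (@normr_measurable R setT)); exact: (@measurable_coord _ (RR R) c).
Qed.

(** From 1 + y <= exp y at y = |w c| - t. With t = ln N the mean of the maximum is at most
    [ln N + 4]; a bound linear in ln N is enough because this mean only multiplies the small
    deviation [u]. *)
Lemma maxabs_exp_le (t : R) (w : nat -> R) : 0 <= t ->
  maxabs N w <= t + expR (- t) * \sum_(c < N) expR `|w c|.
Proof.
move=> t0; have S0 : 0 <= expR (- t) * \sum_(c < N) expR `|w c|.
  by rewrite mulr_ge0 ?expR_ge0// sumr_ge0// => *; exact: expR_ge0.
apply: maxabs_le => [|c cN]; first exact: addr_ge0.
have h : expR `|w c| <= \sum_(c < N) expR `|w c|.
  by rewrite (bigD1 (Ordinal cN))//= lerDl sumr_ge0// => *; exact: expR_ge0.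
have h2 : expR (- t) * expR `|w c| <= expR (- t) * \sum_(c < N) expR `|w c|.
  by rewrite ler_wpM2l// expR_ge0.
rewrite -expRD in h2; have := expR_ge1Dx (- t + `|w c|); lra.
Qed.

Notation gq := (gauss_seq R).

Lemma gauss_seq_coord_integrable c :
  gq.-integrable setT (EFin \o (fun w : Omega => expR `|w c|)).
Proof.
have me : measurable_fun setT (fun x : RR R => expR `|x| : R).
  exact: (measurableT_comp (@measurable_expR R) (@normr_measurable R setT)).
apply/integrableP; split.
  apply/measurable_EFinP; exact: (measurableT_comp me (@measurable_coord _ (RR R) c)).
have := integrable_std_normal_expabs (1 : R) => /integrableP[_]; apply: le_lt_trans.
rewrite le_eqVlt; apply/orP; left; apply/eqP.
transitivity (\int[pushforward gq (fun w : Omega => w c : RR R)]_x `|(expR `|x|)%:E|)%E.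
  rewrite (ge0_integral_pushforward (@measurable_coord _ (RR R) c))//.
  by apply/measurableT_comp => //; exact/measurable_EFinP.
transitivity (\int[@std_normal R]_x `|(expR `|x|)%:E|)%E; last first.
  by apply: eq_integral => x _; rewrite /= mul1r.
apply: eq_measure_integral => [|mc A mA _]; first exact: (@measurable_coord _ (RR R) c).
exact: (@seq_measure_coord _ (RR R) _ (@std_normal R) c A mA).
Qed.

Lemma gauss_seq_coord_expabs c : \int[gq]_w expR `|w c| <= 4.
Proof.
have me : measurable_fun setT (fun x : RR R => expR `|x| : R).
  exact: (measurableT_comp (@measurable_expR R) (@normr_measurable R setT)).
have -> : \int[gq]_w expR `|w c| = \int[@std_normal R]_x expR `|x|.
  rewrite /Rintegral; congr fine.
  transitivity (\int[pushforward gq (fun w : Omega => w c : RR R)]_x (expR `|x|)%:E)%E.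
    rewrite (ge0_integral_pushforward (@measurable_coord _ (RR R) c))//.
    exact/measurable_EFinP.
  apply: eq_measure_integral => [|mc A mA _]; first exact: (@measurable_coord _ (RR R) c).
exact: (@seq_measure_coord _ (RR R) _ (@std_normal R) c A mA).
apply: le_trans (@std_normal_expabs R) _.
have := expR_taylor 2 (2^-1 : R).
rewrite /exp_taylor !big_ord_recr big_ord0 /= !factS fact0 /=.
rewrite (ger0_norm (_ : 0 <= 2^-1))// ler_norml => /andP[_ h1].
lra.
Qed.

Lemma integrable_maxabs : gq.-integrable setT (EFin \o maxabs N).
Proof.
apply: (@integrable_domR _ _ _ gq _ (fun w : Omega => 0 + expR (- 0) * \sum_(c < N) expR `|w c|)).
- exact: measurable_maxabs.
- by move=> w; rewrite ger0_norm ?maxabs_ge0// maxabs_exp_le.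
- apply: integrableDR; first exact: integrable_prob_cst.
  apply: integrableZlR; apply: (@integrable_sumR _ _ _ gq _ _ (fun (c : 'I_N) (w : Omega) => expR
    `|w c|)) => c.
  exact: gauss_seq_coord_integrable.
Qed.

Lemma gauss_seq_maxabs : (0 < N)%N -> \int[gq]_w maxabs N w <= ln N%:R + 4.
Proof.
move=> N_gt0.
have N1 : 1 <= N%:R :> R by rewrite ler1n.
have lN : 0 <= ln N%:R :> R by rewrite ln_ge0.
have ii : gq.-integrable setT (EFin \o (fun w : Omega => \sum_(c < N) expR `|w c|)).
  apply: (@integrable_sumR _ _ _ gq _ _ (fun (c : 'I_N) (w : Omega) => expR `|w c|)) => c.
  exact: gauss_seq_coord_integrable.
apply: (@le_trans _ _ (\int[gq]_w (ln N%:R + expR (- ln N%:R) * \sum_(c < N) expR `|w c|))).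
  apply: le_Rintegral => //; first exact: integrable_maxabs.
    by apply: integrableDR; [exact: integrable_prob_cst|exact: integrableZlR].
  by move=> w _; exact: maxabs_exp_le.
rewrite RintegralD//; [|exact: integrable_prob_cst|exact: integrableZlR].
rewrite Rintegral_prob_cst RintegralZl// lerD2l.
rewrite (@Rintegral_sum _ _ _ gq _ _ (fun (c : 'I_N) (w : Omega) => expR `|w c|)); last first.
  by move=> c; exact: gauss_seq_coord_integrable.
rewrite expRN lnK ?posrE; last exact: lt_le_trans N1.
rewrite ler_pdivrMl; last exact: lt_le_trans N1.
apply: (@le_trans _ _ (\sum_(c < N) 4)); last by rewrite sumr_const card_ord mulr_natl.
by apply: ler_sum => c _; exact: gauss_seq_coord_expabs.
Qed.

End gaussian_maximum.

Section class_distance.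
Context d (T : measurableType d) (R : realType) (P : probability T R).
Variables (N n J : nat) (L : T -> nat) (xi : T -> R).
Hypotheses (N_gt0 : (0 < N)%N) (n_gt0 : (0 < n)%N).
Hypotheses (mL : forall c, measurable_fun setT (fun t => (L t == c)%:R : R))
  (mxi : measurable_fun setT xi) (LN : forall t, (L t < N)%N)
  (xi3 : P.-integrable setT (EFin \o (fun t => `|xi t| ^+ 3))).
Variables (beta lam kappa tail u pmin : R) (p a : nat -> R).
Hypotheses (beta_gt0 : 0 < beta) (lam_ge0 : 0 <= lam) (lam_le1 : lam <= 1) (kappa0 : 0 <= kappa).
Hypotheses (p_ge0 : forall c, 0 <= p c) (p_sum : \sum_(c < N) p c = 1).
Hypothesis p_gt0 : forall c, (c < N)%N -> 0 < p c.
Hypothesis a_gt0 : forall c, 0 < a c.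
Hypothesis aE : forall c, (c < N)%N -> a c ^+ 2 = (n%:R * p c)^-1.
Hypothesis moment1 : forall c, (c < N)%N -> cellmoment P L xi 1 c = 0.
Hypothesis moment2 : forall c, (c < N)%N -> cellmoment P L xi 2 c = p c * a c ^+ 2.
Hypothesis moment3 : forall c, (c < N)%N -> cellabs3 P L xi c <= kappa.
Hypothesis gauss3 : forall c, (c < N)%N ->
  p c * (a c ^+ 3 * \int[@std_normal R]_x (`|x| ^+ 3)) <= kappa.
Hypothesis tail_xi : fine (P [set t | 1 < `|beta * xi t|]%R) <= tail.
Hypothesis tail_gauss : forall c, (c < N)%N ->
  fine (@std_normal R [set x | 1 < `|beta * (a c * x)|]%R) <= tail.
Hypotheses (u_gt0 : 0 < u) (pmin_le : forall c, (c < N)%N -> pmin <= p c).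

Notation Omega := (seqspace (RR R)).
Notation gq := (gauss_seq R).

(* The terms account for the third-order Taylor remainders, the steps too large to be expanded, the
   replacement of the random variances by 1, and the cell counts far from their means. *)
Definition class_error : R :=
  n%:R * (2 * ((48 * 300 ^+ 2 * (lam * beta ^+ 3)) * kappa) + 4 * tail)
  + (144 * (lam * (beta * u)) * (ln N%:R + 4) + 4 * N%:R * expR (- (n%:R * pmin * u ^+ 2))).

Lemma signed_hat_lip (s : nat -> R) x y : (forall j, `|s j| <= 1) ->
  `|signed_hat J s x - signed_hat J s y| <= 144 * `|x - y|.
Proof.
move=> s1; have [h|h] := lerP `|x - y| 1; last first.
  apply: (le_trans (ler_normB _ _)); have := signed_hat_bnd J s1 x.
  have := signed_hat_bnd J s1 y; lra.
have [f1 [f2 [f1b f2b T3]]] := signed_hat_taylor J s1 y.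
have := T3 _ h; rewrite (_ : y + (x - y) = x); last by ring.
set dd := x - y in h *; set t := `|dd| in h *.
have t0 : 0 <= t by exact: normr_ge0.
set A := signed_hat J s x - signed_hat J s y => H.
have e1 : `|f1 * dd| <= 48 * t by rewrite normrM ler_wpM2r.
have t2 : dd ^+ 2 <= t by rewrite -real_normK ?num_real// -/t expr2 ler_piMr.
have t3 : t ^+ 3 <= t by rewrite exprS ler_piMr// exprn_ile1.
have e2 : `|2^-1 * f2 * dd ^+ 2| <= 24 * t.
  rewrite (normrM _ (dd ^+ 2)) (normrM 2^-1) (ger0_norm (sqr_ge0 dd)) (ger0_norm (_ : 0 <= 2^-1))//.
  have : `|f2| * dd ^+ 2 <= 48 * t by apply: ler_pM => //; exact: sqr_ge0.
  lra.
have := ler_normD (A - f1 * dd - 2^-1 * f2 * dd ^+ 2) (f1 * dd + 2^-1 * f2 * dd ^+ 2).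
have := ler_normD (f1 * dd) (2^-1 * f2 * dd ^+ 2).
rewrite (_ : A - f1 * dd - 2^-1 * f2 * dd ^+ 2 + (f1 * dd + 2^-1 * f2 * dd ^+ 2) = A); last by ring.
lra.
Qed.

Section signs.
Variable s : nat -> R.
Hypothesis s_bnd : forall j, `|s j| <= 1.
Let F (w : nat -> R) := signed_hat J s (smax N beta lam w).

Lemma measurable_signed_smax : measurable_fun setT (F : Omega -> R).
Proof.
have mS : measurable_fun setT (signed_hat J s : R -> R).
  by apply: measurable_sum => j; apply: measurable_funM => //; exact: measurable_hat.
exact: (measurableT_comp mS (measurable_smax N beta lam)).
Qed.

(** The same Gaussian point [z] drives both vectors: their coordinates differ by |sqrt(V c) - 1| |z
    c|, at most [u] times the maximum when no count deviates. If some count deviates the difference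
    is at most 2, which the sum of [deviates] covers. *)
Lemma Gam_variance V : nonneg_profile V ->
  `|Gam F V (fun=> 0) - Gam F (fun=> 1) (fun=> 0)| <=
  144 * (lam * (beta * u)) * (ln N%:R + 4) + 2 * \sum_(c < N) deviates u V c.
Proof.
move=> V0; have u0 := u_gt0; have b0 := beta_gt0.
have F1 w : `|F w| <= 1 by exact: signed_hat_bnd.
set D := \sum_(c < N) _.
have mF V' : measurable_fun setT (fun z : Omega => F (fun i => 0 + Num.sqrt (V' i) * z i)).
  apply: (measurableT_comp measurable_signed_smax).
  exact: (@measurable_affine_seq _ _ Omega (fun=> (fun=> 0)) (fun i => Num.sqrt (V' i)) id).
have iF V' : gq.-integrable setT (EFin \o (fun z : Omega => F (fun i => 0 + Num.sqrt (V' i) * z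
  i))).
  by apply: (@bounded_integrable _ _ _ gq _ 1); [exact: mF|move=> z; exact: F1].
rewrite /Gam -RintegralB//.
have iD : gq.-integrable setT (EFin \o (fun z => F (fun i => 0 + Num.sqrt (V i) * z i) -
    F (fun i => 0 + Num.sqrt 1 * z i))) by exact: integrableBR.
apply: (le_trans (le_normr_Rintegral _ iD)) => //.
have im := @integrable_maxabs R N.
apply: (@le_trans _ _ (\int[gq]_z (144 * (lam * (beta * u)) * maxabs N z + 2 * D))).
  apply: le_Rintegral => //; first exact: integrable_norm.
    by apply: integrableDR; [exact: integrableZlR|exact: integrable_prob_cst].
  move=> z _.
  have D0 : 0 <= D by rewrite sumr_ge0// => c _; rewrite /deviates ler0n.
  have M0 : 0 <= 144 * (lam * (beta * u)) * maxabs N z.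
    rewrite mulr_ge0 ?maxabs_ge0// mulr_ge0// mulr_ge0//.
    by rewrite mulr_ge0// ltW.
  have [[c cN cd]|none] := pselect (exists2 c, (c < N)%N & u < `|Num.sqrt (V c) - 1|).
    have D1 : 1 <= D.
      rewrite /D (bigD1 (Ordinal cN))//= {1}/deviates cd lerDl.
      by apply: sumr_ge0 => i _; rewrite /deviates ler0n.
    apply: (le_trans (ler_normB _ _)).
    apply: (le_trans (lerD (F1 _) (F1 _))); rewrite -[leLHS]add0r.
    by apply: lerD => //; exact: ler_peMr.
  apply: (@le_trans _ _ (144 * (lam * (beta * u)) * maxabs N z)); last by lra.
  apply: (le_trans (signed_hat_lip _ _ s_bnd)); rewrite -(mulrA 144) ler_wpM2l// -mulrA.
  apply: smax_lip => // c cN; rewrite sqrtr1 !add0r mul1r -[X in _ - X]mul1r -mulrBl !normrM.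
  rewrite (gtr0_norm beta_gt0) -mulrA ler_wpM2l ?(ltW b0)//.
  apply: ler_pM => //; last exact: maxabs_ge.
  by rewrite leNgt; apply/negP => h; apply: none; exists c.
rewrite RintegralD//; [|exact: integrableZlR|exact: integrable_prob_cst].
rewrite Rintegral_prob_cst RintegralZl// lerD2r ler_wpM2l//.
  by rewrite mulr_ge0// mulr_ge0// mulr_ge0// ltW.
exact: gauss_seq_maxabs.
Qed.

(** [lindeberg_walk] leads from the walk to an average over random variances, and [Gam_variance]
    from there to unit variances; averaging [deviates] over all cells by [label_avg_deviates] gives
    the factor [4 * N] of the last error term. *)
Lemma gauss_comparison :
  `|\int[seq_measure P]_t F (walk L xi n t (fun=> 0)) - \int[gq]_z F z| <= class_error.
Proof.
have F1 w : `|F w| <= 1 by exact: signed_hat_bnd.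
have B0 : 0 <= 48 * 300 ^+ 2 * (lam * beta ^+ 3).
  apply: (mulr_ge0 (mulr_ge0 (ler0n R 48) (sqr_ge0 _))).
  by apply: mulr_ge0; [|rewrite exprn_ge0 ?(ltW beta_gt0)].
have taylor w : exists q b e : nat -> R,
  [/\ forall c, 0 <= q c, \sum_(c < N) q c <= 1 &
    forall c x, (c < N)%N -> `|F (shift w c x) - F w - b c * x - e c * x ^+ 2|
      <= 48 * 300 ^+ 2 * (lam * beta ^+ 3) * (q c * `|x| ^+ 3) + 2 * (1 < `|beta * x|)%R%:R].
  have [q [b [e [q0 q1 h]]]] := smax_taylor beta N_gt0 lam_ge0 lam_le1 (ler0n R 48)
    (signed_hat_bnd J s_bnd) (signed_hat_taylor J s_bnd) w.
  exists q, b, e; split => // c x cN; apply: (le_trans (h c x cN)).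
  rewrite lerD2r normrM (gtr0_norm beta_gt0) exprMn le_eqVlt; apply/orP; left; apply/eqP; ring.
have H1 := lindeberg_walk mL mxi LN xi3 measurable_signed_smax F1 B0 kappa0 p_ge0 p_sum
  a_gt0 taylor moment1 moment2 moment3 gauss3 tail_xi tail_gauss n.
set A := \int[_]_t _ in H1 *.
have e2 : \int[gq]_z F z = Gam F (fun=> 1) (fun=> 0).
  rewrite /Gam; apply: eq_Rintegral => z _; congr F; apply/funext => i.
  by rewrite sqrtr1 mul1r add0r.
set C := 144 * (lam * (beta * u)) * (ln N%:R + 4).
have H2 : `|label_avg N p a n (Gam F ^~ (fun=> 0)) (fun=> 0) - Gam F (fun=> 1) (fun=> 0)|
    <= C + 4 * N%:R * expR (- (n%:R * pmin * u ^+ 2)).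
  rewrite -[X in _ - X](label_avg_cst a p_sum n _ (fun=> 0)).
  apply: (@le_trans _ _ (label_avg N p a n (fun V => C + 2 * \sum_(c < N) deviates u V c) (fun=>
    0))).
    by apply: label_avg_dist => [|i|V V0]; [exact: p_ge0|exact: lexx|exact: Gam_variance].
  rewrite label_avgD (label_avg_cst a p_sum) label_avgZ label_avg_sum.
  apply: lerD; first exact: lexx.
  apply: (@le_trans _ _ (2 * \sum_(c < N) 2 * expR (- (n%:R * pmin * u ^+ 2)))).
    by apply: ler_wpM2l; [exact: ler0n|apply: ler_sum => c _; exact: label_avg_deviates].
    by rewrite sumr_const card_ord -[X in _ * X]mulr_natl le_eqVlt; apply/orP; left; apply/eqP;
      ring.
  exact: p_sum.
rewrite e2 /class_error -(subrKA (label_avg N p a n (Gam F ^~ (fun=> 0)) (fun=> 0))).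
by apply: (le_trans (ler_normD _ _)); exact: lerD.
Qed.

End signs.

Theorem class_distance :
  \sum_(j < J.+1) `|\int[seq_measure P]_t hat J j (smax N beta lam (walk L xi n t (fun=> 0)))
     - \int[gq]_z hat J j (smax N beta lam z)| <= class_error.
Proof.
pose A j := \int[seq_measure P]_t hat J j (smax N beta lam (walk L xi n t (fun=> 0))).
pose B j := \int[gq]_z hat J j (smax N beta lam z).
pose s j := Num.sg (A j - B j).
have s1 j : `|s j| <= 1 by rewrite /s normr_sg lern1 leq_b1.
have mw : measurable_fun setT (fun t : seqspace T => walk L xi n t (fun=> 0) : Omega).
  apply: (@measurable_walk _ T R L xi mL mxi n _ (seqspace T) id (fun=> (fun=> 0))) => //.
have hb j (x : R) : `|hat J j x| <= 1 by rewrite ger0_norm ?hat_ge0// hat_le1.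
have i1 j : (seq_measure P).-integrable setT (EFin \o (fun t => hat J j (smax N beta lam (walk L
  xi n t (fun=> 0))))).
  apply: (@bounded_integrable _ _ _ _ _ 1); last by move=> t; exact: hb.
  exact: (measurableT_comp (measurableT_comp (@measurable_hat R J j) (measurable_smax N beta lam))
    mw).
have i2 j : gq.-integrable setT (EFin \o (fun z => hat J j (smax N beta lam z))).
  apply: (@bounded_integrable _ _ _ _ _ 1); last by move=> t; exact: hb.
  exact: (measurableT_comp (@measurable_hat R J j) (measurable_smax N beta lam)).
apply: (@le_trans _ _ (\sum_(j < J.+1) s j * A j - \sum_(j < J.+1) s j * B j)).
  rewrite -sumrB le_eqVlt; apply/orP; left; apply/eqP; apply: eq_bigr => j _.
  by rewrite -mulrBr /s -normrEsg.
have e1 : \sum_(j < J.+1) s j * A j = \int[seq_measure P]_t signed_hat J s (smax N beta lam (walk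
  L xi n t (fun=> 0))).
  rewrite Rintegral_sum; last by move=> j; exact: integrableZlR.
  by apply: eq_bigr => j _; rewrite RintegralZl.
have e2 : \sum_(j < J.+1) s j * B j = \int[gq]_z signed_hat J s (smax N beta lam z).
  rewrite Rintegral_sum; last by move=> j; exact: integrableZlR.
  by apply: eq_bigr => j _; rewrite RintegralZl.
rewrite e1 e2; apply: (le_trans (ler_norm _)); exact: gauss_comparison.
Qed.

End class_distance.

(** * Coupling *)

(** Maximal coupling in kernel form: the common mass [m] stays in place, and the excess [a - m] is
    spread proportionally to the deficit [b - m], of the same total [rho]. The last clause makes
    later divisions by [b l] harmless. *)
Lemma discrete_coupling (R : realType) (n : nat) (a b : nat -> R) :
  (forall j, 0 <= a j) -> (forall j, 0 <= b j) ->
  \sum_(j < n) a j = 1 -> \sum_(j < n) b j = 1 ->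
  exists K : nat -> nat -> R,
    [/\ forall j l, 0 <= K j l,
        forall j, (j < n)%N -> \sum_(l < n) K j l = 1,
        forall l, (l < n)%N -> \sum_(j < n) a j * K j l = b l,
        forall j, b j - `|a j - b j| <= a j * K j j &
        forall j l, b l = 0 -> K j l = 0].
Proof.
move=> a0 b0 sa sb; pose m j := Num.min (a j) (b j).
have ma j : m j <= a j by rewrite /m ge_min lexx.
have mb j : m j <= b j by rewrite /m ge_min lexx orbT.
have m0 j : 0 <= m j by rewrite /m le_min a0 b0.
pose rho := \sum_(j < n) (a j - m j).
have rhoE : rho = \sum_(j < n) (b j - m j) by rewrite /rho !sumrB sa sb.
have K0 j : 0 <= a j - m j by rewrite subr_ge0.
have L0 j : 0 <= b j - m j by rewrite subr_ge0.
have rho0 : 0 <= rho by apply: sumr_ge0 => j _.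
pose E j l := (j == l)%:R * m j + (a j - m j) * (b l - m l) / rho.
(* [E j l / a j] is the conditional law of the second class given the first; a row of mass zero may
   be any law, and [b] is taken. If [rho = 0] the two laws agree, and division by zero leaves [E]
   diagonal. *)
exists (fun j l => if a j == 0 then b l else if b l == 0 then 0 else E j l / a j).
have E0 j l : 0 <= E j l by rewrite addr_ge0 ?mulr_ge0// invr_ge0.
have Eb j l : b l = 0 -> E j l = 0.
  move=> bl; have ml : m l = 0 by apply/eqP; rewrite eq_le m0 -bl mb.
  rewrite /E bl ml subrr mulr0 mul0r addr0.
  by case: eqP => [->|_]; rewrite ?ml ?mulr0 ?mul0r.
have KE j l : (if b l == 0 then 0 else E j l / a j) = E j l / a j.
  by case: eqP => // /Eb ->; rewrite mul0r.
have delta (f : nat -> R) l : (l < n)%N -> \sum_(j < n) ((j == l :> nat)%:R * f j) = f l.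
  move=> ln; rewrite (bigD1 (Ordinal ln))//= eqxx mul1r big1 ?addr0// => j.
  by rewrite -val_eqE /= => /negbTE ->; rewrite mul0r.
split.
- by move=> j l; case: eqP => // _; rewrite KE divr_ge0.
- move=> j jn; case: eqP => // /eqP aj; under eq_bigr do rewrite KE.
  rewrite -mulr_suml /E big_split /= -mulr_suml.
  have -> : \sum_(l < n) ((j == l :> nat)%:R : R) = 1.
    rewrite -[RHS](delta (fun=> 1) j jn); apply: eq_bigr => l _.
    by rewrite mulr1 eq_sym.
  rewrite mul1r -mulr_suml -mulr_sumr -rhoE.
  have [r0|r0] := eqVneq rho 0; last by rewrite mulfK// addrC subrK mulfV.
  rewrite r0 invr0 mulr0 addr0.
  move: r0; rewrite /rho => /eqP; rewrite psumr_eq0// => /allP /(_ (Ordinal jn)).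
  by rewrite mem_index_enum => /(_ isT) /=; rewrite subr_eq0 => /eqP <-; rewrite mulfV.
- move=> l ln; rewrite (eq_bigr (fun j : 'I_n => E j l)); last first.
    move=> j _; case: eqP => [aj|/eqP aj]; last by rewrite KE mulrCA mulfV ?mulr1.
    have mj : m j = 0 by apply/eqP; rewrite eq_le m0 -aj ma.
    by rewrite /E aj mj subrr !mul0r mulr0 addr0.
  rewrite /E big_split /= delta//.
  rewrite -mulr_suml -mulr_suml -/rho.
  have [r0|r0] := eqVneq rho 0; last first.
    by rewrite mulrAC mulfV// mul1r addrC subrK.
  rewrite r0 !mul0r addr0.
  move: r0; rewrite rhoE => /eqP; rewrite psumr_eq0// => /allP /(_ (Ordinal ln)).
  by rewrite mem_index_enum => /(_ isT) /=; rewrite subr_eq0 => /eqP.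
- move=> j; have [aj|aj] := eqVneq (a j) 0.
    rewrite aj mul0r sub0r normrN; have := ler_norm (b j); lra.
  rewrite KE mulrCA mulfV// mulr1 /E eqxx mul1r.
  have h : 0 <= (a j - m j) * (b j - m j) / rho by rewrite mulr_ge0 ?invr_ge0 ?mulr_ge0.
  apply: (@le_trans _ _ (m j)); last by lra.
  rewrite /m; have := ler_norm (b j - a j); rewrite distrC; have := normr_ge0 (a j - b j).
  by rewrite minEle; case: ifP; lra.
- by move=> j l bl; rewrite bl eqxx; case: ifP.
Qed.

(** * Realization of laws by quantile transforms *)

Section vanishing.
Context d (T : measurableType d) (R : realType) (Q : probability T R).

(** Applied to the tails of [M] and to intervals shrinking to a point from the right, it yields the
    hypotheses [F_top] and [F_rc] for the conditional distribution function in [coupling]. *)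
Lemma vanishing_prob (F : nat -> set T) (eta : R) : (forall n, measurable (F n)) ->
  (forall n m, (n <= m)%N -> F m `<=` F n) -> (forall t, exists n, ~ F n t) ->
  0 < eta -> exists n, fine (Q (F n)) < eta.
Proof.
move=> mF dF iF eta0.
have I0 : \bigcap_n F n = set0.
  by apply/seteqP; split => // t h; have [n nF] := iF t; apply: nF; exact: h.
have h : Q (F n) @[n --> \oo] --> Q (\bigcap_n F n).
  apply: nonincreasing_cvg_mu => //.
  - by rewrite (le_lt_trans (probability_le1 _ _))// ltry.
  - by rewrite I0.
  - by move=> n m nm; apply/subsetPset; exact: dF.
rewrite I0 measure0 in h.
have /fine_cvg := h; move=> /cvgrPdist_lt/(_ eta eta0) [n _ hn].
exists n; have := hn n (leqnn n); rewrite /= sub0r normrN; apply: le_lt_trans.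
exact: ler_norm.
Qed.

End vanishing.

Section uniform_variable.
Variable R : realType.

Definition unif : probability (RR R) R := uniform_prob (@ltr01 R).

Lemma unif_itv (a b : R) : 0 <= a -> a <= b -> b <= 1 ->
  unif [set y | a < y < b] = (b - a)%:E.
Proof.
move=> a0 ab b1; rewrite (_ : [set y | _] = `]a, b[%classic); last first.
  by apply/seteqP; split => y /=; rewrite in_itv.
rewrite /unif /= /uniform_prob (eq_integral (fun=> 1%:E)); last first.
  move=> y; rewrite inE /= in_itv /= => /andP[ay yb]; rewrite /uniform_pdf subr0 invr1 ifT//.
  by rewrite (le_trans a0 (ltW ay)) (le_trans (ltW yb) b1).
rewrite integral_cst//= mul1e lebesgue_measure_itv/= lte_fin.
by case: ltP => // ba; rewrite (_ : b - a = 0)//; lra.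
Qed.

Lemma law_unique (mu nu : probability (RR R) R) :
  (forall s : R, mu [set y | s < y] = nu [set y | s < y]) ->
  forall A, measurable A -> mu A = nu A.
Proof.
move=> H A mA.
have HI (s : R) : mu `]s, +oo[%classic = nu `]s, +oo[%classic.
  have := H s; rewrite (_ : [set y | s < y] = `]s, +oo[%classic)//.
  by apply/seteqP; split => y /=; rewrite in_itv /= andbT.
apply: (@measure_unique _ R (RR R) (@RGenOInfty.G R : set (set (RR R))) (fun n => `](- n%:R),
  +oo[%classic)) => //.
- exact: RGenOInfty.measurableE.
- move=> _ _ [x ->] [y ->]; exists (Num.max x y).
  apply/seteqP; split => z /=; rewrite !in_itv /= !andbT gt_max; first by move=> [-> ->].
  by move=> /andP[].
- by move=> n; exists (- n%:R).
- apply/seteqP; split => // x _; exists (Num.truncn `|x|).+1 => //=.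
  rewrite in_itv /= andbT ltrNl; apply: le_lt_trans (ler_norm _) _; rewrite normrN.
  exact: truncnS_gt.
- by move=> _ [x ->]; exact: HI.
- by move=> n; rewrite (le_lt_trans (probability_le1 _ _))// ltry.
Qed.

End uniform_variable.

Lemma measurable_lt_set d (T : measurableType d) (R : realType) (f g : T -> R) :
  measurable_fun setT f -> measurable_fun setT g -> measurable [set w | f w < g w].
Proof.
move=> mf mg; rewrite -[X in measurable X]setTI.
exact: (measurable_fun_ltr mf mg measurableT (I : measurable [set true])).
Qed.

Section quantile.
Context d (T0 : measurableType d) (R : realType) (P0 : probability T0 R).
Variable F : T0 -> R -> R.
Hypotheses (mF : forall s, measurable_fun setT (F ^~ s))
  (F_nd : forall t s s', s <= s' -> F t s <= F t s')
  (F_neg : forall t s, s < 0 -> F t s = 0)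
  (F_ge0 : forall t s, 0 <= F t s) (F_le1 : forall t s, F t s <= 1)
  (F_rc : forall t s y, F t s < y -> exists2 e, 0 < e & F t (s + e) < y)
  (F_top : forall t y, y < 1 -> exists s, y <= F t s).

(* [inf] is only used on nonempty sets bounded below; elsewhere the value is irrelevant. *)
Definition quantile (w : T0 * RR R) : R :=
  if 0 < w.2 < 1 then inf [set s | w.2 <= F w.1 s] else 0.

Lemma quantile_has_inf t y : 0 < y < 1 -> has_inf [set s | y <= F t s].
Proof.
move=> /andP[y0 y1]; split; first exact: F_top.
exists 0 => s /= ys; rewrite leNgt; apply/negP => /F_neg s0.
by move: ys; rewrite s0 leNgt y0.
Qed.

Lemma quantile_ge0 w : 0 <= quantile w.
Proof.
rewrite /quantile; case: ifPn => // y01; have [ne _] := quantile_has_inf w.1 y01.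
apply: lb_le_inf => // s /= ys; rewrite leNgt; apply/negP => /F_neg s0.
by move: ys y01; rewrite s0 leNgt => /negbTE ->.
Qed.

(** The Galois connection between a distribution function and its quantile; right-continuity [F_rc]
    gives the direction that starts from [F t s < y]. *)
Lemma quantile_gt t y s : 0 < y < 1 -> (s < quantile (t, y)) = (F t s < y).
Proof.
move=> y01; have hi := quantile_has_inf t y01; rewrite /quantile /= y01.
apply/idP/idP => [h|h].
  rewrite ltNge; apply/negP => ys; move: h; rewrite ltNge => /negP; apply.
  by apply: ge_inf; [case: hi|].
have [e e0 he] := F_rc h.
apply: (@lt_le_trans _ _ (s + e)); first by rewrite ltrDl.
apply: lb_le_inf; first by case: hi.
move=> s' /= ys'; rewrite leNgt; apply/negP => /ltW /(F_nd t) h'.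
by have := le_lt_trans (le_trans ys' h') he; rewrite ltxx.
Qed.

Lemma measurable_quantile : measurable_fun setT quantile.
Proof.
apply: (measurability _ (RGenOInfty.measurableE R)) => // _ [_ [s ->] <-].
rewrite setTI.
have m2 : measurable_fun setT (fun w : T0 * RR R => w.2 : R) by exact: measurable_snd.
have m1 : measurable_fun setT (fun w : T0 * RR R => F w.1 s).
  exact: (measurableT_comp (mF s) measurable_fst).
pose O := [set w : T0 * RR R | 0 < w.2] `&` [set w | w.2 < 1].
have mO : measurable O.
  by apply: measurableI; apply: measurable_lt_set.
rewrite (_ : _ @^-1` _ = (O `&` [set w | F w.1 s < w.2]) `|`
  (~` O `&` if s < 0 then setT else set0)); last first.
  apply/seteqP; split => -[t y] /=; rewrite in_itv /= andbT.
    case y01 : (0 < y < 1).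
      by rewrite quantile_gt// => h; left; split => //; have /andP[] := y01.
    rewrite {1}/quantile /= y01 => h; right; rewrite h; split => // -[/= y0 y1].
    by rewrite y0 y1 in y01.
  move=> [[[/= y0 y1] h]|[h]]; first by rewrite quantile_gt// y0 y1.
  case: ifP => // s0 _; exact: (lt_le_trans s0 (quantile_ge0 _)).
apply: measurableU; apply: measurableI => //.
- exact: measurable_lt_set.
- exact: measurableC.
- by case: ifP.
Qed.

Lemma quantile_law s :
  (P0 \x unif R)%E [set w | s < quantile w] = (\int[P0]_t (1 - F t s)%:E)%E.
Proof.
have [s0|s0] := ltP s 0.
  rewrite (_ : [set w | _] = setT); last first.
    by apply/seteqP; split => // w _ /=; exact: (lt_le_trans s0 (quantile_ge0 _)).
  rewrite probability_setT (eq_integral (fun=> 1%:E)); last first.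
    by move=> t _; rewrite F_neg// subr0.
  by rewrite integral_prob_cst.
rewrite /product_measure1; apply: eq_integral => t _ /=.
rewrite -unif_itv//; congr (unif R _); apply/seteqP; split => y.
  rewrite /xsection /= inE /=; case y01 : (0 < y < 1).
    by rewrite quantile_gt// => h; rewrite h; have /andP[] := y01.
  by rewrite {1}/quantile /= y01 ltNge s0.
move=> /= /andP[Fy y1]; rewrite /xsection /= inE /= quantile_gt//.
by rewrite y1 andbT (le_lt_trans _ Fy).
Qed.

(** Given [t], the quantile falls in the window around [W t] with at least the mass that [F t] gives
    to it; [g] is a measurable minorant of this mass, fit for integration over [t]. *)
Lemma quantile_near (W : T0 -> R) (a b : R) (g : T0 -> R) :
  measurable_fun setT W -> measurable_fun setT g -> 0 <= a -> 0 <= b ->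
  (forall t, 0 <= g t <= F t (W t + b) - F t (W t - a)) ->
  (\int[P0]_t (g t)%:E <=
   (P0 \x unif R)%E [set w | (W w.1 - a < quantile w <= W w.1 + b)%R])%E.
Proof.
move=> mW mg a0 b0 hg.
have mA : measurable [set w : T0 * RR R | (W w.1 - a < quantile w <= W w.1 + b)%R].
  rewrite (_ : [set w | _] = [set w | W w.1 - a < quantile w] `&`
     ~` [set w | W w.1 + b < quantile w]); last first.
    apply/seteqP; split => w /=; rewrite leNgt; first by move=> /andP[? /negP].
    by move=> [-> /negP ->].
  have mW1 : measurable_fun setT (fun w : T0 * RR R => W w.1).
    exact: (measurableT_comp mW measurable_fst).
  apply: measurableI; [|apply: measurableC]; apply: measurable_lt_set.
  - exact: measurable_funB.
  - exact: measurable_quantile.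
  - exact: measurable_funD.
  - exact: measurable_quantile.
rewrite /product_measure1; apply: ge0_le_integral => //.
- by move=> t _; rewrite lee_fin; have /andP[] := hg t.
- exact/measurable_EFinP.
- exact: measurable_fun_xsection.
move=> t _ /=; have /andP[g0 gF] := hg t.
apply: (@le_trans _ _ (F t (W t + b) - F t (W t - a))%:E); first by rewrite lee_fin.
rewrite -unif_itv//; last by apply: F_nd; lra.
apply: le_measure; rewrite ?inE.
- rewrite (_ : [set y | _] = `]F t (W t - a), F t (W t + b)[%classic); last first.
    by apply/seteqP; split => y /=; rewrite in_itv.
  exact: measurable_itv.
- exact: measurable_xsection.
move=> y /= /andP[ya yb]; rewrite /xsection /= inE /=.
have y01 : 0 < y < 1 by rewrite (le_lt_trans _ ya)// (lt_le_trans yb).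
by rewrite quantile_gt// ya leNgt quantile_gt// -leNgt ltW.
Qed.

End quantile.

Section weighted_law.
Context d (T : measurableType d) (R : realType) (Q : probability T R).
Variables (v M : T -> R).
Hypotheses (mv : measurable_fun setT v) (mM : measurable_fun setT M)
  (v01 : forall t, 0 <= v t <= 1).

Definition weight (A : set T) : R := \int[Q]_t (v t * \1_A t).

Lemma integrable_weight A : measurable A -> Q.-integrable setT (EFin \o (fun t => v t * \1_A t)).
Proof.
move=> mA; apply: (@bounded_integrable _ _ _ Q _ 1).
  by apply: measurable_funM => //; exact: measurable_indic.
move=> t; have /andP[v0 v1] := v01 t; rewrite indicE.
by case: (_ \in _); rewrite ?mulr1 ?mulr0 ?normr0 ?ler01// ger0_norm.
Qed.

Lemma weight_diff A B : measurable A -> measurable B -> A `<=` B ->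
  weight B - weight A = weight (B `\` A).
Proof.
move=> mA mB AB; have mD := measurableD mB mA.
rewrite /weight -RintegralB//; [|exact: integrable_weight|exact: integrable_weight].
apply: eq_Rintegral => t _; rewrite -mulrBr; congr (_ * _).
rewrite !indicE in_setD; case: (boolP (t \in A)) => tA.
  by rewrite (mem_set (AB _ (set_mem tA))) subrr.
by rewrite subr0 andbT.
Qed.

Lemma weight_ge0 A : 0 <= weight A.
Proof.
apply: Rintegral_ge0 => t _; have /andP[v0 v1] := v01 t.
by rewrite mulr_ge0// indicE ler0n.
Qed.

Lemma weight_le A : measurable A -> weight A <= fine (Q A).
Proof.
move=> mA; rewrite -Rintegral_indic//; apply: le_Rintegral => //.
- exact: integrable_weight.
- apply: (@bounded_integrable _ _ _ Q _ 1); first exact: measurable_indic.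
  by move=> t; rewrite indicE; case: (_ \in _); rewrite ?normr1 ?normr0.
- by move=> t _; have /andP[v0 v1] := v01 t; rewrite ler_piMl.
Qed.

End weighted_law.

Section coupling.
Context d0 d1 (T0 : measurableType d0) (T1 : measurableType d1) (R : realType).
Variables (P0 : probability T0 R) (Q : probability T1 R).
Variables (W : T0 -> R) (M : T1 -> R) (J : nat) (C : R).
Variables (u : nat -> T0 -> R) (v : nat -> T1 -> R).
Hypotheses (mW : measurable_fun setT W) (mM : measurable_fun setT M)
  (M_ge0 : forall t, 0 <= M t) (C_gt0 : 0 < C)
  (mu : forall j, measurable_fun setT (u j)) (mv : forall j, measurable_fun setT (v j))
  (u_ge0 : forall j t, 0 <= u j t) (v_ge0 : forall j t, 0 <= v j t)
  (u_sum : forall t, \sum_(j < J.+1) u j t = 1) (v_sum : forall t, \sum_(j < J.+1) v j t = 1)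
  (u_le1 : forall j t, u j t <= 1) (v_le1 : forall j t, v j t <= 1)
  (near_uv : forall j t t', (j < J)%N -> 0 < u j t -> 0 < v j t' -> `|W t - M t'| <= C).

Let a j := \int[P0]_t u j t.
Let b j := \int[Q]_t v j t.

(** Given [t], a class [j] is drawn with probabilities [u j t] and moved to a class [l] by the
    kernel [K j], and a value of [M] is drawn under [Q] weighted by [v l]. [F t] is the distribution
    function of this conditional law, realized by its quantile at the uniform variable. If the class
    stays in place and is not the last one, [near_uv] keeps the value near [W t]; the other cases
    give the bound. *)
Theorem coupling : exists S : T0 * RR R -> R,
  [/\ measurable_fun setT S,
      forall A : set (RR R), measurable A -> (P0 \x unif R)%E (S @^-1` A) = Q (M @^-1` A) &
      ((P0 \x unif R)%E [set w | (2 * C < `|S w - W w.1|)%R] <=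
        (\sum_(j < J.+1) `|a j - b j| + b J)%:E)%E].
Proof.
have v01 j t : 0 <= v j t <= 1 by rewrite v_ge0 v_le1.
have iu j : P0.-integrable setT (EFin \o u j).
  by apply: (@bounded_integrable _ _ _ P0 _ 1) => // t; rewrite ger0_norm.
have iv j : Q.-integrable setT (EFin \o v j).
  by apply: (@bounded_integrable _ _ _ Q _ 1) => // t; rewrite ger0_norm.
have a0 j : 0 <= a j by apply: Rintegral_ge0.
have b0 j : 0 <= b j by apply: Rintegral_ge0.
have sa : \sum_(j < J.+1) a j = 1.
  rewrite /a -(@Rintegral_sum _ _ _ P0 _ _ (fun j : 'I_J.+1 => u j))//.
  under eq_Rintegral do rewrite u_sum.
  by rewrite Rintegral_prob_cst.
have sb : \sum_(j < J.+1) b j = 1.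
  rewrite /b -(@Rintegral_sum _ _ _ Q _ _ (fun j : 'I_J.+1 => v j))//.
  under eq_Rintegral do rewrite v_sum.
  by rewrite Rintegral_prob_cst.
have [K [K0 K1 Kb Kd Kz]] := discrete_coupling a0 b0 sa sb.
(* [c l t * v l] summed over [l] is the density of the conditional law given [t]; classes with
   [b l = 0] drop out as division by zero gives [0] and [K j l = 0] there. *)
pose c l t := \sum_(j < J.+1) u j t * K j l / b l.
have c0 l t : 0 <= c l t.
  by apply: sumr_ge0 => j _; rewrite divr_ge0// mulr_ge0.
have cb t : \sum_(l < J.+1) c l t * b l = 1.
  transitivity (\sum_(l < J.+1) \sum_(j < J.+1) u j t * K j l).
    apply: eq_bigr => l _; rewrite mulr_suml; apply: eq_bigr => j _.
    by have [bl|bl] := eqVneq (b l) 0; [rewrite (Kz _ _ bl) !(mulr0, mul0r)|rewrite divfK].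
  rewrite exchange_big /= -(u_sum t); apply: eq_bigr => j _.
  by rewrite -mulr_sumr K1// mulr1.
have ic l : P0.-integrable setT (EFin \o c l).
  apply: (@integrable_sumR _ _ _ P0 _ _ (fun (j : 'I_J.+1) t => u j t * K j l / b l)) => j.
  under eq_fun do rewrite -mulrA mulrC; exact: integrableZlR.
have Ic l : (l < J.+1)%N -> \int[P0]_t c l t = b l / b l.
  move=> lJ; rewrite (@Rintegral_sum _ _ _ P0 _ _ (fun (j : 'I_J.+1) t => u j t * K j l / b l)).
    rewrite -[in X in X / _](Kb l lJ) mulr_suml; apply: eq_bigr => j _.
    under eq_Rintegral do rewrite -mulrA mulrC; rewrite RintegralZl//.
    by rewrite mulrC mulrA.
  by move=> j; under eq_fun do rewrite -mulrA mulrC; exact: integrableZlR.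
pose LE s := [set t | M t <= s].
have mLE s : measurable (LE s).
  rewrite (_ : LE s = ~` [set t | s < M t]); last first.
    by apply/seteqP; split => t /=; rewrite /LE /= leNgt => /negP.
  by apply: measurableC; exact: measurable_lt_set.
have LE_sub s s' : s <= s' -> LE s `<=` LE s' by move=> ss' t /= /le_trans; apply.
pose I l A := weight Q (v l) A.
have IT l : I l setT = b l.
  by apply: eq_Rintegral => t _; rewrite indicT mulr1.
pose F t s := \sum_(l < J.+1) c l t * I l (LE s).
have mc l : measurable_fun setT (c l).
  apply: measurable_sum => j; apply: measurable_funM => //.
  exact: measurable_funM.
have mF s : measurable_fun setT (F ^~ s).
  by apply: measurable_sum => l; apply: measurable_funM.
have FB t s s' : s <= s' -> F t s' - F t s = \sum_(l < J.+1) c l t * I l (LE s' `\` LE s).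
  move=> ss'; rewrite -sumrB; apply: eq_bigr => l _; rewrite -mulrBr.
  by rewrite /I (weight_diff _ (mv l) (v01 l))//; exact: LE_sub.
have F_nd t s s' : s <= s' -> F t s <= F t s'.
  move=> ss'; rewrite -subr_ge0 FB//; apply: sumr_ge0 => l _.
  by rewrite mulr_ge0// weight_ge0.
have F_neg t s : s < 0 -> F t s = 0.
  move=> s0; have -> : F t s = \sum_(l < J.+1) c l t * 0.
    apply: eq_bigr => l _; congr (_ * _); rewrite /I /weight.
    rewrite (_ : LE s = set0); last first.
      by apply/seteqP; split => // x /=; rewrite /LE /= leNgt (lt_le_trans s0).
    by under eq_Rintegral do rewrite indic0 mulr0; rewrite Rintegral_prob_cst.
  by rewrite big1 // => l _; rewrite mulr0.
have F_ge0 t s : 0 <= F t s by apply: sumr_ge0 => l _; rewrite mulr_ge0// weight_ge0.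
have F1 t s : 1 - F t s = \sum_(l < J.+1) c l t * I l (~` LE s).
  rewrite -[in LHS](cb t) -sumrB; apply: eq_bigr => l _; rewrite -mulrBr -IT.
  by rewrite /I (weight_diff _ (mv l) (v01 l))// setTD.
have F_le1 t s : F t s <= 1.
  by rewrite -subr_ge0 F1; apply: sumr_ge0 => l _; rewrite mulr_ge0// weight_ge0.
(* The added 1 keeps the divisor strictly positive. *)
pose cc t := \sum_(l < J.+1) c l t + 1.
have cc0 t : 0 < cc t by rewrite ltr_wpDl// sumr_ge0.
have I_small t A y : measurable A -> 0 < y -> fine (Q A) < y / cc t ->
    \sum_(l < J.+1) c l t * I l A < y.
  move=> mA y0 h; apply: (@le_lt_trans _ _ ((cc t - 1) * fine (Q A))).
    rewrite /cc addrK mulr_suml; apply: ler_sum => l _; rewrite ler_wpM2l//.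
    exact: weight_le.
  rewrite ltr_pdivlMr// in h; apply: le_lt_trans h.
  rewrite mulrBl mul1r mulrC lerBlDr lerDl; exact: fine_ge0.
have F_rc t s y : F t s < y -> exists2 e, 0 < e & F t (s + e) < y.
  move=> h; have h' : 0 < y - F t s by rewrite subr_gt0.
  have dec n m : (n <= m)%N ->
      LE (s + m.+1%:R^-1) `\` LE s `<=` LE (s + n.+1%:R^-1) `\` LE s.
    move=> nm x [x1 x2]; split => //; apply: LE_sub x1.
    by rewrite lerD2l lef_pV2 ?posrE ?ltr0n// ler_nat ltnS.
  have esc x : exists n, ~ (LE (s + n.+1%:R^-1) `\` LE s) x.
    have [xs|xs] := lerP (M x) s; first by exists 0%N => -[_]; apply.
    exists (Num.truncn (M x - s)^-1) => -[]; rewrite /LE /= -lerBlDl leNgt => /negP hx _; apply: hx.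
    by rewrite invf_plt ?posrE ?subr_gt0 ?ltr0n// truncnS_gt.
  have [n hn] := vanishing_prob Q (fun n => measurableD (mLE (s + n.+1%:R^-1)) (mLE s)) dec esc
    (divr_gt0 h' (cc0 t)).
  exists n.+1%:R^-1; first by rewrite invr_gt0 ltr0n.
  have se : s <= s + n.+1%:R^-1 by rewrite lerDl invr_ge0 ler0n.
  rewrite -(ltrD2r (- F t s)) FB//.
  by apply: I_small => //; exact: measurableD.
have F_top t y : y < 1 -> exists s, y <= F t s.
  move=> y1; have h' : 0 < 1 - y by rewrite subr_gt0.
  have dec n m : (n <= m)%N -> ~` LE m%:R `<=` ~` LE n%:R.
    by move=> nm; apply: subsetC; apply: LE_sub; rewrite ler_nat.
  have esc x : exists n, ~ (~` LE n%:R) x.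
    by exists (Num.truncn (M x)).+1; apply; rewrite /LE /= ltW// truncnS_gt.
  have [n hn] := vanishing_prob Q (fun n => measurableC (mLE n%:R)) dec esc
    (divr_gt0 h' (cc0 t)).
  exists n%:R; have := I_small t _ _ (measurableC (mLE n%:R)) h' hn.
  rewrite -F1; lra.
exists (quantile F); split.
- exact: measurable_quantile.
- pose q0 : T0 * RR R -> RR R := quantile F.
  have mq0 : measurable_fun setT q0 by exact: measurable_quantile.
  pose q' : {mfun (T0 * RR R)%type >-> RR R} :=
    HB.pack q0 (isMeasurableFun.Build _ _ _ _ q0 mq0).
  pose M0 : T1 -> RR R := M.
  have mM0 : measurable_fun setT M0 by exact: mM.
  pose M' : {mfun T1 >-> RR R} := HB.pack M0 (isMeasurableFun.Build _ _ _ _ M0 mM0).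
  move=> A mA.
  apply: (@law_unique _ (distribution (P0 \x unif R)%E q') (distribution Q M')) => // s.
  rewrite /distribution /pushforward /=.
  transitivity (\int[P0]_t (1 - F t s)%:E)%E; first exact: quantile_law.
  have mG := measurableC (mLE s).
  transitivity (Q (~` LE s)); last first.
    by congr (Q _); apply/seteqP; split => t /=; rewrite /LE /= /M0 ltNge => /negP.
  rewrite -[RHS]fineK ?fin_num_measure//.
  under eq_integral do rewrite F1.
  rewrite -RintegralE; last first.
    apply: (@integrable_sumR _ _ _ P0 _ _ (fun (l : 'I_J.+1) t => c l t * I l (~` LE s))) => l.
    under eq_fun do rewrite mulrC; exact: integrableZlR.
  congr EFin.
  rewrite (@Rintegral_sum _ _ _ P0 _ _ (fun (l : 'I_J.+1) t => c l t * I l (~` LE s))); last first.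
    move=> l; under eq_fun do rewrite mulrC; exact: integrableZlR.
  rewrite -Rintegral_indic//.
  transitivity (\int[Q]_x \sum_(l < J.+1) v l x * \1_(~` LE s) x); last first.
    by apply: eq_Rintegral => x _; rewrite -mulr_suml v_sum mul1r.
  rewrite (@Rintegral_sum _ _ _ Q _ _ (fun (l : 'I_J.+1) x => v l x * \1_(~` LE s) x)); last first.
    by move=> l; exact: integrable_weight.
  apply: eq_bigr => l _; under eq_Rintegral do rewrite mulrC.
  rewrite RintegralZl// Ic//; have [bl|bl] := eqVneq (b l) 0; last by rewrite divff// mulr1.
  (* A class with [b l = 0] contributes 0 on both sides: [b l / b l] is 0 by convention, and the
     weight is at most [b l]. *)
  rewrite bl invr0 mulr0 mulr0; apply/esym/eqP; rewrite eq_le weight_ge0// andbT.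
  rewrite -bl -IT -subr_ge0 (weight_diff _ (mv l) (v01 l))//; exact: weight_ge0.
(* The conditional probability that the class is below [J] and stays in place. *)
- pose g t := \sum_(j < J) K j j * u j t.
  have mg : measurable_fun setT g by apply: measurable_sum => j; exact: measurable_funM.
  (* The window is open at its left end, and values of [M] equal to [W t - C] must lie inside; hence
     [2 * C] on that side. *)
  have gF t : 0 <= g t <= F t (W t + C) - F t (W t - 2 * C).
    rewrite sumr_ge0/=; last by move=> j _; rewrite mulr_ge0.
    rewrite FB; last by have := C_gt0; lra.
    rewrite big_ord_recr /= -[leLHS]addr0; apply: lerD; last by rewrite mulr_ge0// weight_ge0.
    apply: ler_sum => l _; set A := _ `\` _.
    have lJ : (l < J.+1)%N by rewrite ltnS ltnW.
    have [ul|ul] := eqVneq (u l t) 0; first by rewrite ul mulr0 mulr_ge0// weight_ge0.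
    have [bl|bl] := eqVneq (b l) 0; first by rewrite Kz// mul0r mulr_ge0// weight_ge0.
    have -> : I l A = b l.
      apply: eq_Rintegral => x _; have [vl|vl] := eqVneq (v l x) 0; first by rewrite vl mul0r.
      have := @near_uv l t x (ltn_ord l); rewrite !lt_neqAle eq_sym ul u_ge0 eq_sym vl v_ge0.
      move=> /(_ isT isT); rewrite ler_norml => /andP[h1 h2].
      rewrite indicE mem_set ?mulr1// /A /LE; split => /=; first by lra.
      by apply/negP; rewrite -ltNge; have := C_gt0; lra.
    rewrite -ler_pdivrMr; last by rewrite lt_neqAle eq_sym bl b0.
    rewrite /c (bigD1 (Ordinal lJ))//= (mulrC (K l l)) lerDl.
    by apply: sumr_ge0 => j _; rewrite divr_ge0// mulr_ge0.
  have mq := measurable_quantile mF F_nd F_neg F_rc F_top.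
  pose A := [set w : T0 * RR R | (W w.1 - 2 * C < quantile F w <= W w.1 + C)%R].
  have mW1 : measurable_fun setT (fun w : T0 * RR R => W w.1).
    exact: (measurableT_comp mW measurable_fst).
  have mA : measurable A.
    rewrite (_ : A = [set w | W w.1 - 2 * C < quantile F w] `&`
       ~` [set w | W w.1 + C < quantile F w]); last first.
      apply/seteqP; split => w; rewrite /A /= leNgt; first by move=> /andP[? /negP].
      by move=> [-> /negP ->].
    apply: measurableI; [|apply: measurableC]; apply: measurable_lt_set => //.
      exact: measurable_funB.
    exact: measurable_funD.
  have C0 : 0 <= C by exact: ltW.
  have H := quantile_near P0 mF F_nd F_neg F_ge0 F_le1 F_rc F_top mW mg (mulr_ge0 (ler0n R 2) C0)
    C0 gF.
  apply: (@le_trans _ _ ((P0 \x unif R)%E (~` A))).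
    apply: le_measure; rewrite ?inE.
    - apply: measurable_lt_set => //; apply: (measurableT_comp (@normr_measurable R setT)).
      exact: measurable_funB.
    - exact: measurableC.
    - move=> w /= h; apply/negP; rewrite negb_and -ltNge -leNgt.
      by move: h; rewrite lter_normr => /orP[]h; apply/orP; [right|left]; lra.
  rewrite probability_setC//.
  have ig : P0.-integrable setT (EFin \o g).
    apply: (@integrable_sumR _ _ _ P0 _ _ (fun (j : 'I_J) t => K j j * u j t)) => j.
    exact: integrableZlR.
  rewrite -(RintegralE ig) in H.
  apply: (@le_trans _ _ (1 - (\int[P0]_t g t)%:E)%E); first exact: leeB.
  rewrite -EFinB lee_fin.
  rewrite (@Rintegral_sum _ _ _ P0 _ _ (fun (j : 'I_J) t => K j j * u j t)); last first.
    by move=> j; exact: integrableZlR.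
  rewrite lerBlDr -sb !big_ord_recr /=.
  apply: (@le_trans _ _ (\sum_(j < J) (`|a j - b j| + \int[P0]_t (K j j * u j t)) + b J)).
    rewrite lerD2r; apply: ler_sum => j _; rewrite RintegralZl// mulrC.
    by have := Kd j; rewrite -/(a j); lra.
  by rewrite big_split /=; have := normr_ge0 (a J - b J); lra.
Qed.

End coupling.

(** * Grid cells *)

Lemma integral_ge_cst d (T : measurableType d) (R : realType)
    (mu : {measure set T -> \bar R}) (B : set T) (f : T -> \bar R) (c : R) :
  measurable B -> 0 <= c -> (forall x, 0 <= f x)%E -> (forall x, B x -> (c%:E <= f x)%E) ->
  (c%:E * mu B <= \int[mu]_x f x)%E.
Proof.
move=> mB c0 f0 fc; rewrite ge0_integralTE//; apply: ereal_sup_ubound.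
exists (scale_nnsfun (indic_nnsfun R mB) c0) => /=.
  move=> x; change ((c * \1_B x)%:E <= f x)%E.
  rewrite indicE; case: (boolP (x \in B)) => [/set_mem xB|_].
    by rewrite mulr1; exact: fc.
  by rewrite mulr0.
by rewrite sintegralrM sintegral_indic// setIT.
Qed.

Lemma iint_ge0 (R : realType) p (g : p.-tuple R -> \bar R) :
  (forall y, 0 <= g y)%E -> (0 <= iint g)%E.
Proof.
elim: p g => [|p IH] g g0 //=; apply: integral_ge0 => t _; exact: IH.
Qed.

(* The integrand is not assumed measurable, so this goes through simple functions below it. *)
Lemma iint_ge_box (R : realType) p (g : p.-tuple R -> \bar R) (c v : R) (B : nat -> set R) :
  0 <= c -> 0 <= v -> (forall i, measurable (B i)) ->
  (forall i, (i < p)%N -> (v%:E <= (@lebesgue_measure R) (B i))%E) ->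
  (forall y, 0 <= g y)%E ->
  (forall y, (forall i : 'I_p, B i (tnth y i)) -> (c%:E <= g y)%E) ->
  ((c * v ^+ p)%:E <= iint g)%E.
Proof.
move=> c0 v0; elim: p g B => [|p IH] g B mB vB g0 gc /=.
  by rewrite expr0 mulr1; apply: gc => -[].
apply: (@le_trans _ _ ((c * v ^+ p)%:E * (@lebesgue_measure R) (B 0%N))%E).
  rewrite exprSr mulrA EFinM; apply: lee_wpmul2l; last exact: vB.
  by rewrite lee_fin mulr_ge0// exprn_ge0.
apply: integral_ge_cst; first exact: mB.
- by rewrite mulr_ge0// exprn_ge0.
- by move=> t; apply: iint_ge0.
move=> t Bt; apply: (IH _ (B \o S)) => //.
- by move=> i; exact: mB.
- by move=> i ip; exact: (vB i.+1).
move=> y hy; apply: gc => i; case: (unliftP ord0 i) => [j ->|->].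
  by rewrite tnthS; exact: hy.
by rewrite tnth0.
Qed.

Section cells.
Variables (R : realType) (p k' : nat).
Notation k := k'.+1.

(** [inord] makes the code total: inside the cube every index is below [k], elsewhere the code has
    no meaning. *)
Definition cell_code (x : p.-tuple R) : {ffun 'I_p -> 'I_k} :=
  [ffun i => inord `|cellidx k (tnth x i)|%N].

Definition cell_label (x : p.-tuple R) : nat := enum_rank (cell_code x).

Lemma cell_label_lt x : (cell_label x < k ^ p)%N.
Proof.
rewrite /cell_label; apply: (leq_trans (ltn_ord _)).
by rewrite card_ffun !card_ord.
Qed.

Lemma cellidx_bnd (r : R) : 0 <= r <= 1 -> (0 <= cellidx k r < k%:Z)%R.
Proof.
move=> /andP[r0 r1]; rewrite /cellidx; case: ltP => r1'; last first.
  by rewrite -[k%:Z]/(Posz k'.+1); lia.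
rewrite floor_ge0 mulr_ge0//= -(ltr_int R).
by apply: le_lt_trans (floor_le _) _; rewrite gtr_pMl.
Qed.

Lemma cell_code_eq x y : cube x -> cube y ->
  (cell_code x = cell_code y) <-> forall i, cellidx k (tnth x i) = cellidx k (tnth y i).
Proof.
move=> cx cy; split => [h i|h]; last by apply/ffunP => i; rewrite !ffunE h.
have := congr1 (fun f : {ffun _ -> _} => nat_of_ord (f i)) h; rewrite !ffunE.
have := cellidx_bnd (cx i); have := cellidx_bnd (cy i).
case: (cellidx k (tnth x i)) => a //; case: (cellidx k (tnth y i)) => b //= hb ha.
by rewrite !inordK//; move=> ->.
Qed.

Lemma Acell_label x : cube x -> Acell k x = [set y | cube y /\ cell_label y = cell_label x].
Proof.
move=> cx; apply/seteqP; split => y [cy] h; split => //.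
  by rewrite /cell_label; congr (nat_of_ord (enum_rank _)); apply/cell_code_eq.
by apply/cell_code_eq => //; apply: enum_rank_inj; apply: val_inj.
Qed.

Definition cell_corner (f : {ffun 'I_p -> 'I_k}) : p.-tuple R :=
  [tuple (f i)%:R / k%:R | i < p].

Lemma cell_corner_cube f : cube (cell_corner f).
Proof.
move=> i; rewrite tnth_mktuple divr_ge0//= ler_pdivrMr ?ltr0n// mul1r ler_nat.
exact: ltnW.
Qed.

Lemma cellidx_corner (a : nat) : (a < k)%N -> cellidx k (a%:R / k%:R : R) = a%:Z.
Proof.
move=> ak; rewrite /cellidx ltr_pdivrMr ?ltr0n// mul1r ltr_nat ak divfK ?pnatr_eq0//.
by apply: floor_def; rewrite intrD -!pmulrn lexx ltrDl ltr01.
Qed.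

(** Each label is attained at the lower corner of its cell, so that bounds and maxima over labels
    become bounds and maxima over points of the cube. *)
Lemma cell_label_surj c : (c < k ^ p)%N -> exists2 x : p.-tuple R, cube x & cell_label x = c.
Proof.
move=> ck; have ck' : (c < #|{ffun 'I_p -> 'I_k}|)%N by rewrite card_ffun !card_ord.
exists (cell_corner (enum_val (Ordinal ck'))); first exact: cell_corner_cube.
rewrite /cell_label (_ : cell_code _ = enum_val (Ordinal ck')) ?enum_valK//.
apply/ffunP => i; rewrite ffunE tnth_mktuple cellidx_corner//.
by apply: val_inj; rewrite /= inordK.
Qed.

Lemma measurable_cellidx (z : int) : measurable [set r : R | cellidx k r = z].
Proof.
rewrite (_ : [set r : R | cellidx k r = z] =
  (`]-oo, 1[%classic `&` `[z%:~R / k%:R, (z + 1)%:~R / k%:R[%classic) `|`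
  (`[1, +oo[%classic `&` if z == k%:Z - 1 then setT else set0)); last first.
  apply/seteqP; split => r /=; rewrite /cellidx !in_itv /= andbT.
    case: ltP => r1 h; [left|right]; split => //; last by rewrite -h eqxx.
    rewrite ler_pdivrMr ?ltr0n// ltr_pdivlMr ?ltr0n//.
    by rewrite -floor_eq; apply/eqP.
  case=> -[r1]; first rewrite r1 ler_pdivrMr ?ltr0n// ltr_pdivlMr ?ltr0n//.
    by rewrite -floor_eq => /eqP.
  by rewrite ltNge r1 /=; case: eqP => // ->.
by apply: measurableU; apply: measurableI => //; case: ifP.
Qed.

Lemma measurable_cube : measurable (@cube R p).
Proof.
rewrite (_ : @cube R p = \bigcap_(i in [set: 'I_p]) [set x | 0 <= tnth x i <= 1]); last first.
  by apply/seteqP; split => x h i; [move=> _|]; exact: h.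
apply: fin_bigcap_measurable => // i _.
have := measurable_tnth i measurableT (measurable_itv `[0, 1]%R : measurable (`[0, 1]%classic :
  set R)).
rewrite setTI; congr measurable; apply/seteqP; split => x /=; rewrite in_itv//.
Qed.

Lemma measurable_Acell (x : p.-tuple R) : measurable (Acell k x).
Proof.
rewrite (_ : Acell k x = @cube R p `&` \bigcap_(i in [set: 'I_p])
   [set y | cellidx k (tnth y i) = cellidx k (tnth x i)]); last first.
  by apply/seteqP; split => y [cy h]; split => // i; [move=> _|]; exact: h.
apply: measurableI; first exact: measurable_cube.
apply: fin_bigcap_measurable => // i _.
have := measurable_tnth i measurableT (measurable_cellidx (cellidx k (tnth x i))).
by rewrite setTI.
Qed.

Lemma iint_Acell (f : p.-tuple R -> R) (c : R) x : cube x -> 0 <= c -> (forall y, 0 <= f y) ->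
  (forall y, cube y -> c <= f y) ->
  ((c / (k ^ p)%:R)%:E <= iint (fun y => (f y * \1_(Acell k x) y)%:E))%E.
Proof.
move=> cx c0 f0 fc; pose z i := (cell_code x i : nat).
have zE i : cellidx k (tnth x i) = (z i)%:Z.
  rewrite /z ffunE; have := cellidx_bnd (cx i).
  by case: (cellidx k (tnth x i)) => a //= h; rewrite inordK.
pose B (i : nat) : set R := if insub i is Some j then
  `[(z j)%:R / k%:R, (z j).+1%:R / k%:R[%classic else set0.
rewrite natrX -exprVn.
apply: (@iint_ge_box _ _ _ _ _ B) => //.
- by move=> i; rewrite /B; case: insub.
- move=> i ip; rewrite /B insubT lebesgue_measure_itv /= lte_fin.
  rewrite ltr_pM2r ?invr_gt0 ?ltr0n// ltr_nat leqnn.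
  by rewrite -EFinB lee_fin -mulrBl -natrB// subSnn mul1r.
- by move=> y; rewrite lee_fin mulr_ge0// indicE ler0n.
move=> y hy.
have hz (i : 'I_p) : (z i)%:R / k%:R <= tnth y i < (z i).+1%:R / k%:R.
  by have := hy i; rewrite /B valK /= in_itv.
have y01 (i : 'I_p) : 0 <= tnth y i < 1.
  have /andP[h1 h2] := hz i; rewrite (le_trans _ h1) ?divr_ge0//= (lt_le_trans h2)//.
  by rewrite ler_pdivrMr ?ltr0n// mul1r ler_nat /z.
have cy : cube y by move=> i; have /andP[-> /ltW ->] := y01 i.
rewrite indicE mem_set ?mulr1; first by rewrite lee_fin fc.
split => // i; rewrite zE /cellidx; have /andP[_ ->] := y01 i.
apply: floor_def; have /andP[h1 h2] := hz i.
by rewrite intrD -!pmulrn natr1 -ler_pdivrMr ?ltr0n// h1 /= -ltr_pdivlMr ?ltr0n.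
Qed.

End cells.

(** * Moments over a cell and the statistic as a finite maximum *)

Section cell_moments.
Context (R : realType) (p : nat) d (T : measurableType d) (P : probability T R).
Variables (X : T -> p.-tuple R) (eps : T -> R).
Hypotheses (mX : measurable_fun setT X) (meps : measurable_fun setT eps)
  (Xcube : forall w, cube (X w)).
Variables (fX sig2 g3 : p.-tuple R -> R) (cX CX cs Cs M3 : R).
Hypotheses (fX_ge0 : forall x, 0 <= fX x)
  (fXE : forall B : set (p.-tuple R), measurable B ->
     P (X @^-1` B) = iint (fun x => (fX x * \1_B x)%:E))
  (cX_gt0 : 0 < cX) (fX_bnd : forall x, cube x -> cX <= fX x <= CX)
  (mean0 : cond_exp P X eps (fun _ => 0)) (var : cond_var P X eps sig2)
  (cs_gt0 : 0 < cs) (sig2_bnd : forall x, cube x -> cs <= sig2 x <= Cs)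
  (abs3 : cond_exp P X (fun w => `|eps w| ^+ 3) g3) (g3_le : forall x, cube x -> g3 x <= M3).

Lemma cond_exp_Rintegral (Y : T -> R) (g : p.-tuple R -> R) B :
  cond_exp P X Y g -> measurable B ->
  \int[P]_w (Y w * \1_B (X w)) = \int[P]_w (g (X w) * \1_B (X w)).
Proof. by move=> [_ _ _ h] mB; rewrite /Rintegral; have := h B mB; rewrite unlock => ->. Qed.

Lemma measurable_indic_comp B : measurable B -> measurable_fun setT (fun w => \1_B (X w) : R).
Proof.
move=> mB; have mI : measurable_fun setT (\1_B : p.-tuple R -> R) by exact: measurable_indic.
exact: (measurableT_comp mI mX).
Qed.

Lemma integrable_mul_indic (Y : T -> R) B : measurable B -> P.-integrable setT (EFin \o Y) ->
  P.-integrable setT (EFin \o (fun w => Y w * \1_B (X w))).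
Proof.
move=> mB iY; have mY : measurable_fun setT Y by have /integrableP[/measurable_EFinP] := iY.
apply: (@integrable_domR _ _ _ P _ (fun w => `|Y w|)).
- by apply: measurable_funM => //; exact: measurable_indic_comp.
- by move=> w; rewrite normrM indicE ler_piMr//; case: (_ \in _); rewrite ?normr1 ?normr0.
- exact: (integrable_norm iY).
Qed.

Lemma integrable_abs3 : P.-integrable setT (EFin \o (fun w => `|eps w| ^+ 3)).
Proof. by have [] := abs3. Qed.

Lemma integrable_sqr : P.-integrable setT (EFin \o (fun w => eps w ^+ 2)).
Proof.
apply: (@integrable_domR _ _ _ P _ (fun w => 1 + `|eps w| ^+ 3)).
- exact: measurable_funX.
- move=> w; rewrite normrX; set x := `|eps w|; have x0 : 0 <= x by exact: normr_ge0.
  have [x1|x1] := lerP x 1.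
    by rewrite (@le_trans _ _ 1)// ?exprn_ile1// lerDl exprn_ge0.
  apply: (@le_trans _ _ (x ^+ 3)); last by rewrite lerDr.
  by rewrite [leRHS]exprSr ler_peMr ?sqr_ge0// ltW.
- by apply: integrableDR; [exact: integrable_prob_cst|exact: integrable_abs3].
Qed.

(* Any version of the conditional mean vanishes almost surely, so centring at it in [cond_var]
   is harmless. *)
Lemma cond_second_moment B : measurable B ->
  \int[P]_w (eps w ^+ 2 * \1_B (X w)) = \int[P]_w (sig2 (X w) * \1_B (X w)).
Proof.
move=> mB; have [m [mm vs]] := var; rewrite -(cond_exp_Rintegral vs mB).
have [_ mmeas im _] := mm.
have m0 A : measurable A -> \int[P]_w (m (X w) * \1_A (X w)) = 0.
  move=> mA; rewrite -(cond_exp_Rintegral mm mA) (cond_exp_Rintegral mean0 mA).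
  by under eq_Rintegral do rewrite mul0r; rewrite Rintegral_prob_cst.
have mmX : measurable_fun setT (fun w => m (X w)) by exact: (measurableT_comp mmeas mX).
have abs0 : \int[P]_w `|m (X w)| = 0.
  pose A := [set x | 0 < m x].
  have mA : measurable A by exact: measurable_lt_set.
  rewrite (_ : \int[P]_w _ = \int[P]_w (m (X w) * \1_A (X w) - m (X w) * \1_(~` A) (X w))).
    by rewrite RintegralB ?m0 ?subrr//; [exact: measurableC| |];
      apply: integrable_mul_indic => //; exact: measurableC.
  apply: eq_Rintegral => w _; rewrite !indicE in_setC /A.
  case: (boolP (X w \in _)) => [/set_mem /= h|/negP h]; first by rewrite mulr1 mulr0 subr0
    gtr0_norm.
  rewrite mulr1 mulr0 sub0r ler0_norm// leNgt; apply/negP => h'; apply: h; exact/mem_set.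
have ae0 : ae_eq P setT (EFin \o (fun w => m (X w))) (cst 0%E).
  apply/ae_eq_integral_abs => //; first exact/measurable_EFinP.
  transitivity (\int[P]_w (`|m (X w)|)%:E)%E; first by apply: eq_integral.
  rewrite -RintegralE ?abs0//; exact: (integrable_norm im).
rewrite /Rintegral; congr fine; apply: ae_eq_integral => //.
- apply/measurable_EFinP; apply: measurable_funM; first exact: measurable_funX.
  exact: measurable_indic_comp.
- apply/measurable_EFinP; apply: measurable_funM; last exact: measurable_indic_comp.
  by apply: measurable_funX; exact: measurable_funB.
apply: filterS ae0 => w /(_ Logic.I) [mw] _.
by rewrite /= mw subr0.
Qed.

Variable k' : nat.
Notation k := k'.+1.
Notation N := (k ^ p)%N.
Let L w := cell_label k' (X w).

Lemma label_lt w : (L w < N)%N. Proof. exact: cell_label_lt. Qed.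

Lemma label_indic c w x : cube x -> cell_label k' x = c ->
  (L w == c)%:R = \1_(Acell k x) (X w) :> R.
Proof.
move=> cx xc; rewrite indicE Acell_label//; congr (nat_of_bool _)%:R.
apply/eqP/idP => [h|/set_mem[_ h]]; first by apply/mem_set; split => //; rewrite xc.
by rewrite -xc.
Qed.

Lemma measurable_label c : measurable_fun setT (fun w => (L w == c)%:R : R).
Proof.
have [cN|cN] := ltnP c N; last first.
  rewrite (_ : (fun w => _) = fun=> 0); first exact: measurable_cst.
  by apply/funext => w; rewrite ltn_eqF// (leq_trans (label_lt w)).
have [x cx xc] := cell_label_surj R cN.
rewrite (_ : (fun w => _) = fun w => \1_(Acell k x) (X w)).
  by apply: measurable_indic_comp; exact: measurable_Acell.
by apply/funext => w; exact: label_indic.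
Qed.

Definition cell_prob c : R := \int[P]_w (L w == c)%:R.
Definition cell_var c : R := \int[P]_w ((L w == c)%:R * eps w ^+ 2).

Lemma cell_prob_ge0 c : 0 <= cell_prob c.
Proof. by apply: Rintegral_ge0 => w _; rewrite ler0n. Qed.

Lemma integrable_label c : P.-integrable setT (EFin \o (fun w => (L w == c)%:R : R)).
Proof.
apply: (@bounded_integrable _ _ _ P _ 1); first exact: measurable_label.
by move=> w; rewrite ger0_norm ?ler0n// lern1 leq_b1.
Qed.

Lemma cell_prob_sum : \sum_(c < N) cell_prob c = 1.
Proof.
rewrite /cell_prob -(@Rintegral_sum _ _ _ P _ _ (fun (c : 'I_N) w => (L w == c)%:R)); last first.
  by move=> c; exact: integrable_label.
rewrite -[RHS](Rintegral_prob_cst P); apply: eq_Rintegral => w _.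
rewrite (bigD1 (Ordinal (label_lt w)))//= eqxx big1 ?addr0// => c.
by rewrite -val_eqE /= eq_sym => /negbTE ->.
Qed.

Lemma cell_probE x : cube x -> cell_prob (cell_label k' x) = pdelta P X k x.
Proof.
move=> cx; rewrite /pdelta -Rintegral_indic; last first.
  by have := mX measurableT (measurable_Acell k' x); rewrite setTI.
by apply: eq_Rintegral => w _; rewrite (label_indic _ cx).
Qed.

Lemma cell_prob_ge c : (c < N)%N -> cX / N%:R <= cell_prob c.
Proof.
move=> cN; have [x cx <-] := cell_label_surj R cN; rewrite cell_probE// /pdelta.
have mA := measurable_Acell k' x.
rewrite -lee_fin fineK ?fin_num_measure//; last by have := mX measurableT mA; rewrite setTI.
rewrite fXE//; apply: iint_Acell => //; first exact: ltW.
by move=> y cy; have /andP[] := fX_bnd cy.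
Qed.

Lemma cell_prob_gt0 c : (c < N)%N -> 0 < cell_prob c.
Proof.
move=> cN; apply: lt_le_trans (cell_prob_ge cN).
by rewrite divr_gt0// ltr0n expn_gt0.
Qed.

Lemma cell_mean c : (c < N)%N -> \int[P]_w ((L w == c)%:R * eps w) = 0.
Proof.
move=> cN; have [x cx xc] := cell_label_surj R cN.
under eq_Rintegral do rewrite (label_indic _ cx xc) mulrC.
rewrite (cond_exp_Rintegral mean0 (measurable_Acell k' x)).
by under eq_Rintegral do rewrite mul0r; rewrite Rintegral_prob_cst.
Qed.

Lemma cell_varE x : cube x ->
  cell_var (cell_label k' x) = \int[P]_w (sig2 (X w) * \1_(Acell k x) (X w)).
Proof.
move=> cx; rewrite -(cond_second_moment (measurable_Acell k' x)).
by apply: eq_Rintegral => w _; rewrite (label_indic _ cx erefl) mulrC.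
Qed.

Lemma cell_var_ge c : (c < N)%N -> cs * cell_prob c <= cell_var c.
Proof.
move=> cN; have [x cx xc] := cell_label_surj R cN; rewrite -xc cell_varE//.
have mA := measurable_Acell k' x.
rewrite /cell_prob -RintegralZl//; last exact: integrable_label.
apply: le_Rintegral => //.
- exact/integrableZlR/integrable_label.
- by have [m [_ [_ _ i _]]] := var; exact: integrable_mul_indic.
move=> w _; rewrite (label_indic _ cx erefl); apply: ler_wpM2r; first by rewrite indicE ler0n.
by have /andP[] := sig2_bnd (Xcube w).
Qed.

Lemma cell_var_gt0 c : (c < N)%N -> 0 < cell_var c.
Proof.
by move=> cN; apply: lt_le_trans (cell_var_ge cN); rewrite mulr_gt0// cell_prob_gt0.
Qed.

Lemma cell_third c : (c < N)%N ->
  \int[P]_w ((L w == c)%:R * `|eps w| ^+ 3) <= M3 * cell_prob c.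
Proof.
move=> cN; have [x cx xc] := cell_label_surj R cN; have mA := measurable_Acell k' x.
under eq_Rintegral do rewrite (label_indic _ cx xc) mulrC.
rewrite (cond_exp_Rintegral abs3 mA) /cell_prob -RintegralZl//; last exact: integrable_label.
apply: le_Rintegral => //.
- by have [_ _ i _] := abs3; exact: integrable_mul_indic.
- exact/integrableZlR/integrable_label.
move=> w _; rewrite (label_indic _ cx xc); apply: ler_wpM2r; first by rewrite indicE ler0n.
exact: g3_le.
Qed.

Variable n : nat.
Hypothesis n_gt0 : (0 < n)%N.

(** The step is scaled through the second moment of [eps] on its own cell, so that each step
    contributes variance 1 / n to every coordinate and the walk of length [n] has unit variances. *)
Definition cell_step w : R := eps w / (Num.sqrt n%:R * Num.sqrt (cell_var (L w))).

Lemma label_step c w (f : R -> R) :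
  (L w == c)%:R * f (cell_step w) =
  (L w == c)%:R * f (eps w / (Num.sqrt n%:R * Num.sqrt (cell_var c))).
Proof. by rewrite /cell_step; case: eqP => [->//|_]; rewrite !mul0r. Qed.

Lemma measurable_step : measurable_fun setT cell_step.
Proof.
rewrite (_ : cell_step = fun w => \sum_(c < N) (L w == c)%:R *
    (eps w * (Num.sqrt n%:R * Num.sqrt (cell_var c))^-1)).
  apply: measurable_sum => c; apply: measurable_funM; first exact: measurable_label.
  exact: measurable_funM.
apply/funext => w; under eq_bigr do rewrite -(label_step _ _ id).
by rewrite -mulr_suml (bigD1 (Ordinal (label_lt w)))//= eqxx big1 ?addr0 ?mul1r// => c;
   rewrite -val_eqE /= eq_sym => /negbTE ->.
Qed.

Lemma step_mean c : (c < N)%N -> cellmoment P L cell_step 1 c = 0.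
Proof.
move=> cN; rewrite /cellmoment; set q := (Num.sqrt n%:R * Num.sqrt (cell_var c))^-1.
transitivity (\int[P]_w (q * ((L w == c)%:R * eps w))).
  apply: eq_Rintegral => w _; rewrite (label_step c w (fun x => x ^+ 1)) expr1 -/q; ring.
rewrite RintegralZl ?cell_mean ?mulr0//.
apply: (@integrable_domR _ _ _ P _ (fun w => 1 + eps w ^+ 2)).
- by apply: measurable_funM => //; exact: measurable_label.
- move=> w; apply: (@le_trans _ _ `|eps w|).
    by rewrite normrM ler_piMl// ger0_norm ?ler0n// lern1 leq_b1.
  by rewrite -[eps w ^+ 2]real_normK ?num_real//; have := sqr_ge0 (`|eps w| - 1); nra.
- by apply: integrableDR; [exact: integrable_prob_cst|exact: integrable_sqr].
Qed.

Lemma integrable_label_mul (Y : T -> R) c : P.-integrable setT (EFin \o Y) ->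
  P.-integrable setT (EFin \o (fun w => (L w == c)%:R * Y w)).
Proof.
move=> iY; have mY : measurable_fun setT Y by have /integrableP[/measurable_EFinP] := iY.
apply: (@integrable_domR _ _ _ P _ (fun w => `|Y w|)).
- by apply: measurable_funM => //; exact: measurable_label.
- by move=> w; rewrite normrM ler_piMl// ger0_norm ?ler0n// lern1 leq_b1.
- exact: (integrable_norm iY).
Qed.

Lemma step_var c : (c < N)%N -> cellmoment P L cell_step 2 c = n%:R^-1.
Proof.
move=> cN; rewrite /cellmoment; have v0 := cell_var_gt0 cN.
transitivity (\int[P]_w ((n%:R * cell_var c)^-1 * ((L w == c)%:R * eps w ^+ 2))).
  apply: eq_Rintegral => w _; rewrite (label_step c w (fun x => x ^+ 2)) exprMn exprVn exprMn.
  by rewrite (sqr_sqrtr (ler0n R n)) (sqr_sqrtr (ltW v0)); ring.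
rewrite RintegralZl//; last exact/integrable_label_mul/integrable_sqr.
by rewrite -/(cell_var c) invfM mulfVK// gt_eqF.
Qed.

Lemma step_abs3 c : (c < N)%N ->
  cellabs3 P L cell_step c <= M3 * cell_prob c / (Num.sqrt n%:R * Num.sqrt (cell_var c)) ^+ 3.
Proof.
move=> cN; rewrite /cellabs3; have v0 := cell_var_gt0 cN.
set q := Num.sqrt n%:R * Num.sqrt (cell_var c).
have q0 : 0 < q by rewrite mulr_gt0 ?sqrtr_gt0 ?ltr0n.
rewrite (_ : \int[P]_w _ = \int[P]_w ((q ^+ 3)^-1 * ((L w == c)%:R * `|eps w| ^+ 3))).
  rewrite RintegralZl//; last exact/integrable_label_mul/integrable_abs3.
  rewrite mulrC; apply: ler_wpM2r; first by rewrite invr_ge0 exprn_ge0// ltW.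
  exact: cell_third.
apply: eq_Rintegral => w _; rewrite (label_step c w (fun x => `|x| ^+ 3)) normrM exprMn.
by rewrite -/q normfV (gtr0_norm q0) exprVn mulrA mulrC.
Qed.

Lemma integrable_step3 : P.-integrable setT (EFin \o (fun w => `|cell_step w| ^+ 3)).
Proof.
pose q c := (Num.sqrt n%:R * Num.sqrt (cell_var c))^-1.
apply: (@integrable_domR _ _ _ P _ (fun w => \sum_(c < N) `|q c| ^+ 3 * `|eps w| ^+ 3)).
- apply: measurable_funX; exact: (measurableT_comp (@normr_measurable R setT) measurable_step).
- move=> w; rewrite ger0_norm ?exprn_ge0// (bigD1 (Ordinal (label_lt w)))//=.
  rewrite /cell_step normrM exprMn mulrC lerDl; apply: sumr_ge0 => c _.
  by apply: mulr_ge0; exact: exprn_ge0.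
- apply: (@integrable_sumR _ _ _ P _ _ (fun (c : 'I_N) w => `|q c| ^+ 3 * `|eps w| ^+ 3)) => c.
  exact/integrableZlR/integrable_abs3.
Qed.

(** The square root of [taudelta] is the cell probability divided by the square root of [cell_var],
    and this probability cancels the one in [mtilde]. What is left depends only on the cell and
    every label occurs, so the supremum over the cube is an attained maximum over labels. *)
Lemma stat_maxabs (S : Type) (omega : S -> nat -> T) (w : S) :
  stat P X sig2 (fun j w => X (omega w j)) (fun j w => eps (omega w j)) k n w =
  maxabs N (walk L cell_step n (omega w) (fun=> 0)).
Proof.
have N0 : (0 < N)%N by rewrite expn_gt0.
have n0 : 0 < Num.sqrt n%:R :> R by rewrite sqrtr_gt0 ltr0n.
set W := walk _ _ _ _ _.
have val x : cube x -> `|Num.sqrt (taudelta P X sig2 k x) *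
    mtilde P X (fun j w => X (omega w j)) (fun j w => eps (omega w j)) k n w x| =
    (Num.sqrt n%:R)^-1 * `|W (cell_label k' x)|.
  move=> cx; set c := cell_label k' x; have cN : (c < N)%N by exact: cell_label_lt.
  have v0 := cell_var_gt0 cN; have p0 := cell_prob_gt0 cN.
  rewrite -[X in X * `|_|](ger0_norm (_ : 0 <= (Num.sqrt n%:R)^-1)) ?invr_ge0 ?sqrtr_ge0//.
  rewrite -normrM; congr `|_|.
  have vE : fine 'E_P[fun w => (sig2 (X w) * \1_(Acell k x) (X w))%R]%E = cell_var c.
    by rewrite unlock cell_varE.
  rewrite /taudelta vE -cell_probE// -/c.
  rewrite sqrtrM ?sqr_ge0// sqrtr_sqr (gtr0_norm p0) sqrtrV ?ltW//.
  rewrite /W walkE add0r /mtilde -cell_probE// -/c.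
  have -> : \sum_(j < n) eps (omega w j) * (cell_prob c)^-1 * \1_(Acell k x) (X (omega w j)) =
    (cell_prob c)^-1 * \sum_(j < n) (L (omega w j) == c)%:R * eps (omega w j).
    rewrite mulr_sumr; apply: eq_bigr => j _; rewrite (label_indic _ cx erefl).
    ring.
  have -> : \sum_(l < n) (L (omega w l) == c)%:R * cell_step (omega w l) =
    (Num.sqrt n%:R * Num.sqrt (cell_var c))^-1 *
      \sum_(j < n) (L (omega w j) == c)%:R * eps (omega w j).
    rewrite mulr_sumr; apply: eq_bigr => j _; rewrite (label_step c _ id).
    by rewrite mulrA mulrC.
  rewrite -[in X in X^-1 * _](sqr_sqrtr (ler0n R n)).
  have s0 : 0 < Num.sqrt (cell_var c) by rewrite sqrtr_gt0.
  by field; rewrite !gt_eqF.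
rewrite /stat; set A := [set _ | _ in _].
suff -> : sup A = (Num.sqrt n%:R)^-1 * maxabs N W by rewrite mulrA mulfV ?mul1r// gt_eqF.
have ub y : A y -> y <= (Num.sqrt n%:R)^-1 * maxabs N W.
  move=> [x cx <-]; rewrite val// ler_wpM2l ?invr_ge0 ?sqrtr_ge0//.
  exact/maxabs_ge/cell_label_lt.
have att : A ((Num.sqrt n%:R)^-1 * maxabs N W).
  have [c cN ->] := maxabs_attained N0 W; have [x cx <-] := cell_label_surj R cN.
  by exists x => //; rewrite val.
apply/eqP; rewrite eq_le; apply/andP; split.
  by apply: ge_sup; [eexists; exact: att|exact: ub].
by apply: ub_le_sup => //; exists ((Num.sqrt n%:R)^-1 * maxabs N W).
Qed.

End cell_moments.

(** * Asymptotics *)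

Section finite_coupling.
Context d (T : measurableType d) (R : realType) (P : probability T R).
Variables (N n : nat) (L : T -> nat) (xi : T -> R).
Hypotheses (N_gt0 : (0 < N)%N)
  (mL : forall c, measurable_fun setT (fun t => (L t == c)%:R : R))
  (mxi : measurable_fun setT xi).
Variables (beta lam err eta : R).
Hypotheses (beta_gt0 : 0 < beta) (lam_gt0 : 0 < lam) (eta_gt0 : 0 < eta).
Notation Omega := (seqspace (RR R)).
Notation gq := (gauss_seq R).
Notation W w := (walk L xi n w (fun=> 0)).
Hypothesis dist : forall J,
  \sum_(j < J.+1) `|\int[seq_measure P]_t hat J j (smax N beta lam (W t))
     - \int[gq]_z hat J j (smax N beta lam z)| <= err.

Lemma smax_bounds w : `|smax N beta lam w - lam * beta * maxabs N w| <= lam * ln (2 * N%:R).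
Proof.
rewrite /smax -mulrA -mulrBr normrM gtr0_norm// ler_wpM2l ?(ltW lam_gt0)//.
by apply: ln_coshsum_max => //; exact: ltW.
Qed.

Lemma hat01 J j (x : R) : `|hat J j x| <= 1.
Proof. by rewrite ger0_norm ?hat_ge0// hat_le1. Qed.

Lemma measurable_hat_smax J j :
  measurable_fun setT (fun z : Omega => hat J j (smax N beta lam z)).
Proof. exact: (measurableT_comp (@measurable_hat R J j) (measurable_smax N beta lam)). Qed.

(** Markov's inequality, since the last class requires [smax] to be at least [J]. The bound [err]
    does not depend on [J], so [J] may be as large as [eta] asks. *)
Lemma last_class_small : exists2 J, (0 < J)%N &
  \int[gq]_z hat J J (smax N beta lam z) <= eta.
Proof.
have l0 := ltW lam_gt0; have b0 := ltW beta_gt0.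
pose m := lam * beta * (ln N%:R + 4) + lam * ln (2 * N%:R).
pose J := (Num.truncn (m / eta)).+1.
have J0 : 0 < J%:R :> R by rewrite ltr0n.
exists J => //.
have N1 : 1 <= N%:R :> R by rewrite ler1n.
have i1 : gq.-integrable setT (EFin \o (fun z : Omega => lam * beta * maxabs N z + lam * ln (2 *
  N%:R))).
  by apply: integrableDR; [exact/integrableZlR/integrable_maxabs|exact: integrable_prob_cst].
apply: (@le_trans _ _ (\int[gq]_z (J%:R^-1 * (lam * beta * maxabs N z + lam * ln (2 * N%:R))))).
  apply: le_Rintegral => //.
  - apply: (@bounded_integrable _ _ _ gq _ 1); first exact: measurable_hat_smax.
    by move=> z; exact: hat01.
  - exact: integrableZlR.
  move=> z _; have := smax_bounds z; rewrite ler_norml => /andP[_ h2].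
  have s0 : 0 <= smax N beta lam z by exact: smax_ge0.
  have h3 : 0 <= lam * beta * maxabs N z + lam * ln (2 * N%:R).
    by apply: addr_ge0; rewrite mulr_ge0 ?mulr_ge0 ?maxabs_ge0// ln_ge0//; lra.
  have [h|h] := lerP (hat J J (smax N beta lam z)) 0.
    by rewrite (le_trans h)// mulr_ge0// invr_ge0 ltW.
  have JS := hat_last h (ltn0Sn _).
  apply: (@le_trans _ _ 1); first exact: hat_le1.
  by rewrite ler_pdivlMl// mulr1 (le_trans JS)//; lra.
rewrite RintegralZl// RintegralD//; [|exact/integrableZlR/integrable_maxabs|exact:
  integrable_prob_cst].
rewrite Rintegral_prob_cst RintegralZl//; last exact: integrable_maxabs.
rewrite ler_pdivrMl//.
apply: (@le_trans _ _ m).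
  by rewrite lerD2r ler_wpM2l ?mulr_ge0// gauss_seq_maxabs.
by rewrite -ler_pdivrMr// ltW// truncnS_gt.
Qed.

(** A common class puts two values of [smax] within 4 of each other, and each is within
    [lam * ln (2 * N)] of [lam * beta] times its maximum. *)
Definition coupling_radius : R := 4 / (lam * beta) + 2 * ln (2 * N%:R) / beta.

Theorem finite_coupling :
  exists S : (seqspace T * Omega) * RR R -> R,
  [/\ measurable_fun setT S,
      forall A : set (RR R), measurable A ->
        ((seq_measure P \x gq) \x unif R)%E (S @^-1` A) = gq ((maxabs N : Omega -> R) @^-1` A) &
      (((seq_measure P \x gq) \x unif R)
         [set w | (2 * coupling_radius < `|S w - maxabs N (W w.1.1)|)%R]
        <= (err + eta)%:E)%E].
Proof.
have [J J0 bJ] := last_class_small.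
have N1 : 1 <= N%:R :> R by rewrite ler1n.
have lb : 0 < lam * beta by exact: mulr_gt0.
have ln2N : 0 <= ln (2 * N%:R) :> R by rewrite ln_ge0//; lra.
pose U := (seqspace T * Omega)%type.
have mw : measurable_fun setT (fun t : U => W t.1 : Omega).
  by apply: (@measurable_walk _ T R L xi mL mxi n _ U fst (fun=> (fun=> 0))) => //; exact:
    measurable_fst.
have mw0 : measurable_fun setT (fun t : seqspace T => W t : Omega).
  by apply: (@measurable_walk _ T R L xi mL mxi n _ (seqspace T) id (fun=> (fun=> 0))).
have C0 : 0 < coupling_radius.
  apply: ltr_pwDl; first by apply: divr_gt0.
  by apply: mulr_ge0; [apply: mulr_ge0|rewrite invr_ge0 ltW].
have near j (t : U) (z : Omega) : (j < J)%N -> 0 < hat J j (smax N beta lam (W t.1)) ->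
    0 < hat J j (smax N beta lam z) -> `|maxabs N (W t.1) - maxabs N z| <= coupling_radius.
  move=> jJ h1 h2.
  have /andP[a1 a2] := hat_support jJ (smax_ge0 beta N_gt0 (ltW lam_gt0) _) h1.
  have /andP[b1 b2] := hat_support jJ (smax_ge0 beta N_gt0 (ltW lam_gt0) _) h2.
  have := smax_bounds (W t.1); have := smax_bounds z.
  rewrite !ler_norml => /andP[c1 c2] /andP[d1 d2].
  set q := lam * ln (2 * N%:R) in c1 c2 d1 d2.
  have E : lam * beta * coupling_radius = 4 + 2 * q.
    by rewrite /coupling_radius /q; field; rewrite !gt_eqF.
  have e1 : - (4 + 2 * q) <= lam * beta * (maxabs N (W t.1) - maxabs N z) by rewrite mulrBr; lra.
  have e2 : lam * beta * (maxabs N (W t.1) - maxabs N z) <= 4 + 2 * q by rewrite mulrBr; lra.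
  rewrite -E -mulrN ler_pM2l// in e1; rewrite -E ler_pM2l// in e2.
  by apply/andP.
have [S [mS lawS closeS]] := @coupling _ _ _ _ R (seq_measure P \x gq)%E gq
  (fun t => maxabs N (W t.1)) (maxabs N) J coupling_radius
  (fun j t => hat J j (smax N beta lam (W t.1))) (fun j z => hat J j (smax N beta lam z))
  (measurableT_comp (measurable_maxabs N) mw) (measurable_maxabs N) (maxabs_ge0 N) C0
  (fun j => measurableT_comp (measurable_hat_smax J j) mw) (measurable_hat_smax J)
  (fun j t => hat_ge0 J j _) (fun j t => hat_ge0 J j _)
  (fun t => sum_hat J _) (fun t => sum_hat J _)
  (fun j t => hat_le1 J j _) (fun j t => hat_le1 J j _) near.
exists S; split => //; apply: (le_trans closeS); rewrite lee_fin; apply: lerD => //.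
apply: le_trans (dist J); rewrite le_eqVlt; apply/orP; left; apply/eqP.
apply: eq_bigr => j _; congr (`|_ - _|).
apply: (@Rintegral_law _ _ U (seqspace T) R (seq_measure P \x gq)%E (seq_measure P) fst
  (fun t => hat J j (smax N beta lam (W t))) 1).
- exact: measurable_fst.
- by move=> A mA; exact: fst_law.
- exact: (measurableT_comp (measurable_hat_smax J j) mw0).
- by move=> t; exact: hat01.
Qed.

End finite_coupling.

(** * Size of the class error for the chosen scales *)

Section error_estimate.
Variable R : realType.
Variables (N n : nat) (l h nn r K3 Ct B cX nu : R).
Hypotheses (N_gt0 : (0 < N)%N) (n_gt0 : (0 < n)%N) (l_ge1 : 1 <= l) (h_gt0 : 0 < h)
  (hE : h ^+ 2 = N%:R / n%:R) (nn_gt0 : 0 < nn) (l_nn : l <= nu * nn) (r_gt0 : 0 < r)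
  (r_ge : l * Num.sqrt l * nn * h <= r) (r3_ge : l ^+ 3 * h <= r ^+ 3)
  (lnN : ln N%:R <= B * l) (B_ge0 : 0 <= B) (cX_gt0 : 0 < cX) (K3_ge0 : 0 <= K3) (Ct_ge0 : 0 <= Ct).

Definition error_cst : R :=
  96 * (300 ^+ 2 * K3) + 4 * Ct + 144 * (Num.sqrt ((B + 1) / cX) * (B + 4) * nu) + 4.

(** [h] stands for sqrt(N / n) and [nn] for n^(1/nu). The third-order term is of order l^2 h / r^3,
    at most 1 / l by [r3_ge]. The deviation [u] is chosen so that [n * pmin * u ^+ 2] equals
    [(B + 1) * l], which beats the factor N <= exp(B l). The change of variances is of order sqrt(l)
    h / r, at most 1 / (l nn) by [r_ge]; the factor ln N = O(l) is then paid for by [l_nn]. *)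
Lemma class_error_le :
  class_error N n (l / r) l^-1 (K3 * (h / n%:R)) (Ct / (l ^+ 2 * n%:R))
    (Num.sqrt ((B + 1) / cX * l) * h) (cX / N%:R) <= error_cst / l.
Proof.
have l0 : 0 < l by exact: lt_le_trans l_ge1.
have ln0 : l != 0 by rewrite gt_eqF.
have rn0 : r != 0 by rewrite gt_eqF.
have nR : 0 < n%:R :> R by rewrite ltr0n.
have NR : 0 < N%:R :> R by rewrite ltr0n.
have B1 : 0 < B + 1 by have := B_ge0; lra.
have A0 : 0 <= (B + 1) / cX by rewrite divr_ge0 ?ltW.
have s0 : 0 < Num.sqrt l by rewrite sqrtr_gt0.
rewrite /class_error /error_cst; set c300 := 300 ^+ 2.
have c300_ge0 : 0 <= c300 by exact: sqr_ge0.
set a := Num.sqrt ((B + 1) / cX) : R.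
have a_ge0 : 0 <= a by exact: sqrtr_ge0.
have -> : Num.sqrt ((B + 1) / cX * l) = a * Num.sqrt l by rewrite sqrtrM.
have t1 : l ^+ 2 * h / r ^+ 3 <= l^-1.
  rewrite ler_pdivrMr ?exprn_gt0// ler_pdivlMl//.
  by apply: le_trans r3_ge; rewrite le_eqVlt; apply/orP; left; apply/eqP; ring.
have e1 : n%:R * (2 * ((48 * c300 * (l^-1 * (l / r) ^+ 3)) * (K3 * (h / n%:R))) +
    4 * (Ct / (l ^+ 2 * n%:R))) <= (96 * (c300 * K3) + 4 * Ct) / l.
  have -> : n%:R * (2 * ((48 * c300 * (l^-1 * (l / r) ^+ 3)) * (K3 * (h / n%:R))) +
    4 * (Ct / (l ^+ 2 * n%:R))) =
    96 * (c300 * K3) * (l ^+ 2 * h / r ^+ 3) + 4 * Ct * (l ^- 2).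
    by field; rewrite !gt_eqF.
  rewrite [leRHS]mulrDl; apply: lerD; first by apply: ler_wpM2l => //; rewrite mulr_ge0// mulr_ge0.
  apply: ler_wpM2l; first by rewrite mulr_ge0.
  rewrite lef_pV2 ?posrE ?exprn_gt0//; exact: ler_eXnr.
have e2 : 144 * (l^-1 * (l / r * (a * Num.sqrt l * h))) * (ln N%:R + 4)
    <= 144 * (a * (B + 4) * nu) / l.
  have x1 : l^-1 * (l / r * (a * Num.sqrt l * h)) <= a / (l * nn).
    have -> : l^-1 * (l / r * (a * Num.sqrt l * h)) = a * (Num.sqrt l * h / r).
      by field; rewrite ln0 rn0.
    apply: ler_wpM2l => //; rewrite ler_pdivrMr// ler_pdivlMl ?mulr_gt0//.
    by apply: le_trans r_ge; rewrite le_eqVlt; apply/orP; left; apply/eqP; ring.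
  have x2 : 0 <= ln N%:R + 4 :> R by rewrite addr_ge0// ln_ge0// ler1n.
  have x3 : ln N%:R + 4 <= (B + 4) * l by have := lnN; have := l_ge1; nra.
  have x4 : nn^-1 <= nu / l by rewrite ler_pdivlMr// ler_pdivrMl// mulrC.
  apply: (@le_trans _ _ (144 * (a / (l * nn)) * ((B + 4) * l))).
    apply: ler_pM => //; last by apply: ler_wpM2l.
    rewrite mulr_ge0// mulr_ge0 ?invr_ge0 ?(ltW l0)// mulr_ge0 ?divr_ge0 ?(ltW l0) ?(ltW r_gt0)//.
    by rewrite mulr_ge0 ?(ltW h_gt0)// mulr_ge0// ltW.
  have -> : 144 * (a / (l * nn)) * ((B + 4) * l) = 144 * (a * (B + 4)) * nn^-1.
    by field; rewrite ln0 gt_eqF.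
  have -> : 144 * (a * (B + 4) * nu) / l = 144 * (a * (B + 4)) * (nu / l) by ring.
  apply: ler_wpM2l => //; rewrite mulr_ge0// mulr_ge0// addr_ge0//.
have e3 : 4 * N%:R * expR (- (n%:R * (cX / N%:R) * (a * Num.sqrt l * h) ^+ 2)) <= 4 / l.
  have -> : n%:R * (cX / N%:R) * (a * Num.sqrt l * h) ^+ 2 = (B + 1) * l.
    rewrite !exprMn (sqr_sqrtr A0) (sqr_sqrtr (ltW l0)) hE.
    by field; rewrite !gt_eqF.
  rewrite -mulrA; apply: ler_wpM2l => //.
  rewrite -[X in X * _](lnK (_ : N%:R \is Num.pos)) ?posrE// -expRD.
  apply: (@le_trans _ _ (expR (- l))).
    by rewrite ler_expR; have := lnN; lra.
  rewrite expRN lef_pV2 ?posrE ?expR_gt0//; have := expR_ge1Dx l; lra.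
have -> : (96 * (c300 * K3) + 4 * Ct + 144 * (a * (B + 4) * nu) + 4) / l =
  (96 * (c300 * K3) + 4 * Ct) / l + (144 * (a * (B + 4) * nu) / l + 4 / l) by ring.
by apply: lerD => //; exact: lerD.
Qed.

End error_estimate.

(** * Algebra of the rate *)

Section rate.
Variables (R : realType) (p k n : nat) (nu : R).
Hypotheses (k_gt0 : (0 < k)%N) (n_gt1 : (1 < n)%N) (nu_gt0 : 0 < nu).
Notation N := (k ^ p)%N.
Notation l := (ln (n%:R : R)).

Definition mesh_ratio : R := Num.sqrt (N%:R / n%:R).
Definition moment_scale : R := n%:R `^ nu^-1.
(** The first term of [rate], set by the truncation of large steps; [rate_lindeberg] is the third
    term, set by the third moments. *)
Definition rate_tail : R := l `^ (3 / 2) /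
  (delta R k `^ (p%:R / 2) * n%:R `^ (2^-1 - nu^-1)).
Definition rate_lindeberg : R := l / (delta R k `^ (p%:R / 6) * n%:R `^ (6^-1)).

Let nR : 0 < n%:R :> R. Proof. by rewrite ltr0n ltnW. Qed.
Let kR : 0 < k%:R :> R. Proof. by rewrite ltr0n. Qed.
Let dl0 : 0 < delta R k. Proof. by rewrite invr_gt0. Qed.
Let l0 : 0 < l. Proof. by rewrite ln_gt0// ltr1n. Qed.
Let NR : 0 < N%:R :> R. Proof. by rewrite ltr0n expn_gt0 k_gt0. Qed.

Lemma mesh_ratio_gt0 : 0 < mesh_ratio.
Proof. by rewrite sqrtr_gt0 divr_gt0. Qed.

Lemma mesh_ratio_sqr : mesh_ratio ^+ 2 = N%:R / n%:R.
Proof. by rewrite sqr_sqrtr// divr_ge0 ?ltW. Qed.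

Lemma delta_half : delta R k `^ (p%:R / 2) = (Num.sqrt N%:R)^-1.
Proof.
rewrite powRrM powR12_sqrt ?powR_ge0// powR_mulrn ?ltW// /delta exprVn -natrX.
by rewrite sqrtrV// ltW.
Qed.

Lemma mesh_ratioE : mesh_ratio = Num.sqrt N%:R / Num.sqrt n%:R.
Proof. by rewrite /mesh_ratio sqrtrM ?(ltW NR)// sqrtrV// ltW. Qed.

Lemma rate_tailE : rate_tail = l * Num.sqrt l * moment_scale * mesh_ratio.
Proof.
rewrite /rate_tail delta_half powRB ?(gt_eqF nR) ?implybT// powR12_sqrt ?(ltW nR)//.
rewrite -/moment_scale mesh_ratioE (_ : 3 / 2 = 1 + 2^-1); last by field.
rewrite powRD ?(gt_eqF l0) ?implybT// powRr1 ?(ltW l0)// powR12_sqrt ?(ltW l0)//.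
have s1 : 0 < Num.sqrt N%:R :> R by rewrite sqrtr_gt0.
have s2 : 0 < Num.sqrt n%:R :> R by rewrite sqrtr_gt0.
have s3 : 0 < moment_scale by rewrite powR_gt0.
by field; rewrite !gt_eqF.
Qed.

Lemma rate_lindeberg_cube : rate_lindeberg ^+ 3 = l ^+ 3 * mesh_ratio.
Proof.
rewrite /rate_lindeberg exprMn exprVn exprMn -!(powR_mulrn 3) ?powR_ge0//.
rewrite -!powRrM (_ : p%:R / 6 * 3%:R = p%:R / 2); last by field.
rewrite delta_half (_ : 6^-1 * 3%:R = 2^-1); last by field.
rewrite powR12_sqrt ?(ltW nR)// mesh_ratioE powR_mulrn ?(ltW l0)//.
  by rewrite invfM invrK.
exact: ltW.
Qed.

Lemma rate_lindeberg_ge0 : 0 <= rate_lindeberg.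
Proof. by rewrite divr_ge0 ?mulr_ge0 ?powR_ge0// ltW. Qed.

Lemma rate_tail_gt0 : 0 < rate_tail.
Proof. by rewrite divr_gt0 ?mulr_gt0 ?powR_gt0. Qed.

Lemma moment_scale_gt0 : 0 < moment_scale.
Proof. by rewrite powR_gt0. Qed.

Lemma moment_scale_powR : moment_scale `^ nu = n%:R.
Proof. by rewrite -powRrM mulVf ?gt_eqF// powRr1// ltW. Qed.

Lemma moment_scale_log : l <= nu * moment_scale.
Proof.
rewrite -{1}moment_scale_powR ln_powR ler_wpM2l ?(ltW nu_gt0)//.
exact/ltW/ln_sublinear/moment_scale_gt0.
Qed.

End rate.

(** The left side is n^(-3/2) P^(-1/2), decreasing in P, so a lower bound on the cell probability
    suffices. *)
Lemma inv_cube_le (R : realType) (n N : nat) (cX P : R) : (0 < n)%N -> (0 < N)%N -> 0 < cX ->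
  cX / N%:R <= P ->
  P / (Num.sqrt n%:R * Num.sqrt P) ^+ 3 <=
  (Num.sqrt cX)^-1 * (Num.sqrt (N%:R / n%:R) / n%:R).
Proof.
move=> n0 N0 c0 cP; have nR : 0 < n%:R :> R by rewrite ltr0n.
have NR : 0 < N%:R :> R by rewrite ltr0n.
have P0 : 0 < P by apply: lt_le_trans cP; exact: divr_gt0.
have sP : 0 < Num.sqrt P by rewrite sqrtr_gt0.
have sn : 0 < Num.sqrt n%:R :> R by rewrite sqrtr_gt0.
have sN : 0 < Num.sqrt N%:R :> R by rewrite sqrtr_gt0.
have sc : 0 < Num.sqrt cX by rewrite sqrtr_gt0.
have h : Num.sqrt cX / Num.sqrt N%:R <= Num.sqrt P.
  by rewrite -(sqrtrV (ltW NR)) -(sqrtrM _ (ltW c0)) ler_wsqrtr.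
rewrite sqrtrM ?(ltW NR)// sqrtrV ?(ltW nR)//.
have PE := sqr_sqrtr (ltW P0); have nE := sqr_sqrtr (ltW nR).
set y := Num.sqrt P in sP h PE *; set m := Num.sqrt n%:R in sn nE *.
have -> : P / (m * y) ^+ 3 = m ^- 3 * y^-1 by rewrite -PE; field; rewrite !gt_eqF.
have -> : (Num.sqrt cX)^-1 * (Num.sqrt N%:R / m / n%:R) = m ^- 3 * (Num.sqrt cX / Num.sqrt N%:R)^-1.
  by rewrite -nE; field; rewrite !gt_eqF.
apply: ler_wpM2l; first by rewrite invr_ge0 exprn_ge0// ltW.
by rewrite lef_pV2 ?posrE// divr_gt0.
Qed.

(** * Probability of steps too large to be expanded *)

Section tails.
Variables (R : realType) (nu : R) (n : nat).
Hypotheses (nu_ge4 : 4 <= nu) (n_gt1 : (1 < n)%N) (l_ge1 : 1 <= ln (n%:R : R)).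
Notation l := (ln (n%:R : R)).

(** At this level Markov's inequality of order [nu] leaves a multiple of 1 / (l^2 n), because
    [nu >= 4] and [l >= 1] give sqrt(l)^nu >= l^2. *)
Definition truncation : R := Num.sqrt l * moment_scale n nu.

Let nu0 : 0 < nu. Proof. by have := nu_ge4; lra. Qed.

Lemma truncation_ge1 : 1 <= truncation.
Proof.
rewrite -[leLHS]mulr1 ler_pM//; first by rewrite -[leLHS]sqrtr1 ler_wsqrtr.
rewrite /moment_scale -[leLHS](powRr0 (n%:R : R)) ler_powR ?invr_ge0 ?(ltW nu0)//.
by rewrite ler1n ltnW.
Qed.

Lemma truncation_powR : l ^+ 2 * n%:R <= truncation `^ nu.
Proof.
have l0 : 0 <= l by rewrite (le_trans _ l_ge1).
rewrite powRM ?sqrtr_ge0 ?powR_ge0// moment_scale_powR//.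
rewrite ler_wpM2r ?ler0n// -powR12_sqrt// -powRrM -powR_mulrn//.
by apply: ler_powR => //; have := nu_ge4; lra.
Qed.

Lemma truncation_pow (m : nat) : nu <= m%:R -> l ^+ 2 * n%:R <= truncation ^+ m.
Proof.
move=> num; apply: (le_trans truncation_powR); rewrite -powR_mulrn.
  by apply: ler_powR => //; exact: truncation_ge1.
exact: le_trans truncation_ge1.
Qed.

(** The exponential tail is traded for a power, exp(-t) <= m! / t^m with an integer [m >= nu], so
    that the Gaussian jump obeys a bound of the same form as the data. *)
Lemma gaussian_truncation (c : R) (m : nat) : 0 < c -> nu <= m%:R ->
  fine (@std_normal R [set x | (c * truncation < `|x|)%R]) <=
  2 * expR 2^-1 * m`!%:R / c ^+ m / (l ^+ 2 * n%:R).
Proof.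
move=> c0 num; set t := c * truncation.
have n0 : 0 < n%:R :> R by rewrite ltr0n ltnW.
have l0 : 0 < l by exact: lt_le_trans l_ge1.
have t0 : 0 < t by rewrite mulr_gt0// (lt_le_trans _ truncation_ge1).
have mA : measurable [set x : RR R | (t < `|x|)%R].
  by apply: measurable_lt_set => //; exact: normr_measurable.
rewrite -lee_fin fineK ?fin_num_measure//; apply: le_trans (std_normal_tail t) _.
have h1 := expR_ge_pow m (ltW t0).
have h2 : c ^+ m * (l ^+ 2 * n%:R) <= t ^+ m.
  by rewrite exprMn ler_wpM2l ?exprn_ge0 ?(ltW c0)// truncation_pow.
have D0 : 0 < c ^+ m * (l ^+ 2 * n%:R) by rewrite !mulr_gt0 ?exprn_gt0.
have h3 : expR (- t) <= m`!%:R / (c ^+ m * (l ^+ 2 * n%:R)).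
  rewrite expRN ler_pdivlMr// ler_pdivrMl ?expR_gt0//; apply: (le_trans h2).
  by rewrite (mulrC (expR t)).
have -> : 2 * expR 2^-1 * m`!%:R / c ^+ m / (l ^+ 2 * n%:R) =
    2 * expR 2^-1 * (m`!%:R / (c ^+ m * (l ^+ 2 * n%:R))) by rewrite [in RHS]invfM; ring.
by rewrite lee_fin ler_wpM2l// mulr_ge0 ?expR_ge0.
Qed.

End tails.

Section moment_tail.
Context d (T : measurableType d) (R : realType) (P : probability T R).
Variables (eps : T -> R) (nu : R).
Hypotheses (meps : measurable_fun setT eps) (nu_gt0 : 0 < nu)
  (Hnu : ('E_P[fun w => (`|eps w| `^ nu)%R] < +oo)%E).

Definition abs_moment : R := \int[P]_w (`|eps w| `^ nu).

Lemma measurable_abs_pow : measurable_fun setT (fun w => `|eps w| `^ nu).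
Proof.
have mn : measurable_fun setT (fun w => `|eps w|).
  exact: (measurableT_comp (@normr_measurable R setT) meps).
exact: (measurableT_comp (measurable_powR nu) mn).
Qed.

Lemma integrable_abs_pow : P.-integrable setT (EFin \o (fun w => `|eps w| `^ nu)).
Proof.
apply/integrableP; split; first exact/measurable_EFinP/measurable_abs_pow.
move: Hnu; rewrite unlock; apply: le_lt_trans.
rewrite le_eqVlt; apply/orP; left; apply/eqP; apply: eq_integral => w _ /=.
by rewrite ger0_norm// powR_ge0.
Qed.

Lemma abs_moment_ge0 : 0 <= abs_moment.
Proof. by apply: Rintegral_ge0 => w _; exact: powR_ge0. Qed.

Lemma moment_tail (t : R) : 0 < t -> fine (P [set w | t < `|eps w|]) <= abs_moment / t `^ nu.
Proof.
move=> t0; have tn0 : 0 < t `^ nu by rewrite powR_gt0.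
have mA : measurable [set w | t < `|eps w|].
  apply: measurable_lt_set => //.
  exact: (measurableT_comp (@normr_measurable R setT) meps).
rewrite -Rintegral_indic// mulrC -RintegralZl//; last exact: integrable_abs_pow.
apply: le_Rintegral => //.
- apply: (@bounded_integrable _ _ _ P _ 1); first exact: measurable_indic.
  by move=> w; rewrite indicE; case: (_ \in _); rewrite ?normr1 ?normr0.
- exact/integrableZlR/integrable_abs_pow.
move=> w _; rewrite indicE; case: (boolP (w \in _)) => [/set_mem /= h|_].
  by rewrite ler_pdivlMl// mulr1 ge0_ler_powR ?nnegrE ?(ltW t0) ?(ltW h) ?(ltW nu_gt0).
by rewrite mulr_ge0 ?invr_ge0 ?(ltW tn0)// powR_ge0.
Qed.

End moment_tail.

(** * Coupling at a fixed sample size *)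

Section stat_coupling.
Context (R : realType) (p : nat) d (T : measurableType d) (P : probability T R).
Variables (X : T -> p.-tuple R) (eps : T -> R).
Hypotheses (mX : measurable_fun setT X) (meps : measurable_fun setT eps)
  (Xcube : forall w, cube (X w)).
Variables (fX sig2 g3 : p.-tuple R -> R) (cX CX cs Cs M3 nu B : R).
Hypotheses (fX_ge0 : forall x, 0 <= fX x)
  (fXE : forall B : set (p.-tuple R), measurable B ->
     P (X @^-1` B) = iint (fun x => (fX x * \1_B x)%:E))
  (cX_gt0 : 0 < cX) (fX_bnd : forall x, cube x -> cX <= fX x <= CX)
  (mean0 : cond_exp P X eps (fun _ => 0)) (var : cond_var P X eps sig2)
  (cs_gt0 : 0 < cs) (sig2_bnd : forall x, cube x -> cs <= sig2 x <= Cs)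
  (abs3 : cond_exp P X (fun w => `|eps w| ^+ 3) g3) (g3_le : forall x, cube x -> g3 x <= M3)
  (M3_ge0 : 0 <= M3) (nu_ge4 : 4 <= nu)
  (Hnu : ('E_P[fun w => (`|eps w| `^ nu)%R] < +oo)%E) (B_ge0 : 0 <= B).

Let gabs3 : R := \int[@std_normal R]_x (`|x| ^+ 3).
Let m := (Num.truncn nu).+1.

(** The constants for the data and for the Gaussian jump are added, here and in [tail_cst], so that
    one number bounds both. *)
Definition third_cst : R := (M3 / Num.sqrt cs ^+ 3 + gabs3) / Num.sqrt cX.
Definition tail_cst : R :=
  abs_moment P eps nu / (Num.sqrt cs * Num.sqrt cX) `^ nu +
  2 * expR 2^-1 * m`!%:R / Num.sqrt cX ^+ m.
Definition deviation_cst : R := error_cst third_cst tail_cst B cX nu + 1.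

Variables (k' n : nat).
Notation k := k'.+1.
Notation N := (k ^ p)%N.
Notation l := (ln (n%:R : R)).
Notation L := (fun w => cell_label k' (X w)).
Notation xi := (cell_step P X eps k' n).
Notation prob := (cell_prob P X k').
Hypotheses (n_gt1 : (1 < n)%N) (l_ge1 : 1 <= l) (lnN : ln (N%:R : R) <= B * l).

Let n_gt0 : (0 < n)%N. Proof. exact: ltnW. Qed.
Let nR : 0 < n%:R :> R. Proof. by rewrite ltr0n. Qed.
Let N_gt0 : (0 < N)%N. Proof. by rewrite expn_gt0. Qed.
Let NR : 0 < N%:R :> R. Proof. by rewrite ltr0n. Qed.
Let nu_gt0 : 0 < nu. Proof. by have := nu_ge4; lra. Qed.
Let l0 : 0 < l. Proof. exact: lt_le_trans l_ge1. Qed.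
Let sc0 : 0 < Num.sqrt cX. Proof. by rewrite sqrtr_gt0. Qed.
Let ss0 : 0 < Num.sqrt cs. Proof. by rewrite sqrtr_gt0. Qed.
Let sn0 : 0 < Num.sqrt n%:R :> R. Proof. by rewrite sqrtr_gt0. Qed.
Let nu_m : nu <= m%:R. Proof. exact/ltW/truncnS_gt. Qed.

Let h := mesh_ratio R p k n.
Let r := rate_tail p k n nu + rate_lindeberg R p k n.
Let q := truncation nu n.
Let h0 : 0 < h. Proof. exact: mesh_ratio_gt0. Qed.

Let prob_ge c : (c < N)%N -> cX / N%:R <= prob c.
Proof. exact: (cell_prob_ge mX Xcube fX_ge0 fXE cX_gt0 fX_bnd). Qed.

Let prob_gt0 c : (c < N)%N -> 0 < prob c.
Proof. exact: (cell_prob_gt0 mX Xcube fX_ge0 fXE cX_gt0 fX_bnd). Qed.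

Let var_gt0 c : (c < N)%N -> 0 < cell_var P X eps k' c.
Proof.
exact: (cell_var_gt0 mX meps Xcube fX_ge0 fXE cX_gt0 fX_bnd mean0 var cs_gt0 sig2_bnd).
Qed.

Let sd_ge c : (c < N)%N ->
  Num.sqrt cs * Num.sqrt (prob c) <= Num.sqrt (cell_var P X eps k' c).
Proof.
move=> cN; rewrite -sqrtrM ?(ltW cs_gt0)// ler_wsqrtr//.
exact: (cell_var_ge mX meps Xcube mean0 var sig2_bnd).
Qed.

Let gabs3_ge0 : 0 <= gabs3.
Proof. by apply: Rintegral_ge0 => x _; exact: exprn_ge0. Qed.

Let third_ge0 : 0 <= third_cst.
Proof.
apply: divr_ge0; last exact: ltW.
by apply: addr_ge0 => //; apply: divr_ge0 => //; exact/exprn_ge0/ltW.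
Qed.

Let tail_ge0 : 0 <= tail_cst.
Proof.
apply: addr_ge0; first by apply: divr_ge0; [exact: abs_moment_ge0|exact: powR_ge0].
apply: divr_ge0; last exact/exprn_ge0/ltW.
by apply: mulr_ge0; [apply: mulr_ge0 => //; exact: expR_ge0|exact: ler0n].
Qed.

Let r_gt0 : 0 < r.
Proof. by apply: ltr_pwDl; [exact: rate_tail_gt0|exact: rate_lindeberg_ge0]. Qed.

Let r_ge : l * Num.sqrt l * moment_scale n nu * h <= r.
Proof. by rewrite -rate_tailE// lerDl; exact: rate_lindeberg_ge0. Qed.

Let r3_ge : l ^+ 3 * h <= r ^+ 3.
Proof.
rewrite -rate_lindeberg_cube//; apply: lerXn2r.
- by rewrite nnegrE; exact: rate_lindeberg_ge0.
- by rewrite nnegrE ltW.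
- by rewrite lerDr ltW// rate_tail_gt0.
Qed.

(** The standard deviation of the Gaussian jump, with p_c a_c^2 = 1 / n as for an observation; the
    value 1 beyond the last label keeps [a] positive everywhere. *)
Let a (c : nat) : R := if (c < N)%N then (Num.sqrt n%:R * Num.sqrt (prob c))^-1 else 1.

Let a_gt0 c : 0 < a c.
Proof.
rewrite /a; case: ltnP => // cN; rewrite invr_gt0 mulr_gt0// sqrtr_gt0.
exact: prob_gt0.
Qed.

Let aE c : (c < N)%N -> a c ^+ 2 = (n%:R * prob c)^-1.
Proof.
move=> cN; rewrite /a cN exprVn exprMn (sqr_sqrtr (ltW nR)) sqr_sqrtr//.
exact/ltW/prob_gt0.
Qed.

Let third c : (c < N)%N -> cellabs3 P L xi c <= third_cst * (h / n%:R).
Proof.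
move=> cN; have p0 := prob_gt0 cN; have v0 := var_gt0 cN; have sv := sd_ge cN.
apply: le_trans (step_abs3 mX meps Xcube fX_ge0 fXE cX_gt0 fX_bnd mean0 var cs_gt0 sig2_bnd
  abs3 g3_le n_gt0 cN) _.
have sp0 : 0 < Num.sqrt (prob c) by rewrite sqrtr_gt0.
apply: (@le_trans _ _ (M3 * prob c / (Num.sqrt n%:R * (Num.sqrt cs * Num.sqrt (prob c))) ^+ 3)).
  apply: ler_wpM2l; first by rewrite mulr_ge0// ltW.
  rewrite lef_pV2 ?posrE ?exprn_gt0 ?mulr_gt0 ?sqrtr_gt0//.
  apply: lerXn2r; rewrite ?nnegrE ?mulr_ge0 ?sqrtr_ge0//.
  by apply: ler_wpM2l => //; exact: ltW.
have -> : M3 * prob c / (Num.sqrt n%:R * (Num.sqrt cs * Num.sqrt (prob c))) ^+ 3 =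
    M3 / Num.sqrt cs ^+ 3 * (prob c / (Num.sqrt n%:R * Num.sqrt (prob c)) ^+ 3).
  by field; rewrite !gt_eqF.
apply: (@le_trans _ _ (M3 / Num.sqrt cs ^+ 3 * ((Num.sqrt cX)^-1 * (h / n%:R)))).
  apply: ler_wpM2l; first by apply: divr_ge0 => //; exact/exprn_ge0/ltW.
  exact: inv_cube_le (prob_ge cN).
have -> : third_cst * (h / n%:R) = M3 / Num.sqrt cs ^+ 3 * ((Num.sqrt cX)^-1 * (h / n%:R)) +
    gabs3 * ((Num.sqrt cX)^-1 * (h / n%:R)) by rewrite /third_cst; ring.
rewrite lerDl.
by rewrite !mulr_ge0 ?invr_ge0 ?(ltW sc0) ?(ltW h0) ?(ltW nR).
Qed.

Let gauss_third c : (c < N)%N ->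
  prob c * (a c ^+ 3 * \int[@std_normal R]_x (`|x| ^+ 3)) <= third_cst * (h / n%:R).
Proof.
move=> cN; have p0 := prob_gt0 cN; rewrite -/gabs3 /a cN exprVn.
rewrite mulrA mulrC.
apply: (@le_trans _ _ (gabs3 * ((Num.sqrt cX)^-1 * (h / n%:R)))).
  by apply: ler_wpM2l => //; exact: inv_cube_le (prob_ge cN).
have -> : third_cst * (h / n%:R) = M3 / Num.sqrt cs ^+ 3 * ((Num.sqrt cX)^-1 * (h / n%:R)) +
    gabs3 * ((Num.sqrt cX)^-1 * (h / n%:R)) by rewrite /third_cst; ring.
rewrite lerDr.
have x0 : 0 <= M3 / Num.sqrt cs ^+ 3 by apply: divr_ge0 => //; exact/exprn_ge0/ltW.
by rewrite !mulr_ge0 ?invr_ge0 ?(ltW sc0) ?(ltW h0) ?(ltW nR).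
Qed.

(** The first term of the rate enters here: by [l * q * h <= r], a step beyond 1 / beta forces the
    unscaled variable beyond a constant times the truncation level [q]. *)
Let beta_scale (x s : R) : 0 <= s -> s * Num.sqrt cX / h <= x -> s * Num.sqrt cX * q * (l / r) <= x.
Proof.
move=> s0; apply: le_trans; rewrite -(mulrA (s * Num.sqrt cX) q).
apply: ler_wpM2l; first by rewrite mulr_ge0// ltW.
rewrite mulrA ler_pdivrMr// ler_pdivlMl//; apply: le_trans r_ge.
by rewrite /q /truncation le_eqVlt; apply/orP; left; apply/eqP; ring.
Qed.

Let prob_scale c : (c < N)%N -> Num.sqrt cX / h <= Num.sqrt n%:R * Num.sqrt (prob c).
Proof.
move=> cN; have sN : 0 < Num.sqrt N%:R :> R by rewrite sqrtr_gt0.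
have -> : Num.sqrt cX / h = Num.sqrt n%:R * Num.sqrt (cX / N%:R).
  rewrite /h mesh_ratioE// (sqrtrM _ (ltW cX_gt0)) (sqrtrV (ltW NR)).
  by field; rewrite !gt_eqF.
by apply: ler_wpM2l; [exact: ltW|rewrite ler_wsqrtr// prob_ge].
Qed.

Let beta_gt0 : 0 < l / r. Proof. exact: divr_gt0. Qed.
Let q0 : 0 < q. Proof. by apply: lt_le_trans (truncation_ge1 _ _ _). Qed.

Let tail_xi : fine (P [set w | (1 < `|l / r * xi w|)%R]) <= tail_cst / (l ^+ 2 * n%:R).
Proof.
set c0 := Num.sqrt cs * Num.sqrt cX; have c00 : 0 < c0 by exact: mulr_gt0.
have t0 : 0 < c0 * q by exact: mulr_gt0.
have D0 : 0 < l ^+ 2 * n%:R by rewrite mulr_gt0// exprn_gt0.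
apply: (@le_trans _ _ (fine (P [set w | c0 * q < `|eps w|]))).
  apply: fine_le; rewrite ?fin_num_measure//.
  - apply: measurable_lt_set => //; apply: (measurableT_comp (@normr_measurable R setT)).
    by apply: measurable_funM => //; exact: measurable_step.
  - by apply: measurable_lt_set => //; exact: (measurableT_comp (@normr_measurable R setT) meps).
  apply: le_measure; rewrite ?inE.
  - apply: measurable_lt_set => //; apply: (measurableT_comp (@normr_measurable R setT)).
    by apply: measurable_funM => //; exact: measurable_step.
  - by apply: measurable_lt_set => //; exact: (measurableT_comp (@normr_measurable R setT) meps).
  move=> w /=; rewrite /cell_step; set c := cell_label k' (X w).
  have cN : (c < N)%N by exact: cell_label_lt.
  have v0 := var_gt0 cN; have sv := sd_ge cN.
  set D := Num.sqrt n%:R * Num.sqrt (cell_var P X eps k' c).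
  have D1 : 0 < D by rewrite mulr_gt0// sqrtr_gt0.
  rewrite normrM (gtr0_norm beta_gt0) normrM normfV (gtr0_norm D1) mulrA ltr_pdivlMr// mul1r.
  move=> hD; have scale : c0 * q * (l / r) <= D.
    apply: beta_scale; first exact: ltW.
    apply: (@le_trans _ _ (Num.sqrt n%:R * (Num.sqrt cs * Num.sqrt (prob c)))); last first.
      by apply: ler_wpM2l => //; exact: ltW.
    rewrite -mulrA [leRHS]mulrCA; apply: ler_wpM2l; first exact: ltW.
    exact: prob_scale.
  by have := le_lt_trans scale hD; rewrite mulrC ltr_pM2l.
apply: (le_trans (moment_tail meps nu_gt0 Hnu t0)).
apply: (@le_trans _ _ (abs_moment P eps nu / c0 `^ nu / (l ^+ 2 * n%:R))).
  rewrite -mulrA; apply: ler_wpM2l; first exact: abs_moment_ge0.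
  rewrite -invfM lef_pV2 ?posrE ?powR_gt0 ?mulr_gt0 ?powR_gt0 ?sqrtr_gt0//.
  rewrite (@powRM _ c0 q nu (ltW c00) (ltW q0)); apply: ler_wpM2l; first exact: powR_ge0.
  exact: truncation_powR.
apply: ler_wpM2r; first by rewrite invr_ge0 ltW.
rewrite /tail_cst lerDl; apply: divr_ge0; last exact/exprn_ge0/ltW.
by apply: mulr_ge0; [apply: mulr_ge0 => //; exact: expR_ge0|exact: ler0n].
Qed.

Let tail_gauss c : (c < N)%N ->
  fine (@std_normal R [set x | (1 < `|l / r * (a c * x)|)%R]) <= tail_cst / (l ^+ 2 * n%:R).
Proof.
move=> cN; have D0 : 0 < l ^+ 2 * n%:R by rewrite mulr_gt0// exprn_gt0.
have mm t : measurable [set x : RR R | (t < `|x|)%R].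
  by apply: measurable_lt_set => //; exact: normr_measurable.
have mb : measurable [set x : RR R | (1 < `|l / r * (a c * x)|)%R].
  apply: measurable_lt_set => //; apply: (measurableT_comp (@normr_measurable R setT)).
  by apply: measurable_funM => //; exact: measurable_funM.
apply: (@le_trans _ _ (fine (@std_normal R [set x | (Num.sqrt cX * q < `|x|)%R]))).
  apply: fine_le; rewrite ?fin_num_measure//.
  apply: le_measure; rewrite ?inE//.
  move=> x /=; rewrite /a cN; set D := Num.sqrt n%:R * Num.sqrt (prob c).
  have D1 : 0 < D by rewrite mulr_gt0// sqrtr_gt0 prob_gt0.
  rewrite normrM (gtr0_norm beta_gt0) normrM normfV (gtr0_norm D1) (mulrC D^-1) mulrA.
  rewrite ltr_pdivlMr// mul1r => hD; have scale : Num.sqrt cX * q * (l / r) <= D.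
    rewrite -[Num.sqrt cX]mul1r; apply: beta_scale => //; rewrite mul1r; exact: prob_scale.
  by have := le_lt_trans scale hD; rewrite mulrC ltr_pM2l.
apply: (le_trans (gaussian_truncation nu_ge4 n_gt1 l_ge1 sc0 nu_m)).
apply: ler_wpM2r; first by rewrite invr_ge0 ltW.
by rewrite /tail_cst lerDr; apply: divr_ge0; [exact: abs_moment_ge0|exact: powR_ge0].
Qed.

Let dist J : \sum_(j < J.+1)
    `|\int[seq_measure P]_t hat J j (smax N (l / r) l^-1 (walk L xi n t (fun=> 0)))
      - \int[gauss_seq R]_z hat J j (smax N (l / r) l^-1 z)| <=
  error_cst third_cst tail_cst B cX nu / l.
Proof.
have lV1 : l^-1 <= 1 by rewrite invf_le1.
have k0 : 0 <= third_cst * (h / n%:R) by rewrite mulr_ge0// divr_ge0 ?(ltW h0)// ltW.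
have u0 : 0 < Num.sqrt ((B + 1) / cX * l) * h.
  by rewrite mulr_gt0// sqrtr_gt0 mulr_gt0// divr_gt0//; have := B_ge0; lra.
have mom1 c : (c < N)%N -> cellmoment P L xi 1 c = 0 by exact: (step_mean mX meps Xcube mean0 abs3).
have mom2 c : (c < N)%N -> cellmoment P L xi 2 c = prob c * a c ^+ 2.
  move=> cN; rewrite aE// (step_var mX meps Xcube fX_ge0 fXE cX_gt0 fX_bnd mean0 var cs_gt0
    sig2_bnd abs3 n cN) invfM mulrCA mulfV ?mulr1// gt_eqF//; exact: prob_gt0.
have err := class_error_le N_gt0 n_gt0 l_ge1 h0 (mesh_ratio_sqr R p k n)
  (moment_scale_gt0 nu n_gt1) (moment_scale_log n_gt1 nu_gt0) r_gt0 r_ge r3_ge lnN B_ge0 cX_gt0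
  third_ge0 tail_ge0.
apply: le_trans err.
exact: (class_distance J N_gt0 n_gt0 (measurable_label mX Xcube k')
  (measurable_step P mX meps Xcube k' n) (label_lt X k')
  (integrable_step3 mX meps Xcube abs3 k' n) beta_gt0 (ltW (etrans (invr_gt0 l) l0)) lV1 k0
  (cell_prob_ge0 P X k') (cell_prob_sum P mX Xcube k') prob_gt0 a_gt0 aE mom1 mom2 third
  gauss_third tail_xi tail_gauss u0 prob_ge).
Qed.

Let radius_le : coupling_radius N (l / r) l^-1 <= (6 + 2 * B) * r.
Proof.
have l1 := l_ge1; have N1 : 1 <= N%:R :> R by rewrite ler1n.
have -> : coupling_radius N (l / r) l^-1 = 4 * r + 2 * r * (ln (2 * N%:R) / l).
  by rewrite /coupling_radius; field; rewrite !gt_eqF.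
have -> : (6 + 2 * B) * r = 4 * r + 2 * r * (1 + B) by ring.
rewrite lerD2l; apply: ler_wpM2l; first by rewrite mulr_ge0// ltW.
rewrite ler_pdivrMr// lnM ?posrE// mulrDl mul1r; apply: lerD => //.
apply: le_trans l1; rewrite (_ : 2 = 1 + 1 :> R)//; exact: le_ln1Dx.
Qed.

Theorem stat_coupling :
  exists S : (seqspace T * seqspace (RR R)) * RR R -> R,
  [/\ measurable_fun setT S,
      forall A : set (RR R), measurable A ->
        ((seq_measure P \x gauss_seq R) \x unif R)%E (S @^-1` A) =
        gauss_seq R ((maxabs N : seqspace (RR R) -> R) @^-1` A) &
      forall b, 2 * ((6 + 2 * B) * r) <= b ->
      (((seq_measure P \x gauss_seq R) \x unif R)
         [set w : (seqspace T * seqspace (RR R)) * RR R | (b <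
            `|stat P X sig2 (fun j w => X (w.1.1 j)) (fun j w => eps (w.1.1 j)) k n w - S w|)%R]
        <= (deviation_cst / l)%:E)%E].
Proof.
have [S [mS lawS closeS]] := finite_coupling N_gt0 (measurable_label mX Xcube k')
  (measurable_step P mX meps Xcube k' n) beta_gt0 (etrans (invr_gt0 l) l0)
  (etrans (invr_gt0 l) l0) dist.
exists S; split => // b hb.
have -> : deviation_cst / l = error_cst third_cst tail_cst B cX nu / l + l^-1.
  by rewrite /deviation_cst mulrDl mul1r.
apply: le_trans closeS; set U := ((seqspace T * seqspace (RR R)) * RR R)%type.
have mW : measurable_fun setT (fun w : U => maxabs N (walk L xi n w.1.1 (fun=> 0))).
  apply: (measurableT_comp (measurable_maxabs N)).
  apply: (@measurable_walk _ T R L xi (measurable_label mX Xcube k')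
    (measurable_step P mX meps Xcube k' n) n _ U (fun w => w.1.1) (fun=> (fun=> 0))) => //.
  exact: (measurableT_comp measurable_fst measurable_fst).
have mD t : measurable [set w : U | (t < `|S w - maxabs N (walk L xi n w.1.1 (fun=> 0))|)%R].
  apply: measurable_lt_set => //; apply: (measurableT_comp (@normr_measurable R setT)).
  exact: measurable_funB.
have statE (w : U) := stat_maxabs mX meps Xcube fX_ge0 fXE cX_gt0 fX_bnd mean0 var cs_gt0 sig2_bnd
  k' n_gt0 (fun w : U => w.1.1) w.
have -> : [set w : U | (b <
    `|stat P X sig2 (fun j w => X (w.1.1 j)) (fun j w => eps (w.1.1 j)) k n w - S w|)%R] =
    [set w : U | (b < `|S w - maxabs N (walk L xi n w.1.1 (fun=> 0))|)%R].
  by apply/seteqP; split => w /=; rewrite statE distrC.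
apply: le_measure; rewrite ?inE//.
move=> w /=; apply: le_lt_trans; apply: le_trans hb; apply: ler_wpM2l => //; exact: radius_le.
Qed.

End stat_coupling.

Theorem theorem2 (R : realType) (p : nat)
  (d : measure_display) (T : measurableType d) (P : probability T R)
  (X : T -> p.-tuple R) (eps : T -> R)
  (mX : measurable_fun setT X) (meps : measurable_fun setT eps)
  (HXcube : forall w, cube (X w))
  (* density of X *)
  (fX : p.-tuple R -> R) (cX CX : R)
  (mfX : measurable_fun setT fX) (fX_ge0 : forall x, 0 <= fX x)
  (HfX : forall B : set (p.-tuple R), measurable B ->
     P (X @^-1` B) = iint (fun x => (fX x * \1_B x)%:E))
  (cX_gt0 : 0 < cX) (fX_bnd : forall x, cube x -> cX <= fX x <= CX)
  (* E[eps | X] = 0 *)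
  (Hmean : cond_exp P X eps (fun _ => 0))
  (* conditional variance *)
  (sig2 : p.-tuple R -> R) (cs Cs : R)
  (Hsig2 : cond_var P X eps sig2)
  (cs_gt0 : 0 < cs) (sig2_bnd : forall x, cube x -> cs <= sig2 x <= Cs)
  (* delta_n = 1 / k n *)
  (k : nat -> nat) (k_gt0 : forall n, (0 < k n)%N)
  (delta_cvg : (fun n => delta R (k n)) @ \oo --> (0 : R))
  (Hlog : exists C : R, exists N : nat, forall n, (N <= n)%N ->
     ln ((k n)%:R : R) <= C * ln (n%:R : R))
  (* moments *)
  (H3 : exists g : p.-tuple R -> R, exists M : R,
     cond_exp P X (fun w => `|eps w| ^+ 3) g /\ forall x, cube x -> g x <= M)
  (nu : R) (nu_ge4 : 4 <= nu)
  (Hnu : ('E_P[fun w => (`|eps w| `^ nu)%R] < +oo)%E) :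
  exists (d' : measure_display) (T' : measurableType d') (P' : probability T' R)
    (Xs : nat -> T' -> p.-tuple R) (es : nat -> T' -> R)
    (Z : nat -> T' -> R) (S : nat -> T' -> R),
    [/\ (* (Xs_i, es_i)_i are independent copies of (X, eps) *)
        (forall i, measurable_fun setT (Xs i) /\ measurable_fun setT (es i)) /\
        mutually_independent P' (fun i w => (Xs i w, es i w)),
        (forall i (B : set (p.-tuple R * R)%type), measurable B ->
           P' ((fun w => (Xs i w, es i w)) @^-1` B) =
           P ((fun w => (X w, eps w)) @^-1` B)),
        (* (Z_j)_j independent standard normal *)
        (forall j, measurable_fun setT (Z j)) /\ mutually_independent P' Z /\
        (forall j (B : set R), measurable B ->
           P' (Z j @^-1` B) = normal_prob 0 1 B),
        (* S_n =d max_{j <= delta_n^{-p}} |Z_j| *)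
        (forall n, measurable_fun setT (S n)) /\
        (forall n (B : set R), measurable B ->
           P' (S n @^-1` B) =
           P' ((fun w => \big[Order.max/0]_(j < (k n) ^ p) `|Z j w|) @^-1` B)) &
        is_OP P'
          (fun n w => `|stat P X sig2 Xs es (k n) n w - S n w|)
          (rate p nu k)].

Proof.
have [g3 [M3 [abs3 g3_le]]] := H3.
have [C [N0 lnk]] := Hlog.
have g3_le' x : cube x -> g3 x <= `|M3|.
  by move=> cx; apply: le_trans (g3_le x cx) (ler_norm _).
(* ln (k^p) = p ln k <= p |C| ln n. *)
pose B : R := p%:R * `|C|.
have B0 : 0 <= B by rewrite mulr_ge0.
pose D := deviation_cst P eps cX cs `|M3| nu B.
(* The factors carry the data, the Gaussian sequence and one uniform variable. The same uniform
   variable serves all [n], since for each [n] only the joint law of the data and [S n] matters. *)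
pose U := ((seqspace T * seqspace (RR R)) * RR R)%type.
pose P' : probability U R := ((seq_measure P \x gauss_seq R) \x unif R)%E.
have data_law (A : set (seqspace T)) : measurable A ->
    P' ((fun w : U => w.1.1) @^-1` A) = seq_measure P A.
  move=> mA; rewrite -[RHS](fst_law (seq_measure P) (gauss_seq R) mA).
  by rewrite -[RHS](fst_law _ (unif R))// -[X in measurable X]setTI; exact: measurable_fst.
have gauss_law (A : set (seqspace (RR R))) : measurable A ->
    P' ((fun w : U => w.1.2) @^-1` A) = gauss_seq R A.
  move=> mA; rewrite -[RHS](snd_law (seq_measure P) (gauss_seq R) mA).
  by rewrite -[RHS](fst_law _ (unif R))// -[X in measurable X]setTI; exact: measurable_snd.
have mdata : measurable_fun setT (fun w : U => w.1.1).
  exact: (measurableT_comp measurable_fst measurable_fst).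
have mgauss : measurable_fun setT (fun w : U => w.1.2).
  exact: (measurableT_comp measurable_snd measurable_fst).
pose Xs (i : nat) (w : U) := X (w.1.1 i).
pose es (i : nat) (w : U) := eps (w.1.1 i).
pose Z (j : nat) (w : U) : R := w.1.2 j.
have mcoord i : measurable_fun setT (fun w : U => w.1.1 i).
  exact: (measurableT_comp (@measurable_coord _ T i) mdata).
have mpair : measurable_fun setT (fun t => (X t, eps t)) by exact: measurable_fun_pair.
have ex n : exists S : U -> R, [/\ measurable_fun setT S,
    forall A : set (RR R), measurable A ->
      P' (S @^-1` A) = gauss_seq R ((maxabs (k n ^ p) : seqspace (RR R) -> R) @^-1` A) &
    (N0 <= n)%N -> (1 < n)%N -> 1 <= ln (n%:R : R) ->
      forall b, 2 * ((6 + 2 * B) * (rate_tail p (k n) n nu + rate_lindeberg R p (k n) n)) <= b ->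
      (P' [set w | (b < `|stat P X sig2 Xs es (k n) n w - S w|)%R] <= (D / ln n%:R)%:E)%E].
  (* For the finitely many other [n] only the law matters, and [S n] is the maximum of the [|Z j|]
     itself. *)
  have [/and3P[n0 n1 l1]|cn] := boolP [&& (N0 <= n)%N, (1 < n)%N & 1 <= ln (n%:R : R)]; last first.
    exists (fun w : U => maxabs (k n ^ p) (w.1.2)); split.
    - exact: (measurableT_comp (measurable_maxabs _) mgauss).
    - move=> A mA; apply: gauss_law; rewrite -[X in measurable X]setTI; exact: measurable_maxabs.
    - by move=> n0 n1 l1; move: cn; rewrite n0 n1 l1.
  have lnN : ln ((k n ^ p)%:R : R) <= B * ln n%:R.
    have k0 : 0 < (k n)%:R :> R by rewrite ltr0n.
    rewrite natrX lnXn// -[leLHS]mulr_natl /B -[leRHS]mulrA; apply: ler_wpM2l => //.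
    apply: (le_trans (lnk n n0)); apply: ler_wpM2r; last exact: ler_norm.
    exact: le_trans l1.
  move: (k_gt0 n) lnN; case: (k n) => // k' _ lnN.
  have [S [mS lawS closeS]] := stat_coupling mX meps HXcube fX_ge0 HfX cX_gt0 fX_bnd Hmean Hsig2
    cs_gt0 sig2_bnd abs3 g3_le' (normr_ge0 M3) nu_ge4 Hnu B0 n1 l1 lnN.
  by exists S; split.
have [S HS] := choice ex.
exists _, U, P', Xs, es, Z, S; split.
- split.
    by move=> i; split; [exact: (measurableT_comp mX (mcoord i))|exact: (measurableT_comp meps
      (mcoord i))].
  exact: (mutually_independent_coord data_law mpair).
- move=> i A mA.
  have mB : measurable ((fun t => (X t, eps t)) @^-1` A).
    by rewrite -[X in measurable X]setTI; exact: mpair.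
  rewrite -(seq_measure_coord P i mB); apply: data_law.
  by rewrite -[X in measurable X]setTI; exact: measurable_coord.
- have mZ j : measurable_fun setT (Z j).
    exact: (measurableT_comp (@measurable_coord _ (RR R) j) mgauss).
  split; first exact: mZ; split.
    exact: (@mutually_independent_coord _ (RR R) R (@std_normal R) _ U P' (fun w => w.1.2) _ R id).
  move=> j A mA; rewrite -[RHS](@seq_measure_coord _ (RR R) _ (@std_normal R) j A mA).
  apply: gauss_law; rewrite -[X in measurable X]setTI; exact: (@measurable_coord _ (RR R) j).
- split; first by move=> n; have [mS _ _] := HS n.
  move=> n A mA; have [_ lawS _] := HS n; rewrite lawS//; symmetry; apply: gauss_law.
  by rewrite -[X in measurable X]setTI; exact: measurable_maxabs.
(* The constant is the same for every [eta], since the failure probability [D / ln n] tends to 0;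
   [eta] only decides how large [n] must be. *)
move=> eta eta0; exists (2 * (6 + 2 * B)).
pose lmin := Num.max 1 (D / eta).
pose n1 := (Num.truncn (expR lmin)).+1.
exists (maxn N0 (maxn 2 n1)) => n; rewrite !geq_max => /and3P[n0 n2 nn1].
have nR : 0 < n%:R :> R by rewrite ltr0n (leq_trans _ n2).
have lge : lmin <= ln (n%:R : R).
  rewrite -ler_expR lnK ?posrE//; apply: le_trans (ltW (truncnS_gt _)) _.
  by rewrite ler_nat.
have l1 : 1 <= ln (n%:R : R) by apply: le_trans lge; rewrite le_max lexx.
have l0 : 0 < ln (n%:R : R) by exact: lt_le_trans l1.
have [_ _ /(_ n0 n2 l1) close] := HS n.
have rate_ge : rate_tail p (k n) n nu + rate_lindeberg R p (k n) n <= rate p nu k n.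
  rewrite /rate -/(rate_tail p (k n) n nu) -/(rate_lindeberg R p (k n) n) lerD2r lerDl.
  by rewrite divr_ge0 ?powR_ge0// mulr_ge0 ?powR_ge0.
have h : 2 * ((6 + 2 * B) * (rate_tail p (k n) n nu + rate_lindeberg R p (k n) n)) <=
    2 * (6 + 2 * B) * rate p nu k n.
  rewrite -mulrA; apply: ler_wpM2l => //; apply: ler_wpM2l => //.
  by rewrite addr_ge0// mulr_ge0.
have := close _ h; under eq_set do rewrite -[X in (_ < X)%R]normr_id.
move=> /le_trans; apply; rewrite lee_fin ler_pdivrMr// mulrC -ler_pdivrMr//.
by apply: le_trans lge; rewrite le_max lexx orbT.
Qed.
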